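(* Let $\mu \ge 0$, $0 < \nu \le 1$ and $a > 0$, and for $\mu' \ge 0$ and $a'>0$ let $R_{\mu',\nu}(a',t) = \mathcal{L}^{-1}\{s^{-\mu'} e^{-a' s^{\nu}};t\}$. Then $$R_{\mu+\nu,\nu}(a,t) = \int_a^\infty R_{\mu,\nu}(a',t)\, da', \quad t > 0.$$
   Context: $\mathcal{L}\{y(t);s\} = \int_0^\infty e^{-st} y(t)\, dt$ denotes the Laplace transform and $\mathcal{L}^{-1}$ its inverse; $s^{\nu}$ is the principal branch. For $\nu=1$ the inverse transform is understood in the sense of distributions where necessary (e.g. $R_{0,1}(a,t) = \delta(t-a)$ with $\delta$ the Dirac delta). *)

(* Defs.v *)
From HB Require Import structures.
From mathcomp Require Import all_boot all_order all_algebra.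
From mathcomp Require Import complex.
From mathcomp Require Import all_classical all_reals all_analysis.

Set Implicit Arguments.
Unset Strict Implicit.
Unset Printing Implicit Defensive.

Import Order.TTheory GRing.Theory Num.Theory.
Import numFieldNormedType.Exports.

Local Open Scope classical_set_scope.
Local Open Scope ring_scope.
Local Open Scope complex_scope.

Definition cexp {R : realType} (z : R[i]) : R[i] :=
  (expR (complex.Re z) * cos (complex.Im z)) +i*
  (expR (complex.Re z) * sin (complex.Im z)).

Definition cmod {R : realType} (z : R[i]) : R :=
  Num.sqrt (complex.Re z ^+ 2 + complex.Im z ^+ 2).

(* Principal argument, in ]-pi, pi]; the value at 0 is irrelevant. *)
Definition carg {R : realType} (z : R[i]) : R :=
  if 0 <= complex.Im z then acos (complex.Re z / cmod z)
  else - acos (complex.Re z / cmod z).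

(* Principal branch of the logarithm and of s ^ p, for s != 0. *)
Definition cln {R : realType} (z : R[i]) : R[i] := ln (cmod z) +i* carg z.

Definition cpow {R : realType} (s : R[i]) (p : R) : R[i] :=
  cexp (p%:C * cln s).

Definition cintegrable {R : realType} (D : set R) (f : R -> R[i]) : Prop :=
  (@lebesgue_measure R).-integrable D (fun x => (complex.Re (f x))%:E) /\
  (@lebesgue_measure R).-integrable D (fun x => (complex.Im (f x))%:E).

Definition cintegral {R : realType} (D : set R) (f : R -> R[i]) : R[i] :=
  Rintegral (@lebesgue_measure R) D (fun x => complex.Re (f x)) +i*
  Rintegral (@lebesgue_measure R) D (fun x => complex.Im (f x)).

Definition laplace_cvg {R : realType} (y : R -> R[i]) (s : R[i]) : Prop :=
  cintegrable `[0, +oo[ (fun t => cexp (- s * t%:C) * y t).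

Definition laplace {R : realType} (y : R -> R[i]) (s : R[i]) : R[i] :=
  cintegral `[0, +oo[ (fun t => cexp (- s * t%:C) * y t).

Definition ccontinuous_at {R : realType} (y : R -> R[i]) (t : R) : Prop :=
  {for t, continuous (fun x => complex.Re (y x))} /\
  {for t, continuous (fun x => complex.Im (y x))}.

(* A Laplace transform determines y only up to a Lebesgue-null set. To give
   pointwise values a meaning we take the representative that is continuous at
   every t > 0 where some representative is continuous. *)
Definition regular_representative {R : realType} (y : R -> R[i]) : Prop :=
  forall (t : R) (z : R -> R[i]), 0 < t ->
    {ae @lebesgue_measure R, forall x, 0 < x -> z x = y x} ->
    ccontinuous_at z t -> ccontinuous_at y t.

(* y(t) = L^-1{F; t} as a function on t > 0. *)
Definition inverse_laplace {R : realType} (F : R[i] -> R[i]) (y : R -> R[i])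
    : Prop :=
  (exists sigma : R, forall s : R[i], sigma < complex.Re s ->
     laplace_cvg y s /\ laplace y s = F s) /\
  regular_representative y.

(* Laplace-transformable distributions supported in [0, +oo[ are encoded as
   continuous linear functionals on the space [laplace_test c] of smooth
   functions decaying, with all their derivatives, like exp(-ct) at +oo. The
   seminorms only look at [0, +oo[, which encodes the support condition. The
   test functions are real; complex ones are handled by linearity. *)
Definition smooth {R : realType} (phi : R -> R) : Prop :=
  forall (k : nat) (x : R), derivable (derive1n k phi) x 1.

Definition laplace_test {R : realType} (c : R) (phi : R -> R) : Prop :=
  smooth phi /\
  forall k : nat, exists M : R, forall t : R, 0 <= t ->
    expR (c * t) * `|derive1n k phi t| <= M.

Definition laplace_distribution {R : realType} (c : R)
    (T : (R -> R) -> R[i]) : Prop :=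
  (forall (r : R) (phi psi : R -> R),
     laplace_test c phi -> laplace_test c psi ->
     T (fun x => r * phi x + psi x) = r%:C * T phi + T psi) /\
  (exists (N : nat) (K : R), forall (phi : R -> R) (M : R),
     laplace_test c phi ->
     (forall (k : nat) (t : R), (k <= N)%N -> 0 <= t ->
        expR (c * t) * `|derive1n k phi t| <= M) ->
     cmod (T phi) <= K * M).

(* The pairing of T with t |-> exp(-st), which lies in the test space as soon
   as c <= complex.Re s. *)
Definition laplace_distr {R : realType} (T : (R -> R) -> R[i]) (s : R[i])
    : R[i] :=
  T (fun t => complex.Re (cexp (- s * t%:C))) +
  (0 +i* 1) * T (fun t => complex.Im (cexp (- s * t%:C))).

Definition inverse_laplace_distr {R : realType} (F : R[i] -> R[i])
    (T : (R -> R) -> R[i]) : Prop :=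
  exists c : R, laplace_distribution c T /\
    forall s : R[i], c < complex.Re s -> laplace_distr T s = F s.

(* C^oo functions with compact support in ]0, +oo[. *)
Definition test_function_pos {R : realType} (phi : R -> R) : Prop :=
  smooth phi /\
  exists l r : R, 0 < l /\ forall x, x < l \/ r < x -> phi x = 0.

Definition R_symbol {R : realType} (mu nu a : R) (s : R[i]) : R[i] :=
  cpow s (- mu) * cexp (- a%:C * cpow s nu).

(* The inverse transform of R_symbol mu nu a is a function unless nu = 1 and
   mu = 0, where it is the Dirac delta at a. *)
Definition R_is_function {R : realType} (mu nu : R) : Prop :=
  nu < 1 \/ 0 < mu.

(* Main.v *)
Require Import Defs.
From HB Require Import structures.
From mathcomp Require Import all_boot all_order all_algebra.
From mathcomp Require Import complex.
From mathcomp Require Import ring lra.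
From mathcomp Require Import all_classical all_reals all_analysis measurable_realfun.

Set Implicit Arguments.
Unset Strict Implicit.
Unset Printing Implicit Defensive.

Import Order.TTheory GRing.Theory Num.Theory.
Import numFieldNormedType.Exports.

Local Open Scope classical_set_scope.
Local Open Scope ring_scope.
Local Open Scope complex_scope.

(** Let [F_(mu,a) s = s^(-mu) exp(-a s^nu)].

For [nu = 1] the inverse transforms are explicit: [(t - a)^(mu-1) / Gamma mu] on
[t > a], and the Dirac delta at [a] for [mu = 0]. They are identified by Lerch's
theorem: the values of a Laplace transform at the integers are the moments
against the polynomials in [exp(-t)], which approximate every function on
[t > 0] of compact support, with as many derivatives as wanted in the
distributional case.

For [nu < 1] the symbol decays like [exp(-c a |w|^nu)] on each line
[Re s = sigma], so Fourier inversion on this line identifies the inverse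
transform with a continuous Bromwich integral. Integrating in [a] under this
integral (Fubini) divides the symbol by [s^nu]. This needs the same [sigma] for
all [a' >= a], although each [R_(mu,nu)(a', t)] comes with its own abscissa of
convergence: by homogeneity [R_(mu,nu)(a', t)] is a rescaling of
[R_(mu,nu)(a, t)] with factor [(a'/a)^(1/nu) >= 1], hence its transform
converges wherever that of [R_(mu,nu)(a, t)] does. *)

(** * Integration over the real line *)

(** The inverse transforms are assumed rather than constructed, so the proof only ever identifies a
    given function with an explicit one. No contour is deformed: that the Bromwich integral is the
    same on two lines is read off from a function whose transform is known on both. Equality of
    transforms gives equality almost everywhere; [regular_representative] turns it into a value
    wherever the explicit function is continuous. For [nu = 1] and order at most 1 continuity fails
    at [t = a'], so one point of the range of integration stays undetermined. Fourier inversion is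
    proved as an equality of integrals over intervals, by Abel summation. The smoothed kernel then
    integrates to a difference of arctangents, whose limit needs only dominated convergence, and
    Lebesgue differentiation gives the equality almost everywhere. *)

Section dominated_fubini.
Context {R : realType}.
Notation mu := (@lebesgue_measure R).

Lemma le_integrable_EFin (D : set R) (f g : R -> R) : measurable D ->
  measurable_fun D f -> (forall x, D x -> `|f x| <= g x) ->
  mu.-integrable D (EFin \o g) -> mu.-integrable D (EFin \o f).
Proof.
move=> mD mf fg; apply: le_integrable => //; first exact/measurable_EFinP.
by move=> x Dx /=; rewrite lee_fin (le_trans (fg _ Dx))// ler_norm.
Qed.

Lemma le_normr_Rintegral_dom (D : set R) (f g : R -> R) : measurable D ->
  measurable_fun D f -> (forall x, D x -> `|f x| <= g x) ->
  mu.-integrable D (EFin \o g) ->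
  `|\int[mu]_(x in D) f x| <= \int[mu]_(x in D) g x.
Proof.
move=> mD mf fg ig.
have intf : mu.-integrable D (EFin \o f) by exact: le_integrable_EFin ig.
apply: (@le_trans _ _ (\int[mu]_(x in D) `|f x|)).
  exact: le_normr_Rintegral.
apply: le_Rintegral => //; exact: integrable_norm.
Qed.

Lemma integrableZl_EFin (D : set R) c (f : R -> R) : measurable D ->
  mu.-integrable D (EFin \o f) ->
  mu.-integrable D (EFin \o (fun x => c * f x)).
Proof. by move=> mD; exact: integrableZl. Qed.

Lemma integrableD_EFin (D : set R) (f g : R -> R) : measurable D ->
  mu.-integrable D (EFin \o f) -> mu.-integrable D (EFin \o g) ->
  mu.-integrable D (EFin \o (fun x => f x + g x)).
Proof. by move=> mD; exact: integrableD. Qed.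

Lemma integrableB_EFin (D : set R) (f g : R -> R) : measurable D ->
  mu.-integrable D (EFin \o f) -> mu.-integrable D (EFin \o g) ->
  mu.-integrable D (EFin \o (fun x => f x - g x)).
Proof. by move=> mD; exact: integrableB. Qed.

(** A bound in product form reduces integrability on the product to one-variable facts, since the
    iterated integral of the bound is the product of two finite integrals. Integrability of the
    inner integral is returned as well, because the theorem claims it. *)
Lemma Fubini_dominated (D E : set R) (f : R -> R -> R) (g h : R -> R) :
  measurable D -> measurable E ->
  measurable_fun (D `*` E) (fun z : R * R => f z.1 z.2) ->
  mu.-integrable D (EFin \o g) -> mu.-integrable E (EFin \o h) ->
  (forall x y, D x -> E y -> `|f x y| <= g x * h y) ->
  mu.-integrable D (EFin \o (fun x => \int[mu]_(y in E) f x y)) /\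
  \int[mu]_(x in D) \int[mu]_(y in E) f x y =
  \int[mu]_(y in E) \int[mu]_(x in D) f x y.
Proof.
move=> mD mE mf ig ih fgh.
(* Extension by zero, so that Fubini on the whole plane applies. *)
pose F : R * R -> \bar R := (EFin \o (fun z : R * R => f z.1 z.2)) \_ (D `*` E).
have mDE : measurable (D `*` E) by exact: measurableX.
have mF : measurable_fun [set: R * R] F.
  by apply/(measurable_restrictT _ mDE)/measurable_EFinP.
have FE x y : F (x, y) = (((f x) \_ E) y * \1_D x)%:E.
  rewrite /F /patch/= indicE in_setX.
  case: (x \in D) => /=; rewrite ?mulr0// mulr1.
  by case: (y \in E).
have FDE x y : F (x, y) = (((f ^~ y) \_ D) x * \1_E y)%:E.
  rewrite /F /patch/= indicE in_setX.
  case: (x \in D) => /=; rewrite ?mul0r//.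
  by case: (y \in E); rewrite ?mulr1 ?mulr0.
have iF : (mu \x mu)%E.-integrable setT F.
  apply/integrable12ltyP => //.
  (* Only the product [g x * h y] is known to be nonnegative, not each factor, hence the absolute
     values. *)
  pose G := fun x => `|(g \_ D) x|; pose H := fun x => `|(h \_ E) x|.
  have iG : mu.-integrable setT (EFin \o G).
    apply: integrable_norm => //.
    by have := (@integrable_mkcond _ _ _ mu _ (EFin \o g) mD).1 ig; rewrite restrict_EFin.
  have iH : mu.-integrable setT (EFin \o H).
    apply: integrable_norm => //.
    by have := (@integrable_mkcond _ _ _ mu _ (EFin \o h) mE).1 ih; rewrite restrict_EFin.
  have IHfin : (\int[mu]_y (H y)%:E)%E \is a fin_num.
    exact: integrable_fin_num.
  apply: (@le_lt_trans _ _ (\int[mu]_x ((fine (\int[mu]_y (H y)%:E))%:E * (G x)%:E))%E).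
    apply: ge0_le_integral => //.
    - by move=> x _; exact: integral_ge0.
    - have mFa : measurable_fun [set: R * R] (abse \o F).
        exact: measurableT_comp.
      exact: (@measurable_fun_fubini_tonelli_F _ _ _ _ _ mu _ mFa (fun z => abse_ge0 _)).
    - by apply: measurable_funeM; exact: measurable_int iG.
    - move=> x _; rewrite fineK// muleC.
      have mH := measurable_int _ iH.
      have H0 y : setT y -> (0 <= (H y)%:E)%E by move=> _; rewrite lee_fin /H.
      have G0 : (0 <= (G x)%:E)%E by rewrite lee_fin /G.
      rewrite -(ge0_integralZl _ measurableT mH H0 G0).
      apply: ge0_le_integral => //.
        + apply: measurableT_comp => //.
          exact: (measurableT_comp mF (measurable_pair1 x)).
        + by apply: measurable_funeM; exact: measurable_int iH.
        + move=> y _; rewrite /F /G /H /patch in_setX/=.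
          case: ifPn => [/andP[/= xD yE]|_]; last by rewrite abse0 mule_ge0// lee_fin.
          rewrite xD yE lee_fin/= -normrM.
          by rewrite (le_trans (fgh _ _ _ _))// ?ler_norm//; exact: set_mem.
  rewrite integralZl//; apply: lte_mul_pinfty => //.
    by rewrite lee_fin fine_ge0// integral_ge0// => y _; rewrite lee_fin /H.
  by apply: integrable_lty.
have ifx x : D x -> mu.-integrable E (EFin \o f x).
  move=> Dx; apply: (@le_integrable_EFin _ _ (fun y => g x * h y)) => //.
  - have -> : f x = (fun z : R * R => f z.1 z.2) \o pair x by [].
    apply: (measurable_comp mDE _ mf); first by move=> _ [y Ey <-].
    exact: (measurable_funS measurableT).
  - by move=> y Ey; exact: fgh.
  - exact: integrableZl_EFin.
have ify y : E y -> mu.-integrable D (EFin \o f ^~ y).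
  move=> Ey; apply: (@le_integrable_EFin _ _ (fun x => h y * g x)) => //.
  - have -> : f ^~ y = (fun z : R * R => f z.1 z.2) \o (fun x => (x, y)) by [].
    apply: (measurable_comp mDE _ mf); first by move=> _ [x Dx <-].
    exact: (measurable_funS measurableT).
  - by move=> x Dx; rewrite mulrC; exact: fgh.
  - exact: integrableZl_EFin.
have inF x : (\int[mu]_y F (x, y) = ((fun x => \int[mu]_(y in E) f x y) \_ D x)%:E)%E.
  under eq_integral do rewrite FE.
  rewrite patchE; case: ifPn => xD.
    rewrite /Rintegral fineK; last exact/integrable_fin_num/ifx/set_mem.
    rewrite [RHS]integral_mkcond; apply: eq_integral => y _.
    by rewrite indicE xD mulr1 restrict_EFin.
  rewrite integral0_eq// => y _; rewrite indicE (negbTE xD) mulr0//.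
have inF' y : (\int[mu]_x F (x, y) = ((fun y => \int[mu]_(x in D) f x y) \_ E y)%:E)%E.
  under eq_integral do rewrite FDE.
  rewrite patchE; case: ifPn => yE.
    rewrite /Rintegral fineK; last exact/integrable_fin_num/ify/set_mem.
    rewrite [RHS]integral_mkcond; apply: eq_integral => x _.
    by rewrite indicE yE mulr1 restrict_EFin.
  by rewrite integral0_eq// => x _; rewrite indicE (negbTE yE) mulr0.
split.
  apply/(@integrable_mkcond _ _ _ mu _ (EFin \o _) mD); rewrite restrict_EFin.
  have := integrable_fubini_F iF.
  by apply: eq_integrable => // x _; rewrite /fubini_F inF.
have := Fubini iF.
under eq_integral do rewrite inF.
under [in X in _ = X -> _]eq_integral do rewrite inF'.
by rewrite [in X in _ -> X]Rintegral_mkcond [in X in _ -> _ = X]Rintegral_mkcond => /(congr1 fine).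
Qed.

End dominated_fubini.

(** * Affine change of variable *)

Section affine_change_of_variable.
Context {R : realType}.
Notation mu := (@lebesgue_measure R).

Lemma measurable_affine (k b : R) : measurable_fun setT (fun x : R => k * x + b).
Proof.
apply: continuous_measurable_fun => x.
by apply: cvgD; [apply: cvgM; [exact: cvg_cst|exact: cvg_id]|exact: cvg_cst].
Qed.

(** The image of Lebesgue measure under the affine map, rescaled by [k], gives half-open intervals
    their length, which characterises Lebesgue measure. *)
Lemma lebesgue_measure_affine (k b : R) (A : set (measurableTypeR R)) :
  0 < k -> measurable A ->
  mu A = (k%:E * mu ((fun x : R => (k * x + b)%R) @^-1` A))%E.
Proof.
move=> k0 mA.
pose phi := fun x : R => k * x + b.
have mphi : measurable_fun [set: measurableTypeR R] (phi : _ -> measurableTypeR R).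
  exact: measurable_affine.
have [pm pmE] : exists pm : {measure set (measurableTypeR R) -> \bar R},
    forall B, pm B = mu (phi @^-1` B).
  by exists (measure_function_pushforward__canonical__measure_function_Measure mu mphi).
pose m := mscale (NngNum (ltW k0)) pm.
have mE B : m B = (k%:E * mu (phi @^-1` B))%E by rewrite /m/mscale/= pmE.
rewrite -mE; apply: lebesgue_measure_unique => //.
move=> X /= [[x y] _ <-] /=; rewrite -[RHS]/(m _) mE /=.
have -> : phi @^-1` `]x, y] = [set` `](x - b) / k, (y - b) / k]].
  apply/seteqP; split => z /=; rewrite !in_itv/= /phi;
  by rewrite ltr_pdivrMr// ler_pdivlMr// ltrBlDr lerBrDr (mulrC z).
rewrite [LHS]lebesgue_measure_itv/= lebesgue_measure_itv/= !lte_fin.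
rewrite ltr_pM2r ?invr_gt0// ltrD2r.
case: ifPn => _; last by rewrite mule0.
by rewrite -!EFinD -EFinM; congr EFin; field; exact: lt0r_neq0.
Qed.

Lemma ge0_integral_affine (k b : R) (f : R -> R) (D : set R) : 0 < k ->
  measurable D -> measurable_fun D f -> (forall x, D x -> 0 <= f x) ->
  (\int[mu]_(x in D) (f x)%:E =
  k%:E * \int[mu]_(x in (fun x => k * x + b)%R @^-1` D) (f (k * x + b)%R)%:E)%E.
Proof.
move=> k0 mD mf f0.
pose phi := fun x : R => k * x + b.
have mphi : measurable_fun [set: measurableTypeR R] (phi : _ -> measurableTypeR R).
  exact: measurable_affine.
pose pm := measure_function_pushforward__canonical__measure_function_Measure mu mphi.
pose m := mscale (NngNum (ltW k0)) pm.
rewrite (@eq_measure_integral _ _ _ _ m); last first.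
  by move=> A mA _; exact: lebesgue_measure_affine.
rewrite ge0_integral_mscale//; last exact/measurable_EFinP.
rewrite [in LHS]ge0_integral_pushforward//; first exact/measurable_EFinP.
by move=> x; rewrite inE => Dx; rewrite lee_fin f0.
Qed.

Lemma integrable_affine (k b : R) (f : R -> R) (D : set R) : 0 < k ->
  measurable D -> mu.-integrable D (EFin \o f) ->
  mu.-integrable ((fun x => k * x + b) @^-1` D) (EFin \o (fun x => f (k * x + b))).
Proof.
move=> k0 mD intf; have /integrableP[/measurable_EFinP mf foo] := intf.
apply/integrableP; split.
  apply/measurable_EFinP; apply: (measurable_comp mD _ mf).
    by move=> _ [x Dx <-].
  by apply: (measurable_funS measurableT) => //; exact: measurable_affine.
move: foo.
have -> : (\int[mu]_(x in D) `|(EFin \o f) x| = \int[mu]_(x in D) (`|f x|%R)%:E)%E by [].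
rewrite (@ge0_integral_affine k b (fun x => `|f x|))//; last exact: measurableT_comp.
move=> foo; rewrite ltNge leye_eq; apply/negP => /eqP oo.
by move: foo; rewrite [X in (_ * X)%E]oo gt0_muley ?lte_fin// ltxx.
Qed.

Lemma Rintegral_affine (k b : R) (f : R -> R) (D : set R) : 0 < k ->
  measurable D -> mu.-integrable D (EFin \o f) ->
  \int[mu]_(x in D) f x =
  k * \int[mu]_(x in (fun x => k * x + b) @^-1` D) f (k * x + b).
Proof.
move=> k0 mD intf; have /measurable_int/measurable_EFinP mf := intf.
have mD' : measurable ((fun x => k * x + b) @^-1` D).
  by rewrite -[X in measurable X]setTI; exact: measurable_affine.
have intp : mu.-integrable D (EFin \o f^\+) by exact: integrable_funrpos.
have intn : mu.-integrable D (EFin \o f^\-) by exact: integrable_funrneg.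
have -> : \int[mu]_(x in D) f x = \int[mu]_(x in D) f^\+ x - \int[mu]_(x in D) f^\- x.
  by rewrite -RintegralB//; apply: eq_Rintegral => x _; rewrite -[in LHS](funrposBneg f).
have ia := @integrable_affine k b _ _ k0 mD.
have -> : \int[mu]_(x in (fun x => k * x + b) @^-1` D) f (k * x + b) =
  \int[mu]_(x in (fun x => k * x + b) @^-1` D) f^\+ (k * x + b) -
  \int[mu]_(x in (fun x => k * x + b) @^-1` D) f^\- (k * x + b).
  rewrite -RintegralB//; [|exact: (ia f^\+)|exact: (ia f^\-)].
  by apply: eq_Rintegral => x _; rewrite -[in LHS](funrposBneg f).
rewrite mulrBr; congr (_ - _); rewrite /Rintegral.
- rewrite (@ge0_integral_affine k b _ _ k0 mD (measurable_funrpos mf) (fun x _ => funrpos_ge0 f x)).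
  by rewrite fineM// (@integrable_fin_num _ _ _ mu _ mD' _ (ia _ intp)).
- rewrite (@ge0_integral_affine k b _ _ k0 mD (measurable_funrneg mf) (fun x _ => funrneg_ge0 f x)).
  by rewrite fineM// (@integrable_fin_num _ _ _ mu _ mD' _ (ia _ intn)).
Qed.

End affine_change_of_variable.

(** * Limits of integrals and the fundamental theorem of calculus *)

Section convergence_and_FTC.
Context {R : realType}.
Notation mu := (@lebesgue_measure R).

(** If the values at [t] differed, they would differ on a ball, which has positive measure. *)
Lemma ae_continuous_eq (f g : R -> R) (t : R) : 0 < t ->
  {ae mu, forall x, 0 < x -> f x = g x} ->
  {for t, continuous f} -> {for t, continuous g} -> f t = g t.
Proof.
move=> t0 [N [mN N0 sub]] cf cg; apply/eqP/negPn/negP => fg.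
have cfg : {for t, continuous (fun x => f x - g x)} by exact: cvgB.
have : \forall x \near t, f x - g x != 0.
  have /cvgr_neq0 := cfg; apply.
  by rewrite subr_eq0.
case=> e /= e0 He.
have t2 : \forall x \near t, 0 < x by exact: lt_nbhsr.
case: t2 => d /= d0 Hd.
pose r := Num.min e d.
have r0 : 0 < r by rewrite lt_min e0.
have : mu (ball t r) = 0%E.
  apply: (@subset_measure0 _ _ _ mu _ N) => //; first exact: measurable_ball.
  move=> x bx; apply: sub => /= H.
  have := He x; rewrite subr_eq0 => /(_ _)/negP; apply.
    by rewrite /ball/= (lt_le_trans bx)// ge_min lexx.
  by apply/eqP/H/Hd; rewrite /ball/= (lt_le_trans bx)// ge_min lexx orbT.
rewrite lebesgue_measure_ball; last exact: ltW.
by move=> /eqP; rewrite eqe mulrn_eq0/= gt_eqF.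
Qed.

Lemma Rdominated_convergence (D : set R) (f_ : nat -> R -> R) (f g : R -> R) :
  measurable D -> (forall n, measurable_fun D (f_ n)) ->
  (forall x, D x -> f_ n x @[n --> \oo] --> f x) ->
  mu.-integrable D (EFin \o g) ->
  (forall n x, D x -> `|f_ n x| <= g x) ->
  mu.-integrable D (EFin \o f) /\
  \int[mu]_(x in D) f_ n x @[n --> \oo] --> \int[mu]_(x in D) f x.
Proof.
move=> mD mf_ f_f intg f_g.
have mf : measurable_fun D f by exact: (measurable_fun_cvg mf_).
have mfE_ n : measurable_fun D (EFin \o f_ n) by exact/measurable_EFinP.
have mfE : measurable_fun D (EFin \o f) by exact/measurable_EFinP.
have aef_f : {ae mu, forall x, D x -> (EFin \o f_ n) x @[n --> \oo] --> (EFin \o f) x}.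
  by apply: aeW => x Dx; apply: cvg_EFin; [exact: nearW|exact: f_f].
have aef_g : {ae mu, forall x n, D x -> (`|(EFin \o f_ n) x| <= (EFin \o g) x)%E}.
  by apply: aeW => x n Dx; rewrite /= lee_fin f_g.
have [intf _ lim] := @dominated_convergence _ _ R mu D mD (fun n => EFin \o f_ n)
  (EFin \o f) (EFin \o g) mfE_ mfE aef_f intg aef_g.
split=> //; apply: fine_cvg.
rewrite /Rintegral fineK//.
exact: (@integrable_fin_num _ _ _ mu).
Qed.

Lemma Rintegral_FTC2 (f F : R -> R) (p q : R) : p < q ->
  (forall x, is_derive x (1 : R) F (f x)) -> continuous f ->
  \int[mu]_(x in `[p, q]) f x = F q - F p.
Proof.
move=> pq dF cf.
have cF : continuous F.
  by move=> x; apply/differentiable_continuous/derivable1_diffP; exact: ex_derive.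
have dLR : derivable_oo_LRcontinuous F p q.
  split.
  - by move=> x _; exact: ex_derive.
  - by apply: cvg_at_right_filter; exact: cF.
  - by apply: cvg_at_left_filter; exact: cF.
have dFE : {in `]p, q[, derive1 F =1 f}.
  by move=> x _; rewrite derive1E derive_val.
by rewrite /Rintegral (continuous_FTC2 pq (continuous_subspaceT cf) dLR dFE).
Qed.

Lemma Rintegral_FTC2y (f F : R -> R) (a l : R) :
  (forall x, is_derive x (1 : R) F (f x)) -> continuous f ->
  mu.-integrable `[a, +oo[ (EFin \o f) -> F x @[x --> +oo] --> l ->
  \int[mu]_(x in `[a, +oo[) f x = l - F a.
Proof.
move=> dF cf intf Fl.
have FTC n : \int[mu]_(x in `[a, a + n.+1%:R]) f x = F (a + n.+1%:R) - F a.
  by apply: Rintegral_FTC2 => //; rewrite ltrDl.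
have lim1 : \int[mu]_(x in `[a, a + n.+1%:R]) f x @[n --> \oo] --> l - F a.
  under eq_fun do rewrite FTC.
  apply: cvgB; last exact: cvg_cst.
  apply: (cvg_comp _ _ _ Fl).
  apply/cvgryPge => M; near=> n.
  rewrite -lerBlDl (@le_trans _ _ n%:R)// ?ler_nat//.
  by near: n; exact: nbhs_infty_ger.
have mf : measurable_fun setT f by exact: continuous_measurable_fun.
pose D : set R := [set` `[a, +oo[].
have mD : measurable D by exact: measurable_itv.
pose f_ (n : nat) := f \_ [set` `[a, a + n.+1%:R]].
have mf_ n : measurable_fun D (f_ n).
  apply: (measurable_funS measurableT) => //.
  apply/(@measurable_restrictT _ _ _ _ _ f (measurable_itv `[a, a + n.+1%:R])).
  exact: (measurable_funS measurableT).
have f_f x : D x -> f_ n x @[n --> \oo] --> f x.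
  rewrite /D/= in_itv/= andbT => ax.
  apply: cvg_near_cst; near=> n; rewrite /= /f_ patchE mem_set//= in_itv/= ax/=.
  rewrite -lerBlDl (@le_trans _ _ n%:R)// ?ler_nat//.
  by near: n; exact: nbhs_infty_ger.
have f_g n x : D x -> `|f_ n x| <= `|f x|.
  by move=> Dx; rewrite /f_ patchE; case: ifPn => //; rewrite normr0.
have ig : mu.-integrable D (EFin \o (fun x => `|f x|)) by exact: integrable_norm.
have [_] := Rdominated_convergence mD mf_ f_f ig f_g.
have -> : (fun n => \int[mu]_(x in D) f_ n x) =
          (fun n => \int[mu]_(x in `[a, a + n.+1%:R]) f x).
  apply/funext => n; rewrite /f_ -Rintegral_mkcondr; congr (Rintegral _ _ _).
  apply/seteqP; split => x /=; rewrite /D/= !in_itv/= ?andbT; first by case.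
  by move=> /andP[-> ->].
by move=> lim2; exact: (cvg_unique _ lim2 lim1).
Unshelve. all: by end_near. Qed.

(** By Lebesgue differentiation [f] is almost everywhere the derivative of its primitive from [-oo],
    and the hypothesis makes this primitive constant on the positive axis. *)
Lemma ae_eq0_itv (f : R -> R) : mu.-integrable `[0, +oo[ (EFin \o f) ->
  (forall p q, 0 < p -> p < q -> \int[mu]_(x in `]p, q]) f x = 0) ->
  {ae mu, forall x, 0 < x -> f x = 0}.
Proof.
move=> intf f0.
pose D : set R := [set` `[0, +oo[].
have mD : measurable D by exact: measurable_itv.
pose g := f \_ D.
have intg : mu.-integrable setT (EFin \o g).
  by rewrite -restrict_EFin; exact/(@integrable_mkcond _ _ _ mu _ (EFin \o f) mD).
have intgy y : mu.-integrable `]-oo, y] (EFin \o g).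
  by apply: integrableS intg.
have lg : locally_integrable setT g by exact: integrable_locally.
have := @FTC1Ny R g intgy lg.
apply: filterS; first exact: (ae_filter_ringOfSetsType mu).
move=> x /= [dF Fx] x0.
have <- : g x = f x by rewrite /g patchE mem_set// /D/= in_itv/= ltW.
rewrite -Fx derive1E; apply: (@derive_val _ _ _ x 1 _ 0).
apply: (near_eq_is_derive (f := cst (\int[mu]_(t in `]-oo, x]) g t))).
have Fpq p q : 0 < p -> p < q ->
    \int[mu]_(t in `]-oo, p]) g t = \int[mu]_(t in `]-oo, q]) g t.
  move=> p0 pq; apply/eqP; rewrite eq_sym -subr_eq0.
  rewrite (@Rintegral_itvB _ g -oo%O (BRight q) p)//; last by rewrite bnd_simp ltW.
  apply/eqP; rewrite -[RHS](f0 p q p0 pq).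
  apply: eq_Rintegral => y; rewrite inE/= in_itv/= => /andP[py _].
  by rewrite /g patchE mem_set// /D/= in_itv/= andbT (le_trans (ltW p0))// ltW.
near=> y => /=.
have y0 : 0 < y by near: y; exact: lt_nbhsr.
by have [xy|yx|->//] := ltgtP x y; [exact: Fpq|apply/esym/Fpq].
Unshelve. all: by end_near. Qed.

End convergence_and_FTC.

(** * Uniqueness of Laplace transforms *)

Section weierstrass.
Context {R : realType}.

(* The mean of [g (k)] for [k] binomial of parameters [n] and [x]. *)
Fixpoint bernstein_mean (n : nat) (x : R) (g : nat -> R) : R :=
  if n is n'.+1 then
    x * bernstein_mean n' x (g \o succn) + (1 - x) * bernstein_mean n' x g
  else g 0%N.

Fixpoint bernstein_poly (n : nat) (g : nat -> R) : {poly R} :=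
  if n is n'.+1 then
    'X * bernstein_poly n' (g \o succn) + (1 - 'X) * bernstein_poly n' g
  else (g 0%N)%:P.

Lemma horner_bernstein_poly n x g :
  (bernstein_poly n g).[x] = bernstein_mean n x g.
Proof. by elim: n g => [|n IH] g /=; rewrite !hornerE// !IH. Qed.

Lemma bernstein_meanD n x g h :
  bernstein_mean n x (fun k => g k + h k) =
  bernstein_mean n x g + bernstein_mean n x h.
Proof.
elim: n g h => [|n IH] g h //=.
by rewrite (IH (g \o succn) (h \o succn)) IH; ring.
Qed.

Lemma bernstein_meanZ n x c g :
  bernstein_mean n x (fun k => c * g k) = c * bernstein_mean n x g.
Proof.
elim: n g => [|n IH] g //=.
by rewrite (IH (g \o succn)) IH; ring.
Qed.

Lemma bernstein_mean_cst n x c : bernstein_mean n x (fun=> c) = c.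
Proof. by elim: n => //= n IH; rewrite (_ : _ \o _ = fun=> c)// IH; ring. Qed.

Lemma le_bernstein_mean n x g h : 0 <= x <= 1 ->
  (forall k, (k <= n)%N -> g k <= h k) ->
  bernstein_mean n x g <= bernstein_mean n x h.
Proof.
move=> /andP[x0 x1]; elim: n g h => [|n IH] g h gh /=; first exact: gh.
apply: lerD; apply: ler_wpM2l => //; rewrite ?subr_ge0//; apply: IH => k kn.
  exact: gh.
by apply: gh; rewrite (leq_trans kn).
Qed.

(** Squared bias plus variance of a binomial variable. The centre [c] must be arbitrary for the
    induction, since one more success replaces it by [c - 1]. *)
Lemma bernstein_mean_sqr n x c :
  bernstein_mean n x (fun k => (k%:R - c) ^+ 2) =
  (n%:R * x - c) ^+ 2 + n%:R * x * (1 - x).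
Proof.
elim: n c => [|n IH] c /=; first by ring.
rewrite IH.
have -> : (fun k : nat => (k%:R - c) ^+ 2) \o succn =
          (fun k : nat => (k%:R - (c - 1)) ^+ 2).
  by apply/funext => k /=; rewrite -natr1; ring.
by rewrite IH -natr1; ring.
Qed.

(** Compactness is used in its near-covering form, with the modulus [d] tending to [0] from the
    right as parameter; this replaces the choice of a finite subcover. *)
Lemma unif_continuous_segment (f : R -> R) (a b e : R) : continuous f -> 0 < e ->
  exists2 d, 0 < d & forall x y, a <= x <= b -> `|x - y| < d -> `|f x - f y| < e.
Proof.
move=> cf e0.
have /compact_near_coveringP := @segment_compact R a b.
move=> /(_ R (0^'+) (fun d x => forall y, `|x - y| < d -> `|f x - f y| < e)).
have cov x : `[a, b]%classic x -> \forall x' \near x & d \near 0^'+,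
    forall y, `|x' - y| < d -> `|f x' - f y| < e.
  move=> _; have /cvgrPdist_lt/(_ (e / 2)) := cf x.
  rewrite divr_gt0// => /(_ erefl)[r /= r0 Hr].
  exists (ball x (r / 2), [set d | d < r / 2]) => /=.
    split; first by apply: nbhsx_ballx; rewrite divr_gt0.
    by apply: nbhs_right_lt; rewrite divr_gt0.
  move=> [x' d]/= [bx' dr] y x'y.
  have H1 : `|f x - f x'| < e / 2 by apply: Hr; rewrite /= (lt_le_trans bx')//; lra.
  have H2 : `|f x - f y| < e / 2.
    apply: Hr => /=; rewrite /ball/= in bx'.
    rewrite (le_lt_trans (ler_distD x' _ _))//; lra.
  rewrite (le_lt_trans (ler_distD (f x) _ _))// distrC; lra.
move=> /(_ _ cov)[r /= r0 Hr].
exists (r / 2); first by rewrite divr_gt0.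
move=> x y /= xab; apply: (Hr (r / 2)) => //=; last by rewrite divr_gt0.
by rewrite sub0r normrN gtr0_norm ?divr_gt0//; lra.
Qed.

(** Chebyshev's argument: [f x - f (k / n)] is below [e / 2] when [k / n] is within [d] of [x], and
    otherwise below [2 M], hence below [2 M] times the square of the distance divided by [d].
    Averaging over [k] brings in the variance. *)
Lemma weierstrass_approx (f : R -> R) (e : R) : continuous f -> 0 < e ->
  exists p : {poly R}, forall x, 0 <= x <= 1 -> `|f x - p.[x]| <= e.
Proof.
move=> cf e0.
have e20 : 0 < e / 2 by rewrite divr_gt0.
have [d d0 Hd] := @unif_continuous_segment f 0 1 _ cf e20.
have [M M0 HM] : exists2 M, 0 < M & forall x, 0 <= x <= 1 -> `|f x| <= M.
  have cn : {within `[0, 1], continuous (fun x => `|f x|)}.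
    apply: continuous_subspaceT => x.
    by apply: continuous_comp; [exact: cf|exact: norm_continuous].
  have [c _ Hc] := @EVT_max R (fun x => `|f x|) 0 1 ler01 cn.
  exists (`|f c| + 1); first by rewrite ltr_wpDl.
  by move=> x x01; rewrite (le_trans (Hc x _))// lerDl.
pose K := 2 * M / d ^+ 2.
have K0 : 0 < K by rewrite divr_gt0 ?mulr_gt0// exprn_gt0.
(* After averaging the quadratic term is [K x (1 - x) / n]; this [n] makes it at most [e / 2]. *)
pose n := (Num.truncn (2 * K / e)).+1.
have nK : 2 * K / e < n%:R by exact: Num.Theory.truncnS_gt.
have n0 : 0 < n%:R :> R by rewrite ltr0n.
exists (bernstein_poly n (fun k => f (k%:R / n%:R))) => x x01.
rewrite horner_bernstein_poly.
have bound k : (k <= n)%N ->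
    `|f x - f (k%:R / n%:R)| <= e / 2 + K / n%:R ^+ 2 * (k%:R - n%:R * x) ^+ 2.
  move=> kn; have kn01 : 0 <= (k%:R / n%:R : R) <= 1.
    by rewrite divr_ge0//= ler_pdivrMr// mul1r ler_nat.
  have [lt|ge] := ltP `|x - k%:R / n%:R| d.
    rewrite (le_trans (ltW (Hd _ _ x01 lt)))// lerDl mulr_ge0 ?sqr_ge0//.
    by rewrite divr_ge0 ?exprn_ge0// ltW.
  have -> : K / n%:R ^+ 2 * (k%:R - n%:R * x) ^+ 2 =
            2 * M * (`|x - k%:R / n%:R| / d) ^+ 2.
    rewrite exprMn real_normK ?num_real// /K; field.
    by rewrite !gt_eqF.
  have : 2 * M * 1 <= 2 * M * (`|x - k%:R / n%:R| / d) ^+ 2.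
    rewrite ler_pM2l ?mulr_gt0// exprn_ege1//.
    by rewrite ler_pdivlMr// mul1r.
  have := ler_normB (f x) (f (k%:R / n%:R)).
  have := HM _ x01; have := HM _ kn01; lra.
have key : bernstein_mean n x (fun k => e / 2 + K / n%:R ^+ 2 * (k%:R - n%:R * x) ^+ 2) <= e.
  rewrite bernstein_meanD bernstein_mean_cst bernstein_meanZ bernstein_mean_sqr.
  rewrite subrr expr0n/= add0r.
  have -> : K / n%:R ^+ 2 * (n%:R * x * (1 - x)) = K / n%:R * (x * (1 - x)).
    by field; rewrite gt_eqF.
  have : K / n%:R <= e / 2.
    rewrite ler_pdivrMr//; move: nK; rewrite ltr_pdivrMr// => /ltW; lra.
  have Kn : 0 <= K / n%:R by rewrite divr_ge0 ?ltW.
  have : K / n%:R * (x * (1 - x)) <= K / n%:R.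
    case/andP: x01 => x0 x1.
    by rewrite ler_piMr// mulr_ile1//; lra.
  lra.
set B := fun k : nat => e / 2 + _ in key.
rewrite ler_norml; apply/andP; split.
- rewrite -(bernstein_mean_cst n x (f x)) lerBrDr addrC lerBlDr.
  apply: (@le_trans _ _ (bernstein_mean n x (fun k => f x + B k))).
    apply: le_bernstein_mean => // k /bound; rewrite /B.
    by rewrite ler_norml => /andP[]; lra.
  by rewrite bernstein_meanD lerD2l.
- rewrite -[X in X - _](bernstein_mean_cst n x (f x)) lerBlDl.
  apply: (@le_trans _ _ (bernstein_mean n x (fun k => f (k%:R / n%:R) + B k))).
    apply: le_bernstein_mean => // k /bound; rewrite /B.
    by rewrite ler_norml => /andP[]; lra.
  by rewrite bernstein_meanD lerD2l.
Qed.

End weierstrass.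

(** * Lerch's theorem for functions *)

Section lerch.
Context {R : realType}.
Notation mu := (@lebesgue_measure R).

(** A combination of the exponentials [exp(-n t)] with [n >= m] only: the front factor keeps all
    exponents beyond the abscissa of convergence. *)
Definition exp_poly (m : nat) (p : {poly R}) (t : R) : R :=
  expR (- (m%:R * t)) * p.[expR (- t)].

(** The step of every induction on [p] below: the lowest exponential splits off and [m] grows by
    one. *)
Lemma exp_polyMXaddC m (p : {poly R}) c t :
  exp_poly m (p * 'X + c%:P) t = exp_poly m.+1 p t + c * expR (- (m%:R * t)).
Proof.
rewrite /exp_poly hornerMXaddC -natr1 mulrDl opprD mul1r expRD; ring.
Qed.

(** This is [phi] in the variable [x = exp(-t)], to which Weierstrass is applied. Dividing by
    [x ^+ m] turns the uniform error into one weighted by [exp(-m t)]. There is no singularity at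
    [0], since [phi] vanishes beyond [r]. *)
Lemma continuous_compact_support_log (phi : R -> R) (m : nat) (l r : R) :
  continuous phi -> 0 < l -> (forall x, x < l \/ r < x -> phi x = 0) ->
  continuous (fun x : R => phi (- ln x) * (x ^+ m)^-1).
Proof.
move=> cphi l0 phi0 x.
have [x0|x0] := ltP 0 x.
  apply: cvgM.
    apply: (@continuous_comp _ _ _ (fun x => - ln x) phi).
      by apply: continuousN; exact: continuous_ln.
    exact: cphi.
  apply: cvgV; first by rewrite expf_neq0// gt_eqF.
  exact: exprn_continuous.
have near0 : \forall y \near x, y < expR (- r).
  by apply: lt_nbhsl; rewrite (le_lt_trans x0)// expR_gt0.
have zero y : y < expR (- r) -> phi (- ln y) * (y ^+ m)^-1 = 0.
  move=> yr; rewrite phi0 ?mul0r//.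
  (* For [y <= 0] the default value [ln y = 0] leads to [phi 0], which is zero because [0 < l]. *)
  have [y0|y0] := ltP 0 y; last by left; rewrite ln0// oppr0.
  by right; rewrite ltrNr -(expRK (- r)) ltr_ln// posrE// expR_gt0.
apply: cvg_near_cst; near=> y.
rewrite !zero//; last by near: y.
by rewrite (le_lt_trans x0)// expR_gt0.
Unshelve. all: by end_near. Qed.

Lemma exp_poly_approx (phi : R -> R) (m : nat) (l r e : R) :
  continuous phi -> 0 < l -> (forall x, x < l \/ r < x -> phi x = 0) -> 0 < e ->
  exists p : {poly R}, forall t, 0 <= t ->
    `|phi t - exp_poly m p t| <= e * expR (- (m%:R * t)).
Proof.
move=> cphi l0 phi0 e0.
have [p Hp] := weierstrass_approx (@continuous_compact_support_log _ m _ _ cphi l0 phi0) e0.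
exists p => t t0.
have := Hp (expR (- t)).
rewrite expR_ge0/= expR_le1 oppr_le0 t0 expRK opprK => /(_ erefl).
have -> : (expR (- t) ^+ m)^-1 = (expR (- (m%:R * t)))^-1 by rewrite -expRM_natl mulrN.
have E0 := expR_gt0 (- (m%:R * t)).
have -> : phi t - exp_poly m p t =
    (phi t * (expR (- (m%:R * t)))^-1 - p.[expR (- t)]) * expR (- (m%:R * t)).
  by rewrite /exp_poly; field; rewrite gt_eqF.
by rewrite normrM (gtr0_norm E0) ler_pM2r.
Qed.

Lemma laplace_exp_poly0 (f : R -> R) (m : nat) (p : {poly R}) :
  (forall n : nat, (m <= n)%N ->
    mu.-integrable `[0, +oo[ (EFin \o (fun t => expR (- (n%:R * t)) * f t)) /\
    \int[mu]_(t in `[0, +oo[) (expR (- (n%:R * t)) * f t) = 0) ->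
  mu.-integrable `[0, +oo[ (EFin \o (fun t => exp_poly m p t * f t)) /\
  \int[mu]_(t in `[0, +oo[) (exp_poly m p t * f t) = 0.
Proof.
elim/poly_ind: p m => [|p c IH] m H.
  have -> : (fun t => exp_poly m 0 t * f t) = cst 0.
    by apply/funext => t; rewrite /exp_poly horner0 mulr0 mul0r.
  split; last by rewrite Rintegral_cst// mul0r.
  exact: integrable0.
have [ip Ip] := IH m.+1 (fun n mn => H n (ltnW mn)).
have [ic Ic] := H m (leqnn m).
have -> : (fun t => exp_poly m (p * 'X + c%:P) t * f t) =
    (fun t => exp_poly m.+1 p t * f t + c * (expR (- (m%:R * t)) * f t)).
  by apply/funext => t; rewrite exp_polyMXaddC; ring.
have icc := integrableZl_EFin c (measurable_itv _) ic.
split; first exact: integrableD_EFin.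
by rewrite RintegralD// RintegralZl// Ip Ic mulr0 addr0.
Qed.

(** Exponential polynomials integrate to zero against [f]. A continuous test function is
    approximated by them with error [e exp(-m t)], which costs at most [e] times the finite integral
    of the norm of [exp(-m t) f]. Indicators of intervals are then limits of such test functions. *)
Lemma laplace_real_itv0 (f : R -> R) (m : nat) :
  (forall n : nat, (m <= n)%N ->
    mu.-integrable `[0, +oo[ (EFin \o (fun t => expR (- (n%:R * t)) * f t)) /\
    \int[mu]_(t in `[0, +oo[) (expR (- (n%:R * t)) * f t) = 0) ->
  forall p q, 0 < p -> p < q -> \int[mu]_(t in `]p, q]) f t = 0.
Proof.
move=> H.
pose D : set R := [set` `[0, +oo[].
have mD : measurable D by exact: measurable_itv.
have [im Im] := H m (leqnn m).
have ct (phi : R -> R) l r : continuous phi -> 0 < l ->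
    (forall x, x < l \/ r < x -> phi x = 0) ->
    mu.-integrable D (EFin \o (fun t => phi t * f t)) ->
    \int[mu]_(t in D) (phi t * f t) = 0.
  move=> cphi l0 phi0 iphi; apply/eqP; rewrite -normr_le0; apply/ler_addgt0Pl => e e0.
  pose N := \int[mu]_(t in D) `|expR (- (m%:R * t)) * f t|.
  have N0 : 0 <= N by apply: Rintegral_ge0.
  have e'0 : 0 < e / (N + 1) by rewrite divr_gt0// ltr_wpDl.
  have [p Hp] := exp_poly_approx m cphi l0 phi0 e'0.
  have [ip Ip] := laplace_exp_poly0 p H.
  have -> : \int[mu]_(t in D) (phi t * f t) =
      \int[mu]_(t in D) (phi t * f t - exp_poly m p t * f t).
    by rewrite RintegralB// Ip subr0.
  rewrite addr0.
  have idif : mu.-integrable D (EFin \o (fun t => phi t * f t - exp_poly m p t * f t)).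
    exact: integrableB_EFin.
  have mdif : measurable_fun D (fun t => phi t * f t - exp_poly m p t * f t).
    by apply/measurable_EFinP; exact: measurable_int idif.
  apply: (@le_trans _ _ (\int[mu]_(t in D) (e / (N + 1) * `|expR (- (m%:R * t)) * f t|))).
    apply: le_normr_Rintegral_dom => //.
    - move=> t; rewrite /D/= in_itv/= andbT => t0.
      rewrite -mulrBl !normrM mulrA ler_wpM2r// (le_trans (Hp _ t0))//.
      by rewrite (ger0_norm (expR_ge0 _)).
    - by apply: integrableZl_EFin => //; exact: integrable_norm.
  rewrite RintegralZl//; last exact: integrable_norm.
  rewrite -/N mulrAC ler_pdivrMr ?ltr_wpDl// ler_pM2l//.
  by rewrite lerDl.
have cE : measurable_fun D (fun t : R => expR (m%:R * t)).
  apply: (measurable_funS measurableT) => //.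
  by apply: continuous_measurable_fun => x; apply: continuous_comp;
    [apply: cvgM; [exact: cvg_cst|exact: cvg_id]|exact: continuous_expR].
have mf : measurable_fun D f.
  have -> : f = (fun t => expR (m%:R * t) * (expR (- (m%:R * t)) * f t)).
    by apply/funext => t; rewrite mulrA expRxMexpNx_1 mul1r.
  apply: measurable_funM => //.
  by apply/measurable_EFinP; exact: measurable_int im.
move=> p q p0 pq.
  (* A trapezoid rising just after [p] and falling just after [q]: it is [0] at [p] and [1] at [q],
     so it converges at every point to the indicator of the half-open interval. *)
  pose phi (n : nat) (t : R) := Num.max 0 (Num.min 1 (Num.min ((t - p) * n.+1%:R) (1 - (t - q) * n.+1%:R))).
  have cphi n : continuous (phi n).
    move=> t.
    pose A (x : R) : R := (x - p) * n.+1%:R.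
    pose B (x : R) : R := 1 - (x - q) * n.+1%:R.
    have cA : {for t, continuous A}.
      by apply: cvgM; [apply: cvgB; [exact: cvg_id|exact: cvg_cst]|exact: cvg_cst].
    have cB : {for t, continuous B}.
      apply: cvgB; first exact: cvg_cst.
      by apply: cvgM; [apply: cvgB; [exact: cvg_id|exact: cvg_cst]|exact: cvg_cst].
    have cAB := continuous_min cA cB.
    have c1 : {for t, continuous (fun _ : R => 1 : R)} by exact: cvg_cst.
    have c0 : {for t, continuous (fun _ : R => 0 : R)} by exact: cvg_cst.
    exact: (continuous_max c0 (continuous_min c1 cAB)).
  have phi_ge0 n t : 0 <= phi n t by rewrite /phi le_max lexx.
  have phi_le1 n t : phi n t <= 1 by rewrite /phi ge_max ler01 ge_min lexx.
  have phi0 n t : t < p \/ q + 1 < t -> phi n t = 0.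
    move=> H1; apply/max_idPl; rewrite !ge_min; apply/or3P.
    case: H1 => ht; [apply: Or32|apply: Or33].
      by rewrite mulr_le0_ge0// subr_le0 ltW.
    have : 1 * n.+1%:R <= (t - q) * n.+1%:R :> R by rewrite ler_pM2r// lerBrDl ltW.
    have : 1 <= n.+1%:R :> R by rewrite ler1n.
    lra.
  (* All trapezoids vanish beyond [q + 1], and up to there the constant makes up for the damping;
     [f] itself need not be integrable. *)
  pose g t := expR (m%:R * (q + 1)) * `|expR (- (m%:R * t)) * f t|.
  have ig : mu.-integrable D (EFin \o g).
    by apply: integrableZl_EFin => //; exact: integrable_norm.
  have dom n t : D t -> `|phi n t * f t| <= g t.
    move=> _; rewrite normrM (ger0_norm (phi_ge0 _ _)) /g normrM mulrA ler_wpM2r//.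
    rewrite (ger0_norm (expR_ge0 _)) -expRD.
    have [tq|tq] := leP t (q + 1); last by rewrite phi0 ?expR_ge0//; right.
    by rewrite (le_trans (phi_le1 _ _))// -[leLHS]expR0 ler_expR -mulrBr mulr_ge0// subr_ge0.
  have mphif n : measurable_fun D (fun t => phi n t * f t).
    apply: measurable_funM => //; apply: (measurable_funS measurableT) => //.
    exact: continuous_measurable_fun.
  have int0 n : \int[mu]_(t in D) (phi n t * f t) = 0.
    apply: (ct (phi n) p (q + 1)) => //; first exact: phi0.
    by apply: le_integrable_EFin ig => // t; exact: dom.
  have lim t : D t -> phi n t * f t @[n --> \oo] --> (f \_ `]p, q]) t.
    move=> _; apply: cvg_near_cst; near=> n.
    have large x : 0 < x -> x^-1 <= n%:R -> 1 <= x * n.+1%:R :> R.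
      move=> x0 xn; rewrite -[leLHS](mulfV (lt0r_neq0 x0)) ler_pM2l// (le_trans xn)//.
      by rewrite ler_nat.
    rewrite patchE; case: ifPn => [|].
      rewrite inE/= in_itv/= => /andP[pt tq].
      have A1 : 1 <= (t - p) * n.+1%:R.
        by apply: large; [rewrite subr_gt0|near: n; exact: nbhs_infty_ger].
      have B1 : 1 <= 1 - (t - q) * n.+1%:R.
        by rewrite lerBrDr gerDl mulr_le0_ge0// subr_le0.
      by rewrite /phi (min_idPl _) ?le_min ?A1// (max_idPr _)// mul1r.
    rewrite notin_setE/= in_itv/= => /negP; rewrite negb_and -!leNgt -ltNge.
    move=> H1; rewrite /phi (max_idPl _) ?mul0r// !ge_min.
    case/orP: H1 => ht; first by rewrite (mulr_le0_ge0 (x := t - p)) ?subr_le0// orbT.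
    have : 1 <= (t - q) * n.+1%:R.
      by apply: large; [rewrite subr_gt0|near: n; exact: nbhs_infty_ger].
    by rewrite -subr_le0 => ->; rewrite !orbT.
  have [_] := Rdominated_convergence mD mphif lim ig dom.
  rewrite (_ : (fun n => _) = cst 0); last by apply/funext => n; exact: int0.
  move=> lim2; transitivity (\int[mu]_(x in D) (f \_ `]p, q]) x); last first.
    have lim0 : cst (0 : R) x @[x --> \oo] --> (0 : R) by exact: cvg_cst.
    exact: (cvg_unique _ lim2 lim0).
  rewrite -Rintegral_mkcondr; congr (Rintegral _ _ _).
  apply/seteqP; split => x /=; rewrite /D/= !in_itv/= ?andbT; last by case.
  by move=> /andP[px ->]; rewrite px (le_trans (ltW p0))// ltW.
Unshelve. all: by end_near. Qed.

(** Passing to [exp(-m t) f], which is integrable as [ae_eq0_itv] requires, shifts the known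
    exponents so that they start at [0]. *)
Lemma laplace_real_unique (f : R -> R) (m : nat) :
  (forall n : nat, (m <= n)%N ->
    mu.-integrable `[0, +oo[ (EFin \o (fun t => expR (- (n%:R * t)) * f t)) /\
    \int[mu]_(t in `[0, +oo[) (expR (- (n%:R * t)) * f t) = 0) ->
  {ae mu, forall t, 0 < t -> f t = 0}.
Proof.
move=> H; pose h t := expR (- (m%:R * t)) * f t.
have Hh n : (0 <= n)%N ->
    mu.-integrable `[0, +oo[ (EFin \o (fun t => expR (- (n%:R * t)) * h t)) /\
    \int[mu]_(t in `[0, +oo[) (expR (- (n%:R * t)) * h t) = 0.
  move=> _; have := H (n + m)%N (leq_addl _ _).
  have -> // : (fun t => expR (- (n%:R * t)) * h t) =
          (fun t => expR (- ((n + m)%:R * t)) * f t).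
  by apply/funext => t; rewrite /h mulrA -expRD natrD; congr (expR _ * _); ring.
have := ae_eq0_itv (H m (leqnn m)).1 (laplace_real_itv0 Hh).
apply: filterS; first exact: (ae_filter_ringOfSetsType mu).
move=> t /= /[apply] /eqP; rewrite mulf_eq0 expR_eq0/=.
by move/eqP.
Qed.

End lerch.

(** * Approximation together with derivatives *)

Section smooth_approx.
Context {R : realType}.
Notation mu := (@lebesgue_measure R).

(** With [x = exp(-t)], differentiation in [t] is [-x d/dx]; this is its effect on [x^m p(x)], with
    [x^m] factored out again. *)
Definition exp_poly_deriv (m : nat) (p : {poly R}) : {poly R} :=
  - (m%:R *: p + 'X * p^`()).

Lemma is_derive_expRN (k t : R) :
  is_derive t (1 : R) (fun t => expR (- (k * t))) (- k * expR (- (k * t))).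
Proof.
have -> : (fun t => expR (- (k * t))) = expR \o (fun t => - (k * t)) by [].
by apply: is_derive_eq; rewrite /GRing.scale/= mulr1 mulrC.
Qed.

Lemma is_derive_exp_poly m (p : {poly R}) (t : R) :
  is_derive t (1 : R) (exp_poly m p) (exp_poly m (exp_poly_deriv m p) t).
Proof.
elim/poly_ind: p m => [|p c IH] m.
  have -> : exp_poly m (0 : {poly R}) = cst 0.
    by apply/funext => x; rewrite /exp_poly horner0 mulr0.
  have -> : exp_poly m (exp_poly_deriv m 0) t = 0.
    by rewrite /exp_poly_deriv scaler0 deriv0 mulr0 addr0 oppr0 /exp_poly horner0 mulr0.
  exact: is_derive_cst.
have -> : exp_poly m (p * 'X + c%:P) =
    (fun t => exp_poly m.+1 p t + c * expR (- (m%:R * t))).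
  by apply/funext => x; rewrite exp_polyMXaddC.
have -> : exp_poly_deriv m (p * 'X + c%:P) =
    exp_poly_deriv m.+1 p * 'X + (- m%:R * c)%:P.
  rewrite /exp_poly_deriv derivD derivC addr0 derivM derivX mulr1.
  rewrite -!mul_polyC -natr1 !polyCD !polyCM !polyCN polyC1; ring.
rewrite exp_polyMXaddC.
have := IH m.+1; have := is_derive_expRN m%:R t => d1 d2.
apply: is_derive_eq; rewrite /GRing.scale/= ?mul0r ?addr0; ring.
Qed.

Lemma derive1n_exp_poly k m (p : {poly R}) :
  derive1n k (exp_poly m p) = exp_poly m (iter k (exp_poly_deriv m) p).
Proof.
elim: k => // k IH; rewrite derive1nS IH iterS; apply/funext => t.
by rewrite derive1E; apply: derive_val; exact: is_derive_exp_poly.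
Qed.

(** The operator is diagonal: it multiplies the coefficient of degree [i] by [-(m + i)], which is
    nonzero since [m] is positive. *)
Lemma exp_poly_deriv_surj m (p : {poly R}) : (0 < m)%N ->
  exists q, exp_poly_deriv m q = p.
Proof.
move=> m0; exists (\poly_(i < size p) (- p`_i / (m + i)%:R)).
apply/polyP => i; rewrite /exp_poly_deriv coefN coefD coefZ coefXM coef_deriv !coef_poly.
case: i => [|i] /=.
  rewrite addr0 addn0; case: ifPn => [_|]; last first.
    by rewrite -leqNgt leqn0 mulr0 oppr0 => /eqP p0; rewrite nth_default// p0.
  by field; rewrite pnatr_eq0 -lt0n.
case: ifPn => [_|]; last first.
  by rewrite -leqNgt => sp; rewrite mulr0 mul0rn addr0 oppr0 nth_default.
rewrite -mulr_natr natrD.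
have : m%:R + i.+1%:R != 0 :> R by rewrite -natrD pnatr_eq0 addnS.
by move=> h; field.
Qed.

Lemma smooth_derive1n (k : nat) (phi : R -> R) :
  smooth phi -> smooth (derive1n k phi).
Proof.
by move=> sphi j x; rewrite /derive1n -iterD; exact: (sphi (j + k)%N).
Qed.

Lemma smooth_continuous (phi : R -> R) : smooth phi -> continuous phi.
Proof.
by move=> sphi x; apply/differentiable_continuous/derivable1_diffP/(sphi 0%N).
Qed.

Lemma derive1n_vanish k (phi : R -> R) (l r : R) :
  (forall x, x < l \/ r < x -> phi x = 0) ->
  forall x, x < l \/ r < x -> derive1n k phi x = 0.
Proof.
move=> phi0; elim: k => // k IH x xlr.
rewrite derive1nS derive1E -(derive_cst (0 : R) x (1 : R)).
apply: near_eq_derive.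
case: xlr => [xl|rx]; near=> y.
- by rewrite IH//; left; near: y; exact: lt_nbhsl.
- by rewrite IH//; right; near: y; exact: lt_nbhsr.
Unshelve. all: by end_near. Qed.

Lemma cvg_expRN (k : R) : 0 < k -> expR (- (k * t)) @[t --> +oo] --> 0.
Proof.
move=> k0.
have kty : k * t @[t --> +oo] --> +oo by apply: gt0_cvgMry => //; exact: cvg_id.
exact: (cvg_comp _ _ kty (@cvgr_expR R)).
Qed.

(** Comparison with the primitive of the bound: [u] minus it, and the negative of [u] plus it, are
    nondecreasing on the half-line and tend to [0] at infinity, so both are at most [0]. *)
Lemma derivative_exp_bound (u u' : R -> R) (k e : R) : 0 < k ->
  (forall t, is_derive t (1 : R) u (u' t)) ->
  (forall t, 0 <= t -> `|u' t| <= e * expR (- (k * t))) ->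
  u t @[t --> +oo] --> 0 ->
  forall t, 0 <= t -> `|u t| <= e / k * expR (- (k * t)).
Proof.
move=> k0 du ub u0.
have mono (w w' : R -> R) : (forall t, is_derive t (1 : R) w (w' t)) ->
    (forall t, 0 <= t -> 0 <= w' t) -> w t @[t --> +oo] --> 0 ->
    forall t, 0 <= t -> w t <= 0.
  move=> dw w'0 w0 t t0; apply: (cvgr_to_ge w0); near=> T.
  have tT : t < T by near: T; apply: nbhs_pinfty_gt; exact: num_real.
  have cw : {within `[t, T], continuous w}.
    apply: continuous_subspaceT => x.
    by apply/differentiable_continuous/derivable1_diffP; exact: ex_derive.
  have [c ctT E] := MVT tT (fun x _ => dw x) cw.
  rewrite -subr_ge0 E; apply: mulr_ge0; last by rewrite subr_ge0 ltW.
  move: ctT; rewrite in_itv/= => /andP[/ltW tc _].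
  by apply: w'0; rewrite (le_trans t0).
have E0 : e / k * expR (- (k * t)) @[t --> +oo] --> 0.
  rewrite -[X in _ --> X](mulr0 (e / k)); apply: cvgM; first exact: cvg_cst.
  exact: cvg_expRN.
have dE t : is_derive t (1 : R) (fun t => e / k * expR (- (k * t))) (- e * expR (- (k * t))).
  have := is_derive_expRN k t => d1.
  apply: is_derive_eq; rewrite /GRing.scale/= ?mul0r ?addr0; field.
  by rewrite gt_eqF.
move=> t t0; rewrite ler_norml; apply/andP; split.
- rewrite -subr_ge0 opprK -oppr_le0.
  apply: (mono (fun t => - (u t + e / k * expR (- (k * t))))
    (fun t => - (u' t + - e * expR (- (k * t))))) => // {t t0}.
  + by move=> t /ub; rewrite ler_norml => /andP[]; lra.
  + by rewrite -oppr0 -[X in - X](addr0 0); apply: cvgN; apply: cvgD.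
- rewrite -subr_le0.
  apply: (mono (fun t => u t - e / k * expR (- (k * t)))
    (fun t => u' t - - e * expR (- (k * t)))) => // {t t0}.
  + by move=> t /ub; rewrite ler_norml => /andP[]; lra.
  + by rewrite -[X in _ --> X](subr0 0); apply: cvgB.
Unshelve. all: by end_near. Qed.

End smooth_approx.

Section exp_poly_extension.
Context {R : realType}.
Notation mu := (@lebesgue_measure R).

(* Approximate the derivative and integrate from [+oo]: the approximants are
   stable under integration because [exp_poly_deriv m] is surjective. *)
Lemma smooth_exp_poly_approx (N m : nat) (phi : R -> R) (l r e : R) :
  (0 < m)%N -> smooth phi -> 0 < l -> (forall x, x < l \/ r < x -> phi x = 0) ->
  0 < e ->
  exists p : {poly R}, forall k t, (k <= N)%N -> 0 <= t ->
    `|derive1n k phi t - derive1n k (exp_poly m p) t| <= e * expR (- (m%:R * t)).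
Proof.
move=> m0 + l0 + e0; elim: N phi => [|N IH] phi sphi phi0.
  have [p Hp] := exp_poly_approx m (smooth_continuous sphi) l0 phi0 e0.
  by exists p => k t; rewrite leqn0 => /eqP -> t0; rewrite !derive1n0; exact: Hp.
have [p Hp] := IH _ (@smooth_derive1n _ 1 _ sphi) (@derive1n_vanish _ 1 _ _ _ phi0).
have [q qp] := exp_poly_deriv_surj p m0.
exists q => -[|k] t; last first.
  rewrite ltnS => kN t0.
  have -> : derive1n k.+1 phi = derive1n k (derive1n 1 phi) by rewrite /derive1n -iterD addn1.
  have -> : derive1n k.+1 (exp_poly m q) = derive1n k (exp_poly m p).
    by rewrite !derive1n_exp_poly iterSr qp.
  exact: Hp.
move=> _ t0.
have mR0 : 0 < m%:R :> R by rewrite ltr0n.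
(* Integrating the bound divides it by [m >= 1], so the error does not grow with the order of
   differentiation. *)
apply: (@le_trans _ _ (e / m%:R * expR (- (m%:R * t)))); last first.
  by rewrite ler_wpM2r ?expR_ge0// ler_pdivrMr// ler_peMr ?(ltW e0)// ler1n.
apply: (@derivative_exp_bound _ (fun t => derive1n 0 phi t - derive1n 0 (exp_poly m q) t)
  (fun t => derive1n 1 phi t - exp_poly m p t)) => //.
- move=> x; rewrite !derive1n0 -qp; have := is_derive_exp_poly m q x => d1.
  apply: is_deriveB; rewrite derive1n1 derive1E; apply: DeriveDef => //.
  exact: (sphi 0%N).
- by move=> x x0; have := Hp 0%N x (leq0n _) x0; rewrite !derive1n0.
- rewrite !derive1n0 -[X in _ --> X](subr0 0); apply: cvgB.
    apply: cvg_near_cst; near=> x; apply: phi0; right.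
    by near: x; apply: nbhs_pinfty_gt; exact: num_real.
  have -> : 0 = 0 * (q.[0]) :> R by rewrite mul0r.
  apply: cvgM; first exact: cvg_expRN.
  apply: (@cvg_comp _ _ _ (fun t => expR (- t)) (horner q) _ (nbhs (0 : R))).
    exact: cvgr_expR.
  exact: continuous_horner.
Unshelve. all: by end_near. Qed.

Lemma horner_bounded01 (p : {poly R}) :
  exists M, forall x, 0 <= x <= 1 -> `|p.[x]| <= M.
Proof.
elim/poly_ind: p => [|p c [M HM]]; first by exists 0 => x _; rewrite horner0 normr0.
exists (M + `|c|) => x x01; rewrite hornerMXaddC (le_trans (ler_normD _ _))//.
rewrite lerD2r normrM; have := HM x x01; case/andP: x01 => x0 x1.
by apply: le_trans; rewrite (ger0_norm x0) ler_piMr.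
Qed.

Lemma laplace_test_exp_poly (c : R) (m : nat) (p : {poly R}) :
  c <= m%:R -> laplace_test c (exp_poly m p).
Proof.
move=> cm; split=> [k x|k].
  by rewrite derive1n_exp_poly; have := is_derive_exp_poly m (iter k (exp_poly_deriv m) p) x => d; exact: ex_derive.
have [M HM] := horner_bounded01 (iter k (exp_poly_deriv m) p).
exists M => t t0; rewrite derive1n_exp_poly /exp_poly normrM (ger0_norm (expR_ge0 _)).
rewrite mulrA -expRD -mulNr -mulrDl.
have x01 : 0 <= expR (- t) <= 1 by rewrite expR_ge0/= expR_le1 oppr_le0.
apply: le_trans (HM _ x01); rewrite ler_piMl// expR_le1.
by rewrite mulr_le0_ge0// subr_le0.
Qed.

Lemma derive1n_lin (k : nat) (r : R) (phi psi : R -> R) : smooth phi -> smooth psi ->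
  derive1n k (fun x => r * phi x + psi x) =
  fun x => r * derive1n k phi x + derive1n k psi x.
Proof.
move=> sphi spsi; elim: k => // k IH; rewrite derive1nS IH; apply/funext => x.
rewrite derive1E !derive1nS !derive1E.
have d1 := derivableP (sphi k x); have d2 := derivableP (spsi k x).
by rewrite derive_val /GRing.scale/= ?mul0r ?addr0.
Qed.

Lemma laplace_test_lin (c r : R) (phi psi : R -> R) :
  laplace_test c phi -> laplace_test c psi ->
  laplace_test c (fun x => r * phi x + psi x).
Proof.
move=> [sphi bphi] [spsi bpsi]; split.
  move=> k x; rewrite derive1n_lin//.
  by apply: derivableD; [apply: derivableM => //; exact: derivable_cst|exact: spsi].
move=> k; have [M1 H1] := bphi k; have [M2 H2] := bpsi k.
exists (`|r| * M1 + M2) => t t0; rewrite derive1n_lin//.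
apply: (@le_trans _ _ (`|r| * (expR (c * t) * `|derive1n k phi t|) + expR (c * t) * `|derive1n k psi t|)).
  rewrite mulrCA -mulrDr ler_wpM2l ?expR_ge0// (le_trans (ler_normD _ _))//.
  by rewrite normrM.
by apply: lerD; [rewrite ler_wpM2l// H1|exact: H2].
Qed.

Lemma test_function_pos_laplace (c : R) (phi : R -> R) :
  test_function_pos phi -> laplace_test c phi.
Proof.
move=> [sphi [l [r [l0 phi0]]]]; split=> // k.
have cf : continuous (fun t => expR (c * t) * `|derive1n k phi t|).
  move=> t; apply: cvgM.
    apply: continuous_comp; last exact: continuous_expR.
    by apply: cvgM; [exact: cvg_cst|exact: cvg_id].
  apply: continuous_comp; last exact: norm_continuous.
  exact: (smooth_continuous (@smooth_derive1n _ k _ sphi)).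
(* The bound [r] of the support may be negative, for instance when [phi] is zero. *)
have r0 : 0 <= Num.max r 0 by rewrite le_max lexx orbT.
have [t0 _ H] := EVT_max r0 (continuous_subspaceT cf).
exists (Num.max 0 (expR (c * t0) * `|derive1n k phi t0|)) => t tge0.
have [tr|tr] := leP t r.
  rewrite (le_trans (H t _))// ?le_max ?lexx ?orbT// in_itv/= tge0 le_max tr//.
by rewrite (derive1n_vanish _ phi0) ?normr0 ?mulr0 ?le_max ?lexx//; right.
Qed.

Lemma Re_le_cmod (z : R[i]) : `|complex.Re z| <= cmod z.
Proof.
rewrite /cmod -sqrtr_sqr ler_sqrt; first by rewrite lerDl sqr_ge0.
by rewrite addr_ge0// sqr_ge0.
Qed.

Lemma Im_le_cmod (z : R[i]) : `|complex.Im z| <= cmod z.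
Proof.
rewrite /cmod -sqrtr_sqr ler_sqrt; first by rewrite lerDr sqr_ge0.
by rewrite addr_ge0// sqr_ge0.
Qed.

Lemma distribution_exp_poly_ext (T1 T2 : (R -> R) -> R[i]) (c1 c2 : R) (m : nat)
    (p : {poly R}) :
  laplace_distribution c1 T1 -> laplace_distribution c2 T2 ->
  c1 <= m%:R -> c2 <= m%:R ->
  (forall n : nat, (m <= n)%N ->
     T1 (fun t => expR (- (n%:R * t))) = T2 (fun t => expR (- (n%:R * t)))) ->
  T1 (exp_poly m p) = T2 (exp_poly m p).
Proof.
move=> [lin1 _] [lin2 _].
have test_exp (c : R) (n : nat) : c <= n%:R -> laplace_test c (fun t => expR (- (n%:R * t))).
  move=> cn; have := @laplace_test_exp_poly c n 1 cn; congr laplace_test.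
  by apply/funext => t; rewrite /exp_poly hornerC mulr1.
have test0 (c : R) : laplace_test c (fun=> 0).
  split=> [k x|k].
    rewrite (_ : derive1n k _ = fun=> 0); first exact: derivable_cst.
    by elim: k => // k IH; rewrite derive1nS IH; apply/funext => t; rewrite derive1_cst.
  exists 0 => t _; rewrite (_ : derive1n k _ = fun=> 0) ?normr0 ?mulr0//.
  by elim: k => // k IH; rewrite derive1nS IH; apply/funext => z; rewrite derive1_cst.
elim/poly_ind: p m => [|p c IH] m c1m c2m H.
  have -> : exp_poly m 0 = (fun=> 0 : R).
    by apply/funext => t; rewrite /exp_poly horner0 mulr0.
  (* Linearity is given only for combinations [r phi + psi]; with [r = -1] and two zero functions it
     yields [T 0 = 0]. *)
  have z T cc : (forall (r : R) (phi psi : R -> R),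
     laplace_test cc phi -> laplace_test cc psi ->
     T (fun x => r * phi x + psi x) = r%:C * T phi + T psi) -> T (fun=> 0 : R) = 0.
    move=> /(_ (-1) (fun=> 0) (fun=> 0) (test0 _) (test0 _)).
    rewrite (_ : (fun x : R => -1 * 0 + 0) = fun=> 0); last by apply/funext => x; rewrite mulr0 addr0.
    by move=> ->; rewrite rmorphN rmorph1 mulN1r addNr.
  by rewrite (z _ _ lin1) (z _ _ lin2).
have -> : exp_poly m (p * 'X + c%:P) =
    fun t => c * expR (- (m%:R * t)) + exp_poly m.+1 p t.
  by apply/funext => t; rewrite exp_polyMXaddC addrC.
have mS : m%:R <= m.+1%:R :> R by rewrite ler_nat.
have c1m' := le_trans c1m mS; have c2m' := le_trans c2m mS.
rewrite (lin1 c _ _ (test_exp _ _ c1m) (laplace_test_exp_poly p c1m')).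
rewrite (lin2 c _ _ (test_exp _ _ c2m) (laplace_test_exp_poly p c2m')).
rewrite (H m (leqnn m)); congr (_ + _).
by apply: IH => // n mn; apply: H; exact: ltnW.
Qed.

End exp_poly_extension.

(** * Uniqueness for distributions, and the two explicit ones *)

Section laplace_distributions.
Context {R : realType}.
Notation mu := (@lebesgue_measure R).

(** Both functionals have finite order, so approximating [phi] by exponential polynomials in
    finitely many seminorms is enough, and on these the two agree by linearity. *)
Lemma laplace_distribution_unique (T1 T2 : (R -> R) -> R[i]) (c1 c2 : R) (m : nat)
    (phi : R -> R) :
  laplace_distribution c1 T1 -> laplace_distribution c2 T2 ->
  (forall n : nat, (m <= n)%N ->
     T1 (fun t => expR (- (n%:R * t))) = T2 (fun t => expR (- (n%:R * t)))) ->
  test_function_pos phi -> T1 phi = T2 phi.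
Proof.
move=> d1 d2 H tphi.
(* With [m'] above both decay rates the error weight [exp(-m' t)] absorbs the factors [exp(c1 t)]
   and [exp(c2 t)] of the seminorms; [0 < m'] is needed for approximating derivatives. *)
have [m' [m'0 mm' c1m c2m]] : exists m' : nat,
    [/\ (0 < m')%N, (m <= m')%N, c1 <= m'%:R & c2 <= m'%:R].
  exists (maxn m (maxn (Num.truncn c1).+1 (Num.truncn c2).+1)).
  rewrite !leq_max leqnn !ltnS !leq0n !orbT; split => //.
    rewrite (le_trans (ltW (Num.Theory.truncnS_gt c1)))// ler_nat.
    by rewrite !leq_max leqnn !orbT.
  rewrite (le_trans (ltW (Num.Theory.truncnS_gt c2)))// ler_nat.
  by rewrite !leq_max leqnn !orbT.
have [lin1 [N1 [K1 B1]]] := d1; have [lin2 [N2 [K2 B2]]] := d2.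
have [sphi [l [r [l0 phi0]]]] := tphi.
have bound e : 0 < e -> exists p : {poly R},
    cmod (T1 phi - T1 (exp_poly m' p)) <= K1 * e /\
    cmod (T2 phi - T2 (exp_poly m' p)) <= K2 * e.
  move=> e0.
  have [p Hp] := smooth_exp_poly_approx (maxn N1 N2) m'0 sphi l0 phi0 e0.
  exists p.
  have test c : c <= m'%:R -> laplace_test c (exp_poly m' p).
    by move=> cm; exact: laplace_test_exp_poly.
  have sub (T : (R -> R) -> R[i]) c : c <= m'%:R -> (forall (r : R) (phi psi : R -> R),
     laplace_test c phi -> laplace_test c psi ->
     T (fun x => r * phi x + psi x) = r%:C * T phi + T psi) ->
     T phi - T (exp_poly m' p) = T (fun x => -1 * exp_poly m' p x + phi x).
    move=> cm lin; rewrite (lin (-1) _ _ (test _ cm) (test_function_pos_laplace c tphi)).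
    by rewrite rmorphN rmorph1 mulN1r addrC.
  have est c k t : c <= m'%:R -> (k <= maxn N1 N2)%N -> 0 <= t ->
      expR (c * t) * `|derive1n k (fun x => -1 * exp_poly m' p x + phi x) t| <= e.
    move=> cm kN t0; rewrite derive1n_lin//; last first.
      by have [] := test _ cm.
    rewrite mulN1r addrC.
    apply: (@le_trans _ _ (expR (c * t) * (e * expR (- (m'%:R * t))))).
      by rewrite ler_wpM2l ?expR_ge0// Hp.
    rewrite mulrCA -expRD ler_piMr ?(ltW e0)// expR_le1 -mulNr -mulrDl.
    by rewrite mulr_le0_ge0// subr_le0.
  split.
  - rewrite (sub T1 c1)//; apply: B1.
      apply: laplace_test_lin; first exact: test.
      exact: test_function_pos_laplace.
    by move=> k t kN; apply: est => //; rewrite leq_max kN.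
  - rewrite (sub T2 c2)//; apply: B2.
      apply: laplace_test_lin; first exact: test.
      exact: test_function_pos_laplace.
    by move=> k t kN; apply: est => //; rewrite leq_max kN orbT.
(* The continuity constants carry no sign hypothesis, hence their absolute values. *)
have zero x : (forall e, 0 < e -> x <= (`|K1| + `|K2|) * e) -> x <= 0.
  move=> Hx; apply/ler_addgt0Pl => e e0; rewrite addr0.
  have k0 : 0 < `|K1| + `|K2| + 1 by rewrite ltr_wpDl// addr_ge0.
  have := Hx (e / (`|K1| + `|K2| + 1)); rewrite divr_gt0// => /(_ erefl).
  move/le_trans; apply; by rewrite mulrCA ler_piMr ?(ltW e0)// ler_pdivrMr// mul1r lerDl.
have RIm (P : R[i] -> R) : (forall z, `|P z| <= cmod z) -> (forall x y, P (x - y) = P x - P y) ->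
    P (T1 phi) = P (T2 phi).
  move=> Pc PB; apply/eqP; rewrite -subr_eq0 -normr_le0.
  apply: zero => e e0.
  have [p [p1 p2]] := bound e e0.
  have E := distribution_exp_poly_ext p d1 d2 c1m c2m (fun n mn => H n (leq_trans mm' mn)).
  have -> : P (T1 phi) - P (T2 phi) = P (T1 phi - T1 (exp_poly m' p)) - P (T2 phi - T2 (exp_poly m' p)).
    by rewrite !PB E; ring.
  rewrite (le_trans (ler_normB _ _))// mulrDl lerD//.
    rewrite (le_trans (Pc _))// (le_trans p1)// ler_wpM2r ?(ltW e0)// ler_norm//.
  rewrite (le_trans (Pc _))// (le_trans p2)// ler_wpM2r ?(ltW e0)// ler_norm//.
have ReE := RIm _ Re_le_cmod (fun x y => raddfB _ x y).
have ImE := RIm _ Im_le_cmod (fun x y => raddfB _ x y).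
by apply/eqP; rewrite eq_complex ReE ImE !eqxx.
Qed.

Lemma cmod_real (x : R) : cmod x%:C = `|x|.
Proof. by rewrite /cmod/= expr0n/= addr0 sqrtr_sqr. Qed.

Lemma cexp_real (x : R) : cexp x%:C = (expR x)%:C.
Proof. by rewrite /cexp/= cos0 sin0 mulr1 mulr0. Qed.

Lemma cpow_real (x p : R) : 0 < x -> cpow x%:C p = (x `^ p)%:C.
Proof.
move=> x0; rewrite /cpow /cln /carg cmod_real/= lexx gtr0_norm// divff ?gt_eqF// acos1.
by rewrite -rmorphM/= cexp_real /powR gt_eqF.
Qed.

Lemma R_symbol_real (nu a x p : R) : 0 < x ->
  R_symbol p nu a x%:C = (x `^ (- p) * expR (- (a * x `^ nu)))%:C.
Proof.
move=> x0; rewrite /R_symbol !cpow_real// -rmorphN/= -rmorphM/= cexp_real.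
by rewrite -rmorphM mulNr.
Qed.

Lemma laplace_distr_real (T : (R -> R) -> R[i]) (c x : R) : laplace_distribution c T ->
  laplace_distr T x%:C = T (fun t => expR (- (x * t))).
Proof.
move=> [lin _]; rewrite /laplace_distr.
have E t : cexp (- x%:C * t%:C) = (expR (- (x * t)))%:C.
  by rewrite -rmorphN -rmorphM/= cexp_real mulNr.
have -> : (fun t => complex.Re (cexp (- x%:C * t%:C))) = fun t => expR (- (x * t)).
  by apply/funext => t; rewrite E.
have -> : (fun t => complex.Im (cexp (- x%:C * t%:C))) = fun=> 0.
  by apply/funext => t; rewrite E.
rewrite (_ : T (fun=> 0) = 0) ?mulr0 ?addr0//.
have E0 : forall k, derive1n k (fun=> 0 : R) = fun=> 0 : R.
  by elim=> // k IH; rewrite derive1nS IH; apply/funext => t; rewrite derive1_cst.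
have t0 : laplace_test c (fun=> 0 : R).
  split=> [k y|k]; first by rewrite E0; exact: derivable_cst.
  by exists 0 => t _; rewrite E0 normr0 mulr0.
have := lin (-1) _ _ t0 t0.
rewrite (_ : (fun x : R => -1 * 0 + 0) = fun=> 0); last by apply/funext => y; rewrite mulr0 addr0.
by move=> ->; rewrite rmorphN rmorph1 mulN1r addNr.
Qed.

Lemma integrable_expRN (k a : R) : 0 < k ->
  mu.-integrable `[a, +oo[ (EFin \o (fun t => expR (- (k * t)))).
Proof.
move=> k0.
have cE : continuous (fun t => expR (- (k * t))).
  by move=> x; apply/differentiable_continuous/derivable1_diffP;
     have := is_derive_expRN k x => d; exact: ex_derive.
have mE : measurable_fun [set` `[a, +oo[] (fun t => expR (- (k * t))).
  by apply: (measurable_funS measurableT) => //; exact: continuous_measurable_fun.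
apply/integrableP; split; first exact/measurable_EFinP.
under eq_integral do rewrite gee0_abs ?lee_fin ?expR_ge0//.
have dF x : is_derive x (1 : R) (fun t => - k^-1 * expR (- (k * t))) (expR (- (k * x))).
  have := is_derive_expRN k x => d; apply: is_derive_eq.
  by rewrite /GRing.scale/= ?mul0r ?addr0; field; rewrite gt_eqF.
rewrite (@ge0_continuous_FTC2y _ _ (fun t => - k^-1 * expR (- (k * t))) a 0).
- by rewrite -EFinB ltry.
- by move=> x _; exact: expR_ge0.
- exact: continuous_subspaceT.
- rewrite -[X in _ --> X](mulr0 (- k^-1)); apply: cvgM; first exact: cvg_cst.
  exact: cvg_expRN.
- by move=> x _; exact: ex_derive.
- apply: cvg_at_right_filter; apply: cvgM; first exact: cvg_cst.
  exact: cE.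
- by move=> x _; rewrite derive1E derive_val.
Qed.

Lemma Rintegral_expRN (k a : R) : 0 < k ->
  \int[mu]_(t in `[a, +oo[) expR (- (k * t)) = k^-1 * expR (- (k * a)).
Proof.
move=> k0.
have dF x : is_derive x (1 : R) (fun t => - k^-1 * expR (- (k * t))) (expR (- (k * x))).
  have := is_derive_expRN k x => d; apply: is_derive_eq.
  by rewrite /GRing.scale/= ?mul0r ?addr0; field; rewrite gt_eqF.
have cE : continuous (fun t => expR (- (k * t))).
  by move=> x; apply/differentiable_continuous/derivable1_diffP;
     have := is_derive_expRN k x => d; exact: ex_derive.
rewrite (@Rintegral_FTC2y _ _ (fun t => - k^-1 * expR (- (k * t))) a 0)//.
- by rewrite sub0r mulNr opprK.
- exact: integrable_expRN.
- rewrite -[X in _ --> X](mulr0 (- k^-1)); apply: cvgM; first exact: cvg_cst.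
  exact: cvg_expRN.
Qed.

Lemma laplace_test_integrable (a : R) (phi : R -> R) : 0 <= a -> laplace_test 1 phi ->
  mu.-integrable `[a, +oo[ (EFin \o phi).
Proof.
move=> a0 [sphi /(_ 0%N)[M HM]].
apply: (@le_integrable_EFin _ _ _ (fun t => M * expR (- (1 * t)))) => //.
- apply: (measurable_funS measurableT) => //; apply: continuous_measurable_fun.
  exact: smooth_continuous.
- move=> t /=; rewrite in_itv/= andbT => at0; have := HM t (le_trans a0 at0).
  by rewrite derive1n0 mul1r expRN ler_pdivlMr ?expR_gt0// mulrC.
- by apply: integrableZl_EFin => //; exact: integrable_expRN.
Qed.

(** The candidate for order [0], with transform [exp(-a s)]. Here [0 <= a] matters because the
    seminorms see only the half-line. *)
Lemma laplace_distribution_dirac (a : R) : 0 <= a ->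
  laplace_distribution 0 (fun phi : R -> R => (phi a)%:C).
Proof.
move=> a0; split; first by move=> r phi psi _ _; rewrite rmorphD rmorphM.
exists 0%N, 1 => phi M _ H; rewrite mul1r cmod_real.
by have := H 0%N a (leqnn _) a0; rewrite derive1n0 mul0r expR0 mul1r.
Qed.

(** The candidate for order [1]: the unit step at [a], with transform [exp(-a s) / s]. Decay rate
    [1] makes the integral of a test function converge. *)
Lemma laplace_distribution_step (a : R) : 0 <= a ->
  laplace_distribution 1 (fun phi : R -> R => (\int[mu]_(t in `[a, +oo[) phi t)%:C).
Proof.
move=> a0; split.
  move=> r phi psi tphi tpsi.
  have i1 := laplace_test_integrable a0 tphi; have i2 := laplace_test_integrable a0 tpsi.
  rewrite RintegralD//; first by rewrite RintegralZl// rmorphD rmorphM.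
  exact: integrableZl_EFin.
exists 0%N, 1 => phi M [sphi _] H; rewrite mul1r cmod_real.
have M0 : 0 <= M by apply: le_trans (H 0%N 0 _ _) => //; rewrite mulr_ge0 ?expR_ge0.
apply: (@le_trans _ _ (\int[mu]_(t in `[a, +oo[) (M * expR (- (1 * t))))).
  apply: le_normr_Rintegral_dom => //.
  - apply: (measurable_funS measurableT) => //; apply: continuous_measurable_fun.
    exact: smooth_continuous.
  - move=> t /=; rewrite in_itv/= andbT => at0; have := H 0%N t (leqnn _) (le_trans a0 at0).
    by rewrite derive1n0 mul1r expRN ler_pdivlMr ?expR_gt0// mulrC.
  - by apply: integrableZl_EFin => //; exact: integrable_expRN.
rewrite RintegralZl//; last exact: integrable_expRN.
rewrite Rintegral_expRN// invr1 !mul1r ler_piMr// expR_le1 oppr_le0//.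
Qed.

End laplace_distributions.

(** * The case [nu = 1] *)

Section power_functions.
Context {R : realType}.
Notation mu := (@lebesgue_measure R).

(** Integrability of the limit is a conclusion here: it follows from the convergence of the
    integrals to a finite [L]. *)
Lemma ge0_Rmonotone_convergence (D : set R) (g_ : nat -> R -> R) (f : R -> R) (L : R) :
  measurable D -> (forall n, mu.-integrable D (EFin \o g_ n)) ->
  (forall n x, D x -> 0 <= g_ n x) ->
  (forall x, D x -> {homo g_ ^~ x : n m / (n <= m)%N >-> n <= m}) ->
  (forall x, D x -> g_ n x @[n --> \oo] --> f x) ->
  \int[mu]_(x in D) g_ n x @[n --> \oo] --> L ->
  mu.-integrable D (EFin \o f) /\ \int[mu]_(x in D) f x = L.
Proof.
move=> mD ig g0 gnd gf gL.
have mg n : measurable_fun D (EFin \o g_ n) by exact: measurable_int (ig n).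
have mf : measurable_fun D f.
  have mg' n : measurable_fun D (g_ n) by apply/measurable_EFinP; exact: mg.
  exact: (measurable_fun_cvg mg').
have f0 x : D x -> 0 <= f x.
  by move=> Dx; apply: (cvgr_to_ge (gf x Dx)); apply: nearW => n; exact: g0.
have := @cvg_monotone_convergence _ _ R mu D mD (fun n => EFin \o g_ n) mg.
move=> /(_ (fun n x Dx => g0 n x Dx)) /(_ (fun x Dx n m nm => gnd x Dx n m nm)).
have -> : (\int[mu]_(x in D) limn (fun n => (EFin \o g_ n) x))%E = (\int[mu]_(x in D) (f x)%:E)%E.
  apply: eq_integral => x /set_mem Dx; apply/cvg_lim => //.
  by apply: cvg_EFin; [exact: nearW|exact: gf].
move=> lim1.
have lim2 : (\int[mu]_(x in D) (EFin \o g_ n) x)%E @[n --> \oo] --> L%:E.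
  have -> : (fun n => (\int[mu]_(x in D) (EFin \o g_ n) x)%E) =
      (fun n => (\int[mu]_(x in D) g_ n x)%:E).
    by apply/funext => n; rewrite /Rintegral fineK// (@integrable_fin_num _ _ _ mu _ mD _ (ig n)).
  by apply: cvg_EFin => //; exact: nearW.
have E : (\int[mu]_(x in D) (f x)%:E)%E = L%:E by exact: (cvg_unique _ lim1 lim2).
split; last by rewrite /Rintegral E.
apply/integrableP; split; first exact/measurable_EFinP.
have -> : (\int[mu]_(x in D) `|(EFin \o f) x|)%E = L%:E; last exact: ltry.
by rewrite -E; apply: eq_integral => x /set_mem Dx; rewrite /= ger0_norm// f0.
Qed.

(** The integrand may blow up at an endpoint, as [x^(m-1)] does at [0] for [m < 1]; only [F] is
    continuous there. The interval is exhausted by compact ones, and the sign of [f] permits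
    monotone convergence. *)
Lemma ge0_FTC2_oo (f F : R -> R) (p q : R) : p < q ->
  (forall x, p < x < q -> 0 <= f x) ->
  (forall x, p < x < q -> {for x, continuous f}) ->
  (forall x, p < x < q -> is_derive x (1 : R) F (f x)) ->
  {for p, continuous F} -> {for q, continuous F} ->
  mu.-integrable `]p, q[ (EFin \o f) /\ \int[mu]_(x in `]p, q[) f x = F q - F p.
Proof.
move=> pq f0 cf dF cFp cFq.
pose d := q - p; have d0 : 0 < d by rewrite subr_gt0.
(* A denominator of at least 3 keeps [e n] strictly below [d / 2], so the compact intervals are
   never degenerate. *)
pose e (n : nat) := d / n.+3%:R.
have e0 n : 0 < e n by rewrite divr_gt0.
have ed n : e n < d / 2 by rewrite ltr_pM2l// ltf_pV2 ?posrE// ltr_nat.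
have dE : d = q - p by [].
have ends n : p < p + e n /\ p + e n < q - e n /\ q - e n < q.
  by have := e0 n; have := ed n; rewrite dE => h1 h2; split; [lra|split; lra].
have cc n : {within `[p + e n, q - e n], continuous f}.
  apply: continuous_in_subspaceT => x; rewrite inE/= in_itv/= => /andP[h1 h2].
  by apply: cf; have [h3 [h4 h5]] := ends n; apply/andP; split; lra.
pose D : set R := [set` `]p, q[].
have mD : measurable D by exact: measurable_itv.
pose g_ n := f \_ [set` `[p + e n, q - e n]].
have sub n x : x \in `[p + e n, q - e n] -> p < x < q.
  rewrite in_itv/= => /andP[h1 h2].
  by have [h3 [h4 h5]] := ends n; apply/andP; split; lra.
have ic n : mu.-integrable `[p + e n, q - e n] (EFin \o f).
  by apply: continuous_compact_integrable => //; exact: segment_compact.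
have capE n : D `&` [set` `[p + e n, q - e n]] = [set` `[p + e n, q - e n]].
  by apply/seteqP; split => x /=; [case|move=> h; split=> //; rewrite /D/= in_itv/=; exact: sub h].
have ig n : mu.-integrable D (EFin \o g_ n).
  rewrite /g_ -restrict_EFin; apply/integrable_restrict => //.
  by rewrite capE.
have g0 n x : D x -> 0 <= g_ n x.
  by rewrite /D/= in_itv/= => pxq; rewrite /g_ patchE; case: ifPn => // _; exact: f0.
have eE : e n @[n --> \oo] --> 0.
  rewrite -[X in _ --> X](mulr0 d); apply: cvgM; first exact: cvg_cst.
  have := @cvg_harmonic R; rewrite /harmonic => h.
  rewrite (_ : (fun n : nat => n.+3%:R^-1) = (fun n => [sequence n.+1%:R^-1 : R]_n (n + 2)%N)).
    by rewrite cvg_shiftn.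
  by apply/funext => n /=; rewrite addn2.
have [] := @ge0_Rmonotone_convergence D g_ f (F q - F p) mD ig g0.
- move=> x Dx n m nm; rewrite /g_ !patchE.
  case: ifPn => [xn|_]; last by case: ifPn => // _; apply: f0; move: Dx; rewrite /D/= in_itv.
  rewrite ifT//; move: xn; rewrite !inE/= !in_itv/=.
  have : e m <= e n by rewrite ler_pM2l// lef_pV2 ?posrE// ler_nat !ltnS.
  by move=> emn /andP[h1 h2]; apply/andP; split; lra.
- move=> x; rewrite /D/= in_itv/= => /andP[px xq].
  apply: cvg_near_cst; near=> n; rewrite /g_ patchE mem_set//= in_itv/=.
  have h1 : e n < x - p by near: n; apply: (cvgr_lt _ eE); rewrite subr_gt0.
  have h2 : e n < q - x by near: n; apply: (cvgr_lt _ eE); rewrite subr_gt0.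
  by apply/andP; split; lra.
- have -> : (fun n => \int[mu]_(x in D) g_ n x) = (fun n => F (q - e n) - F (p + e n)).
    apply/funext => n; rewrite /g_ -Rintegral_mkcondr capE.
    have [h3 [h4 h5]] := ends n.
    have cF x : x \in `[p + e n, q - e n] -> {for x, continuous F}.
      move=> /sub h; apply/differentiable_continuous/derivable1_diffP.
      by have := dF _ h => dd; exact: ex_derive.
    have dLR : derivable_oo_LRcontinuous F (p + e n) (q - e n).
      split.
      + by move=> x h; have := dF x (sub n x (subset_itv_oo_cc h)) => dd; exact: ex_derive.
      + by apply: cvg_at_right_filter; apply: cF; rewrite in_itv/= lexx ltW.
      + by apply: cvg_at_left_filter; apply: cF; rewrite in_itv/= lexx ltW.
    have dFE : {in `]p + e n, q - e n[, derive1 F =1 f}.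
      move=> x h; have := dF x (sub n x (subset_itv_oo_cc h)) => dd.
      by rewrite derive1E derive_val.
    by rewrite /Rintegral (continuous_FTC2 h4 (cc n) dLR dFE).
  apply: cvgB.
  + have h : q - e n @[n --> \oo] --> q.
      by rewrite -[X in _ --> X](subr0 q); apply: cvgB => //; exact: cvg_cst.
    exact: (cvg_comp _ _ h cFq).
  + have h : p + e n @[n --> \oo] --> p.
      by rewrite -[X in _ --> X](addr0 p); apply: cvgD => //; exact: cvg_cst.
    exact: (cvg_comp _ _ h cFp).
by move=> ? ?; split.
Unshelve. all: by end_near. Qed.

(** Negative bases are cut off because [powR] takes the value 1 there; the truncation yields
    primitives continuous up to and across [0]. *)
Lemma continuous_powR_pos (m : R) : 0 < m ->
  continuous (fun x : R => (Num.max x 0) `^ m).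
Proof.
move=> m0 x; have [x0|x0|x0] := ltgtP x 0.
- rewrite /continuous_at (max_idPr (ltW x0)) powR0 ?gt_eqF//.
  apply: cvg_near_cst; near=> y; rewrite max_r ?powR0 ?gt_eqF//.
  by apply: ltW; near: y; exact: lt_nbhsl.
- have cx : {for x, continuous (fun x : R => x `^ m)}.
    apply/differentiable_continuous/derivable1_diffP.
    by have := is_derive1_powR m x0 => d; exact: ex_derive.
  rewrite /continuous_at (max_idPl (ltW x0)).
  apply: cvg_trans cx; apply: near_eq_cvg; near=> y.
  rewrite max_l//; apply: ltW; near: y; exact: lt_nbhsr.
- rewrite x0 /continuous_at maxxx powR0 ?gt_eqF//.
  apply/cvgrPdist_lt => e e0; near=> y; rewrite sub0r normrN ger0_norm ?powR_ge0//.
  have -> : e = (e `^ m^-1) `^ m by rewrite -powRrM mulVf ?gt_eqF// powRr1// ltW.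
  rewrite gt0_ltr_powR// ?nnegrE ?le_max ?lexx ?orbT ?powR_ge0//.
  rewrite gt_max powR_gt0// andbT; near: y; apply: lt_nbhsl; exact: powR_gt0.
Unshelve. all: by end_near. Qed.

End power_functions.

(** * The Gamma function and shifted powers *)

Section gamma.
Context {R : realType}.
Notation mu := (@lebesgue_measure R).

Lemma is_derive_powR_max (m x : R) : 0 < m -> 0 < x ->
  is_derive x (1 : R) (fun x : R => m^-1 * (Num.max x 0) `^ m) (x `^ (m - 1)).
Proof.
move=> m0 x0; have d := is_derive1_powR m x0.
apply: (near_eq_is_derive (f := fun x => m^-1 * x `^ m)).
  near=> y; rewrite max_l//; apply: ltW; near: y; exact: lt_nbhsr.
apply: is_derive_eq; rewrite /GRing.scale/= ?mul0r ?addr0 mulrA mulVf ?mul1r//.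
by rewrite gt_eqF.
Unshelve. all: by end_near. Qed.

Lemma continuous_powR (m x : R) : 0 < x -> {for x, continuous (fun x : R => x `^ m)}.
Proof.
move=> x0; apply/differentiable_continuous/derivable1_diffP.
by have := is_derive1_powR m x0 => d; exact: ex_derive.
Qed.

Lemma integral_powR (m T : R) : 0 < m -> 0 < T ->
  mu.-integrable `]0, T[ (EFin \o (fun x => x `^ (m - 1))) /\
  \int[mu]_(x in `]0, T[) x `^ (m - 1) = m^-1 * T `^ m.
Proof.
move=> m0 T0.
have cF : continuous (fun x : R => m^-1 * (Num.max x 0) `^ m).
  by move=> x; apply: cvgM; [exact: cvg_cst|exact: continuous_powR_pos].
have := @ge0_FTC2_oo R (fun x => x `^ (m - 1)) (fun x : R => m^-1 * (Num.max x 0) `^ m) 0 T T0.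
rewrite maxxx powR0 ?gt_eqF// mulr0 subr0 (max_idPl (ltW T0)); apply.
- by move=> x _; exact: powR_ge0.
- by move=> x /andP[x0 _]; exact: continuous_powR.
- by move=> x /andP[x0 _]; exact: is_derive_powR_max.
- exact: cF.
- exact: cF.
Qed.

(** From [x <= exp x] at [x = k t / m], multiplied by [m / k] and raised to the power [m]; this
    gives [C = (m / k)^m]. *)
Lemma powR_le_expR (m k : R) : 0 < m -> 0 < k ->
  exists2 C, 0 <= C & forall t, 1 <= t -> t `^ (m - 1) <= C * expR (k * t).
Proof.
move=> m0 k0; exists ((m / k) `^ m); first exact: powR_ge0.
move=> t t1; have t0 : 0 < t by exact: lt_le_trans t1.
apply: (@le_trans _ _ (t `^ m)); first by rewrite ler_powR// gerBl.
have -> : expR (k * t) = (expR (k * t / m)) `^ m by rewrite -expRM divfK// gt_eqF.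
rewrite -powRM ?expR_ge0//; last by rewrite divr_ge0// ltW.
have h : t = m / k * (k * t / m) by field; rewrite !gt_eqF.
apply: ge0_ler_powR; rewrite ?nnegrE.
- exact: ltW.
- exact: ltW.
- by rewrite mulr_ge0 ?expR_ge0// divr_ge0// ltW.
rewrite {1}h ler_pM2l ?divr_gt0//.
have := expR_ge1Dx (k * t / m); lra.
Qed.

Lemma measurable_expRN (k : R) (D : set R) : measurable D -> measurable_fun D (fun t => expR (- (k * t))).
Proof.
move=> mD; apply: (measurable_funS measurableT) => //; apply: continuous_measurable_fun.
by move=> x; apply/differentiable_continuous/derivable1_diffP;
   have := is_derive_expRN k x => d; exact: ex_derive.
Qed.

(** Near [0] the power alone is integrable; beyond [1] half of the exponential absorbs it. *)
Lemma integrable_gamma (m s : R) : 0 < m -> 0 < s ->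
  mu.-integrable `[0, +oo[ (EFin \o (fun t => expR (- (s * t)) * t `^ (m - 1))).
Proof.
move=> m0 s0.
pose D : set R := [set` `[0, +oo[].
have mD : measurable D by exact: measurable_itv.
have s20 : 0 < s / 2 by rewrite divr_gt0.
have [C C0 HC] := powR_le_expR m0 s20.
have [i1 _] := integral_powR m0 (@ltr01 R).
(* The [1] in [1 + C] covers [t = 0], outside the open interval, where the power takes the value 1
   if [m = 1] and 0 otherwise. *)
apply: (@le_integrable_EFin _ _ _
  (fun t => ((fun x => x `^ (m - 1)) \_ `]0, 1[) t + (1 + C) * expR (- (s / 2 * t)))) => //.
- apply: measurable_funM; first exact: measurable_expRN.
  by apply: (measurable_funS measurableT) => //; exact: measurable_powR.
- move=> t; rewrite /= in_itv/= andbT => t0.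
  rewrite ger0_norm ?mulr_ge0 ?expR_ge0 ?powR_ge0// patchE.
  have E1 : expR (- (s * t)) <= 1 by rewrite expR_le1 oppr_le0 mulr_ge0// ltW.
  have E2 : 0 <= (1 + C) * expR (- (s / 2 * t)).
    by rewrite mulr_ge0 ?expR_ge0// addr_ge0.
  case: ifPn => [|].
    move=> _; apply: (@le_trans _ _ (t `^ (m - 1))); last by rewrite lerDl.
    by rewrite ler_piMl// powR_ge0.
  rewrite notin_setE/= in_itv/= => /negP; rewrite negb_and -!leNgt add0r.
  case/orP => ht.
    have -> : t = 0 by apply/eqP; rewrite eq_le ht.
    rewrite !mulr0 oppr0 expR0 mul1r mulr1.
    by rewrite /powR eqxx; case: (_ == _); rewrite /=; lra.
  apply: (@le_trans _ _ (expR (- (s * t)) * (C * expR (s / 2 * t)))).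
    by rewrite ler_wpM2l ?expR_ge0// HC.
  rewrite mulrCA -expRD (_ : - (s * t) + s / 2 * t = - (s / 2 * t)); last by field.
  by rewrite ler_wpM2r ?expR_ge0// lerDr.
- apply: integrableD_EFin => //; last first.
    by apply: integrableZl_EFin => //; exact: integrable_expRN.
  rewrite -restrict_EFin; apply/integrable_restrict => //.
  apply: integrableS i1 => //; exact: measurableI.
Qed.

(** The factor [1] displays this as the case [s = 1] of the Laplace integrals. *)
Definition Gamma_fun (m : R) : R :=
  \int[mu]_(t in `[0, +oo[) (expR (- (1 * t)) * t `^ (m - 1)).

Lemma laplace_powR (m s : R) : 0 < m -> 0 < s ->
  \int[mu]_(t in `[0, +oo[) (expR (- (s * t)) * t `^ (m - 1)) = Gamma_fun m * s `^ (- m).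
Proof.
move=> m0 s0; rewrite /Gamma_fun.
rewrite [in RHS](@Rintegral_affine R s 0)//; last exact: integrable_gamma.
have -> : (fun x : R => s * x + 0) @^-1` `[0, +oo[ = [set` `[0, +oo[].
  by apply/seteqP; split => x /=; rewrite !in_itv/= addr0 !andbT pmulr_rge0.
rewrite [in RHS](@eq_Rintegral _ _ _ mu _ (fun t => s `^ (m - 1) * (expR (- (s * t)) * t `^ (m - 1)))); last first.
  move=> t; rewrite inE/= in_itv/= andbT => t0.
  by rewrite addr0 mul1r powRM// ?ltW// mulrCA.
rewrite [in RHS]RintegralZl//; last exact: integrable_gamma.
rewrite mulrA mulr_powRB1 ?ltW// mulrAC -powRD ?subrr ?powRr0 ?mul1r//.
by apply/implyP => _; rewrite lt0r_neq0.
Qed.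

Lemma Gamma_fun_gt0 (m : R) : 0 < m -> 0 < Gamma_fun m.
Proof.
move=> m0; have [i1 I1] := integral_powR m0 (@ltr01 R).
apply: (@lt_le_trans _ _ (expR (-1) * (m^-1 * 1 `^ m))).
  by rewrite mulr_gt0 ?expR_gt0// mulr_gt0 ?invr_gt0// powR_gt0.
have mD1 : measurable [set` `]0, (1 : R)[] by exact: measurable_itv.
have e1 : mu.-integrable `]0, 1[ (EFin \o (fun x => expR (-1) * x `^ (m - 1))).
  exact: integrableZl_EFin.
rewrite -I1 -RintegralZl//.
have -> : [set` `]0, (1 : R)[] = [set` `[0, +oo[] `&` [set` `]0, 1[].
  by apply/seteqP; split => x /=; rewrite !in_itv/= ?andbT; [move=> /andP[h1 h2]; rewrite h1 h2 (ltW h1)|case].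
rewrite Rintegral_mkcondr; apply: le_Rintegral => //.
- rewrite -restrict_EFin; apply/integrable_restrict => //.
  apply: integrableS e1 => //; exact: measurableI.
- exact: integrable_gamma.
- move=> x /=; rewrite in_itv/= andbT => x0; rewrite patchE; case: ifPn => [|_].
    rewrite inE/= in_itv/= => /andP[_ x1].
    by rewrite ler_wpM2r ?powR_ge0// ler_expR mul1r lerN2 ltW.
  by rewrite mulr_ge0 ?expR_ge0 ?powR_ge0.
Qed.

(** Fubini instead of integration by parts: [t^m / m] is the integral of [u^(m-1)] over [0 < u < t],
    and integrating [exp(-t)] over [t > u] first leaves [exp(-u)]. *)
Lemma Gamma_funS (m : R) : 0 < m -> Gamma_fun (m + 1) = m * Gamma_fun m.
Proof.
move=> m0.
pose D : set R := [set` `[0, +oo[].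
have mD : measurable D by exact: measurable_itv.
pose f (t u : R) := expR (- (1 * t)) * u `^ (m - 1) * (u < t)%R%:R.
have mf : measurable_fun (D `*` D) (fun z : R * R => f z.1 z.2).
  apply: (measurable_funS measurableT) => //; apply: measurable_funM.
    apply: measurable_funM.
      exact: (measurableT_comp (@measurable_expRN 1 _ measurableT) measurable_fst).
    exact: (measurableT_comp (@measurable_powR R (m - 1)) measurable_snd).
  have -> : (fun z : R * R => (z.2 < z.1)%R%:R) = (fun z : R * R => if (z.2 < z.1)%R then 1 else 0 : R).
    by apply/funext => z; case: ifP.
  apply: measurable_fun_ifT => //.
  exact: (measurable_fun_ltr measurable_snd measurable_fst).
have h2 : 0 < 2^-1 :> R by [].
(* On [u < t] one has [exp(-t) <= exp(-t/2) exp(-u/2)], which gives the product bound. *)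
have [] := @Fubini_dominated R D D f (fun t => expR (- (2^-1 * t)))
  (fun u => expR (- (2^-1 * u)) * u `^ (m - 1)) mD mD mf.
- exact: integrable_expRN.
- exact: integrable_gamma.
- move=> t u; rewrite /D/= !in_itv/= !andbT => t0 u0.
  rewrite ger0_norm ?mulr_ge0 ?expR_ge0 ?powR_ge0//.
  rewrite /f; have [ut|_] := ltP u t; last first.
    by rewrite mulr0 !mulr_ge0 ?expR_ge0 ?powR_ge0.
  rewrite mulr1 mulrA ler_wpM2r ?powR_ge0// -expRD ler_expR; lra.
move=> _ E.
have L : \int[mu]_(x in D) \int[mu]_(y in D) f x y = m^-1 * Gamma_fun (m + 1).
  rewrite /Gamma_fun addrK -RintegralZl//; last first.
    have := @integrable_gamma (m + 1) 1; rewrite addrK; apply => //; exact: addr_gt0.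
  apply: eq_Rintegral => t; rewrite inE/D/= in_itv/= andbT le_eqVlt => /orP[/eqP <-|t0].
    rewrite powR0 ?gt_eqF// !mulr0 (@eq_Rintegral _ _ _ mu _ (cst 0)).
      by rewrite Rintegral_cst// mul0r.
    by move=> u; rewrite inE/= in_itv/= andbT => u0; rewrite /f ltNge u0 mulr0.
  have [i1 I1] := integral_powR m0 t0.
  rewrite mulrCA -I1 -RintegralZl// Rintegral_itv_obnd_cbnd; last exact: integrableZl_EFin.
  have -> : [set` `[0, t[] = D `&` [set` `[0, t[].
    by apply/seteqP; split => x /=; rewrite /D/= !in_itv/= ?andbT; [move=> /andP[-> ->]|case].
  rewrite Rintegral_mkcondr; apply: eq_Rintegral => u; rewrite inE/= in_itv/= andbT => u0.
  by rewrite /f patchE mem_setE in_itv/= u0/=; case: ifP => _; rewrite ?mulr1 ?mulr0.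
have Rr : \int[mu]_(y in D) \int[mu]_(x in D) f x y = Gamma_fun m.
  apply: eq_Rintegral => u; rewrite inE/D/= in_itv/= andbT => u0.
  have := @Rintegral_expRN R 1 u ltr01; rewrite invr1 mul1r => <-.
  have iu := @integrable_expRN R 1 u ltr01.
  have ic : mu.-integrable `[u, +oo[ (EFin \o (fun x => expR (- (1 * x)) * u `^ (m - 1))).
    have -> : (fun x => expR (- (1 * x)) * u `^ (m - 1)) = (fun x => u `^ (m - 1) * expR (- (1 * x))).
      by apply/funext => x; rewrite mulrC.
    exact: integrableZl_EFin.
  rewrite -RintegralZr// -Rintegral_itv_obnd_cbnd; last first.
    by apply: integrableS ic => //; apply: subset_itvr; rewrite bnd_simp.
  have -> : [set` `]u, +oo[] = D `&` [set` `]u, +oo[].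
    apply/seteqP; split => x /=; rewrite /D/= !in_itv/= ?andbT; last by case.
    by move=> ux; split=> //; rewrite (le_trans u0)// ltW.
  rewrite Rintegral_mkcondr; apply: eq_Rintegral => t _.
  by rewrite /f patchE mem_setE in_itv/= andbT; case: ifP => _; rewrite ?mulr1 ?mulr0.
by rewrite -Rr -E L mulrA divff ?mul1r// gt_eqF.
Qed.

Definition power_shift (m a t : R) : R :=
  (Gamma_fun m)^-1 * ((fun u => (u - a) `^ (m - 1)) \_ `]a, +oo[) t.

Lemma laplace_power_shift (m a s : R) : 0 < m -> 0 <= a -> 0 < s ->
  mu.-integrable `[0, +oo[ (EFin \o (fun t => expR (- (s * t)) * power_shift m a t)) /\
  \int[mu]_(t in `[0, +oo[) (expR (- (s * t)) * power_shift m a t) =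
  s `^ (- m) * expR (- (a * s)).
Proof.
move=> m0 a0 s0.
pose D : set R := [set` `[0, +oo[].
have mD : measurable D by exact: measurable_itv.
pose K := (Gamma_fun m)^-1 * expR (- (s * a)).
pose h t := expR (- (s * (1 * t + - a))) * (1 * t + - a) `^ (m - 1).
have preE : (fun x => 1 * x + - a) @^-1` D = [set` `[a, +oo[].
  by apply/seteqP; split => x /=; rewrite /D/= !in_itv/= !andbT mul1r subr_ge0.
have ig := integrable_gamma m0 s0.
have ih : mu.-integrable `[a, +oo[ (EFin \o h).
  by have := @integrable_affine R 1 (- a) _ D ltr01 mD ig; rewrite preE.
have Ih : \int[mu]_(t in `[a, +oo[) h t = Gamma_fun m * s `^ (- m).
  have := @Rintegral_affine R 1 (- a) _ D ltr01 mD ig; rewrite preE mul1r => <-.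
  exact: laplace_powR.
have iho : mu.-integrable `]a, +oo[ (EFin \o h).
  by apply: integrableS ih => //; apply: subset_itvr; rewrite bnd_simp.
have capE : D `&` [set` `]a, +oo[] = [set` `]a, +oo[].
  apply/seteqP; split => x /=; rewrite /D/= !in_itv/= !andbT; first by case.
  by move=> ax; split=> //; rewrite (le_trans a0)// ltW.
have -> : (fun t => expR (- (s * t)) * power_shift m a t) =
    (fun t => K * (h \_ `]a, +oo[) t).
  apply/funext => t; rewrite /power_shift /K /h !patchE mul1r.
  case: ifP => _; last by rewrite !mulr0.
  rewrite -[in RHS]mulrA [in RHS]mulrA -[in RHS]mulrA.
  rewrite (_ : expR (- (s * t)) = expR (- (s * a)) * expR (- (s * (t - a)))); first by ring.
  by rewrite -expRD; congr expR; ring.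
have ip : mu.-integrable D (EFin \o (h \_ `]a, +oo[)).
  by rewrite -restrict_EFin; apply/integrable_restrict => //; rewrite capE.
split; first exact: integrableZl_EFin.
rewrite RintegralZl// -Rintegral_mkcondr capE Rintegral_itv_obnd_cbnd// Ih /K.
rewrite [a * s]mulrC; field; rewrite gt_eqF//; exact: Gamma_fun_gt0.
Qed.

Lemma continuous_power_shift (m a t : R) : t != a ->
  {for t, continuous (power_shift m a)}.
Proof.
move=> ta; apply: cvgM; first exact: cvg_cst.
have [at0|ta0] := ltP a t.
  have c1 : {for t, continuous (fun u => (u - a) `^ (m - 1))}.
    apply: (@continuous_comp _ _ _ (fun u => u - a) (fun u => u `^ (m - 1))).
      by apply: cvgB; [exact: cvg_id|exact: cvg_cst].
    by apply: continuous_powR; rewrite subr_gt0.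
  rewrite /continuous_at patchE mem_setE in_itv/= at0/=.
  apply: cvg_trans c1; apply: near_eq_cvg; near=> u.
  rewrite patchE mem_setE in_itv/= andbT ifT//.
  by near: u; exact: lt_nbhsr.
have {}ta0 : t < a by rewrite lt_neqAle ta.
rewrite /continuous_at patchE mem_setE in_itv/= andbT ifF ?(le_gtF (ltW ta0))//.
apply: cvg_near_cst; near=> u; rewrite patchE mem_setE in_itv/= andbT ifF//.
by apply/le_gtF/ltW; near: u; exact: lt_nbhsl.
Unshelve. all: by end_near. Qed.

Lemma continuous_power_shiftS (m a : R) : 0 < m -> continuous (power_shift (m + 1) a).
Proof.
move=> m0; have -> : power_shift (m + 1) a =
    (fun t => (Gamma_fun (m + 1))^-1 * (Num.max (t - a) 0) `^ m).
  apply/funext => t; rewrite /power_shift addrK patchE mem_setE in_itv/= andbT.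
  have [at0|ta] := ltP a t; first by rewrite max_l// subr_ge0 ltW.
  by rewrite max_r ?subr_le0// powR0// gt_eqF.
move=> t; apply: cvgM; first exact: cvg_cst.
apply: (@continuous_comp _ _ _ (fun u => u - a) (fun u => (Num.max u 0) `^ m)).
  by apply: cvgB; [exact: cvg_id|exact: cvg_cst].
exact: continuous_powR_pos.
Qed.

(** As a function of [b] the integrand is a reflected power on [b < t]. Its primitive contributes
    [1 / m], which the functional equation of Gamma absorbs. *)
Lemma integral_power_shift (m a t : R) : 0 < m ->
  mu.-integrable `[a, +oo[ (EFin \o (fun b => power_shift m b t)) /\
  \int[mu]_(b in `[a, +oo[) power_shift m b t = power_shift (m + 1) a t.
Proof.
move=> m0; pose g b := (t - b) `^ (m - 1).
have E b : power_shift m b t = (Gamma_fun m)^-1 * (g \_ [set` `]-oo, t[]) b.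
  by rewrite /power_shift !patchE !mem_setE !in_itv/= andbT.
have -> : (fun b => power_shift m b t) = (fun b => (Gamma_fun m)^-1 * (g \_ [set` `]-oo, t[]) b).
  by apply/funext => b; exact: E.
have G0 := Gamma_fun_gt0 m0.
have [ta|ta] := leP t a.
  have capE : [set` `[a, +oo[] `&` [set` `]-oo, t[] = set0.
    apply/seteqP; split => x //=; rewrite !in_itv/= andbT => -[ax xt].
    by have := lt_le_trans xt (le_trans ta ax); rewrite ltxx.
  have ig : mu.-integrable `[a, +oo[ (EFin \o (g \_ [set` `]-oo, t[])).
    rewrite -restrict_EFin; apply/integrable_restrict => //.
    by rewrite capE; exact: integrable_set0.
  split; first exact: integrableZl_EFin.
  rewrite RintegralZl// -Rintegral_mkcondr capE Rintegral_set0 mulr0.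
  by rewrite /power_shift patchE mem_setE in_itv/= andbT ifF ?mulr0//; exact/le_gtF.
have cF : continuous (fun b : R => - (m^-1 * (Num.max (t - b) 0) `^ m)).
  move=> b; apply: cvgN; apply: cvgM; first exact: cvg_cst.
  apply: (@continuous_comp _ _ _ (fun b => t - b) (fun u => (Num.max u 0) `^ m)).
    by apply: cvgB; [exact: cvg_cst|exact: cvg_id].
  exact: continuous_powR_pos.
have FTC p : p < t -> mu.-integrable `]p, t[ (EFin \o g) /\
    \int[mu]_(b in `]p, t[) g b = m^-1 * (t - p) `^ m.
  move=> pt.
  have := @ge0_FTC2_oo R g (fun b : R => - (m^-1 * (Num.max (t - b) 0) `^ m)) p t pt.
  rewrite subrr maxxx powR0 ?gt_eqF// mulr0 oppr0 sub0r opprK max_l ?subr_ge0 ?ltW//.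
  apply.
  - by move=> b _; exact: powR_ge0.
  - move=> b /andP[_ bt]; apply: (@continuous_comp _ _ _ (fun b => t - b) (fun u => u `^ (m - 1))).
      by apply: cvgB; [exact: cvg_cst|exact: cvg_id].
    by apply: continuous_powR; rewrite subr_gt0.
  - move=> b /andP[_ bt].
    have tb0 : 0 < t - b by rewrite subr_gt0.
    have d1 : is_derive b (1 : R) (fun b => t - b) (-1).
      by rewrite -sub0r; exact: (is_deriveB (is_derive_cst t b 1) (is_derive_id b 1)).
    have d2 := is_derive1_comp (f := fun x : R => m^-1 * (Num.max x 0) `^ m)
      (g := fun b => t - b) (is_derive_powR_max m0 tb0) d1.
    by apply: is_derive_eq; rewrite /g mulrN1 opprK.
  - exact: cF.
  - exact: cF.
have [i1 I1] := FTC a ta.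
(* [FTC] treats open intervals; starting at [a - 1] makes [a] an interior point. *)
have ico : mu.-integrable `[a, t[ (EFin \o g).
  have a1t : a - 1 < t by rewrite (lt_trans _ ta)// gtrBl.
  apply: integrableS (FTC _ a1t).1 => //.
  by apply: subset_itvr; rewrite bnd_simp gtrBl.
have capE : [set` `[a, +oo[] `&` [set` `]-oo, t[] = [set` `[a, t[].
  apply/seteqP; split => x /=; rewrite !in_itv/= ?andbT; first by move=> [-> ->].
  by move=> /andP[].
have ig : mu.-integrable `[a, +oo[ (EFin \o (g \_ [set` `]-oo, t[])).
  by rewrite -restrict_EFin; apply/integrable_restrict => //; rewrite capE.
split; first exact: integrableZl_EFin.
rewrite RintegralZl// -Rintegral_mkcondr capE -Rintegral_itv_obnd_cbnd// I1.
rewrite /power_shift patchE mem_setE in_itv/= andbT ta Gamma_funS// addrK.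
by field; rewrite !gt_eqF.
Qed.

End gamma.

(** * Identification of the inverse transforms for [nu = 1] *)

Section integer_order.
Context {R : realType}.
Notation mu := (@lebesgue_measure R).

Lemma ae_sub2 (P Q S : R -> Prop) : (forall x, P x -> Q x -> S x) ->
  {ae mu, forall x, P x} -> {ae mu, forall x, Q x} -> {ae mu, forall x, S x}.
Proof. exact: (@filterS2 _ _ (ae_filter_ringOfSetsType mu)). Qed.

(** The passage from almost everywhere to a point: continuity of the representative [z] at [t] is
    inherited by [y], and two continuous representatives agree. *)
Lemma regular_representative_eq (y : R -> R[i]) (z : R -> R) (t : R) :
  regular_representative y -> 0 < t ->
  {ae mu, forall x, 0 < x -> complex.Re (y x) = z x} ->
  {ae mu, forall x, 0 < x -> complex.Im (y x) = 0} ->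
  {for t, continuous z} -> y t = (z t)%:C.
Proof.
move=> reg t0 aeRe aeIm cz.
have ae : {ae mu, forall x, 0 < x -> (z x)%:C = y x}.
  apply: ae_sub2 aeRe aeIm => x h1 h2 x0.
  by apply/eqP; rewrite eq_complex/= h1// h2// !eqxx.
have cz' : ccontinuous_at (fun x => (z x)%:C) t.
  by split=> /=; [exact: cz|exact: cvg_cst].
have [cRe cIm] := reg t _ t0 ae cz'.
have ReE := ae_continuous_eq t0 aeRe cRe cz.
have c0 : {for t, continuous (fun _ : R => 0 : R)} by exact: cvg_cst.
have ImE := ae_continuous_eq t0 aeIm cIm c0.
by apply/eqP; rewrite eq_complex/= ReE ImE !eqxx.
Qed.

Lemma laplace_realE (y : R -> R[i]) (s : R) :
  laplace_cvg y s%:C ->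
  [/\ mu.-integrable `[0, +oo[ (EFin \o (fun t => expR (- (s * t)) * complex.Re (y t))),
      mu.-integrable `[0, +oo[ (EFin \o (fun t => expR (- (s * t)) * complex.Im (y t))),
      complex.Re (laplace y s%:C) =
        \int[mu]_(t in `[0, +oo[) (expR (- (s * t)) * complex.Re (y t)) &
      complex.Im (laplace y s%:C) =
        \int[mu]_(t in `[0, +oo[) (expR (- (s * t)) * complex.Im (y t))].
Proof.
have E t : cexp (- s%:C * t%:C) = (expR (- (s * t)))%:C.
  by rewrite -rmorphN -rmorphM/= cexp_real mulNr.
have ERe t : complex.Re (cexp (- s%:C * t%:C) * y t) = expR (- (s * t)) * complex.Re (y t).
  by rewrite E; case: (y t) => u v /=; rewrite mul0r subr0.
have EIm t : complex.Im (cexp (- s%:C * t%:C) * y t) = expR (- (s * t)) * complex.Im (y t).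
  by rewrite E; case: (y t) => u v /=; rewrite mul0r addr0.
rewrite /laplace_cvg /cintegrable /laplace /cintegral.
have -> : (fun t => (complex.Re (cexp (- s%:C * t%:C) * y t))%:E) =
   (EFin \o (fun t => expR (- (s * t)) * complex.Re (y t))).
  by apply/funext => t; rewrite ERe.
have -> : (fun t => (complex.Im (cexp (- s%:C * t%:C) * y t))%:E) =
   (EFin \o (fun t => expR (- (s * t)) * complex.Im (y t))).
  by apply/funext => t; rewrite EIm.
move=> [iRe iIm]; split=> //=; apply: eq_Rintegral => t _; [exact: ERe|exact: EIm].
Qed.

Lemma inverse_laplace_unique_real (F : R[i] -> R[i]) (y : R -> R[i]) (z g : R -> R) :
  inverse_laplace F y ->
  (forall s, 0 < s -> F s%:C = (g s)%:C) ->
  (forall s, 0 < s ->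
    mu.-integrable `[0, +oo[ (EFin \o (fun t => expR (- (s * t)) * z t)) /\
    \int[mu]_(t in `[0, +oo[) (expR (- (s * t)) * z t) = g s) ->
  {ae mu, forall x, 0 < x -> complex.Re (y x) = z x} /\
  {ae mu, forall x, 0 < x -> complex.Im (y x) = 0}.
Proof.
move=> [[sigma H] _] Fg zg.
(* The integers from [m] on are both positive and beyond the abscissa, even if [sigma] is
   negative. *)
pose m := (Num.truncn sigma).+1.
have ms n : (m <= n)%N -> 0 < n%:R :> R /\ sigma < n%:R.
  move=> mn; rewrite ltr0n (leq_trans _ mn)//; split => //.
  by rewrite (lt_le_trans (Num.Theory.truncnS_gt sigma))// ler_nat.
have key n : (m <= n)%N -> [/\ mu.-integrable `[0, +oo[ (EFin \o (fun t => expR (- (n%:R * t)) * complex.Re (y t))),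
      mu.-integrable `[0, +oo[ (EFin \o (fun t => expR (- (n%:R * t)) * complex.Im (y t))),
      \int[mu]_(t in `[0, +oo[) (expR (- (n%:R * t)) * complex.Re (y t)) = g n%:R &
      \int[mu]_(t in `[0, +oo[) (expR (- (n%:R * t)) * complex.Im (y t)) = 0].
  move=> /ms[n0 sn].
  have [cv] := H (n%:R)%:C sn.
  have [iRe iIm <- <-] := laplace_realE cv.
  by move=> ->; rewrite Fg.
split.
  have : {ae mu, forall x, 0 < x -> complex.Re (y x) - z x = 0}.
    apply: (@laplace_real_unique _ _ m) => n mn.
    have [iRe _ IRe _] := key n mn; have [iz Iz] := zg _ (ms n mn).1.
    have -> : (fun t => expR (- (n%:R * t)) * (complex.Re (y t) - z t)) =
      (fun t => expR (- (n%:R * t)) * complex.Re (y t) - expR (- (n%:R * t)) * z t).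
      by apply/funext => t; rewrite mulrBr.
    split; first exact: integrableB_EFin.
    by rewrite RintegralB// IRe Iz subrr.
  apply: filterS; first exact: (ae_filter_ringOfSetsType mu).
  by move=> x h x0; apply/eqP; rewrite -subr_eq0; apply/eqP/h.
apply: (@laplace_real_unique _ _ m) => n mn.
by have [_ iIm _ IIm] := key n mn.
Qed.

(** The value of [f] at [t] is arbitrary. Measurability of [f] is part of what must be shown, and it
    comes from writing [f] as a case distinction on [x == t]. *)
Lemma integral_eq_off_point (t : R) (D : set R) (f g : R -> R) : measurable D ->
  mu.-integrable D (EFin \o g) -> (forall x, D x -> x != t -> f x = g x) ->
  mu.-integrable D (EFin \o f) /\ \int[mu]_(x in D) f x = \int[mu]_(x in D) g x.
Proof.
move=> mD ig fg.
have mg : measurable_fun D g by apply/measurable_EFinP; exact: measurable_int ig.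
have mgT := (measurable_restrictT g mD).1 mg.
have mf : measurable_fun D f.
  apply/(measurable_restrictT f mD).
  have -> : f \_ D = (fun x => if x == t then (f \_ D) t else (g \_ D) x).
    apply/funext => x; case: eqVneq => [->//|xt].
    by rewrite !patchE; case: ifPn => // /set_mem Dx; exact: fg.
  apply: measurable_fun_ifT => //.
    exact: measurable_fun_eqr.
have aefg : ae_eq mu D (EFin \o g) (EFin \o f).
  exists [set t]; split => //; first exact: lebesgue_measure_set1.
  move=> x /= /not_implyP[Dx]; apply: contra_notP => xt.
  by rewrite fg//; apply/eqP.
have mfE : measurable_fun D (EFin \o f) by exact/measurable_EFinP.
have mgE := measurable_int mu ig.
split.
  have [_ /integrableP[_ fin]] := (I, ig).
  apply/integrableP; split => //.
  rewrite (@ae_eq_integral _ _ _ mu _ (abse \o (EFin \o g)))//.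
  - exact: measurableT_comp.
  - exact: measurableT_comp.
  - apply: (@filterS _ _ (ae_filter_ringOfSetsType mu) _ _ _ aefg) => x h Dx /=.
    by have /= [->] := h Dx.
by rewrite /Rintegral (@ae_eq_integral _ _ _ mu _ (EFin \o g) (EFin \o f)) //; exact: ae_eq_sym.
Qed.

Lemma R_integral_nu1 (mu' a : R) (Rf : R -> R -> R -> R[i]) : 0 < mu' -> 0 < a ->
  (forall m b : R, 0 <= m -> 0 < b -> @R_is_function R m 1 ->
        inverse_laplace (R_symbol m 1 b) (Rf m b)) ->
  forall t, 0 < t ->
  cintegrable `[a, +oo[ (fun b => Rf mu' b t) /\
  Rf (mu' + 1) a t = cintegral `[a, +oo[ (fun b => Rf mu' b t).
Proof.
move=> m0 a0 H t t0.
have rep m b : 0 < m -> 0 < b -> {for t, continuous (power_shift m b)} ->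
    Rf m b t = (power_shift m b t)%:C.
  move=> {}m0 b0 cz.
  have inv := H m b (ltW m0) b0 (or_intror m0).
  have Fs s : 0 < s -> R_symbol m 1 b s%:C = (s `^ (- m) * expR (- (b * s)))%:C.
    by move=> s0; rewrite R_symbol_real// powRr1// ltW.
  have [h1 h2] := @inverse_laplace_unique_real _ _ (power_shift m b)
    (fun s => s `^ (- m) * expR (- (b * s))) inv
    Fs
    (fun s s0 => laplace_power_shift m0 (ltW b0) s0).
  exact: (regular_representative_eq inv.2 t0 h1 h2 cz).
pose D : set R := [set` `[a, +oo[].
have mD : measurable D by exact: measurable_itv.
(* At [b = t] the power may jump or blow up, and then the value of [Rf] is not determined. *)
have repD b : D b -> b != t -> Rf mu' b t = (power_shift mu' b t)%:C.
  rewrite /D/= in_itv/= andbT => ab bt; apply: rep => //; first exact: lt_le_trans ab.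
  by apply: continuous_power_shift; rewrite eq_sym.
have [ip Ip] := integral_power_shift a t m0.
have [iRe IRe] := @integral_eq_off_point t D (fun b => complex.Re (Rf mu' b t))
  (fun b => power_shift mu' b t) mD ip (fun b Db bt => congr1 (@complex.Re R) (repD b Db bt)).
have [iIm IIm] := @integral_eq_off_point t D (fun b => complex.Im (Rf mu' b t))
  (fun b => 0) mD (integrable0 mu D) (fun b Db bt => congr1 (@complex.Im R) (repD b Db bt)).
split; first by split.
rewrite rep//; [|exact: addr_gt0|exact: continuous_power_shiftS].
by apply/eqP; rewrite eq_complex/= IRe IIm Ip Rintegral_cst// mul0r !eqxx.
Qed.

(** Once the two distributions are identified as the Dirac delta at [a'] and the unit step at [a],
    both sides are the integral of [phi] from [a] on. *)
Lemma R_distr_integral (a : R) (Rd : R -> R -> (R -> R) -> R[i]) : 0 < a ->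
  (forall mu' a' : R, 0 <= mu' -> 0 < a' ->
        inverse_laplace_distr (R_symbol mu' 1 a') (Rd mu' a')) ->
  forall phi : R -> R, test_function_pos phi ->
  cintegrable `[a, +oo[ (fun a' => Rd 0 a' phi) /\
  Rd 1 a phi = cintegral `[a, +oo[ (fun a' => Rd 0 a' phi).
Proof.
move=> a0 H phi tphi.
have rep m b (S : (R -> R) -> R[i]) c : 0 <= m -> 0 < b -> laplace_distribution c S ->
    (forall n : nat, (0 < n)%N -> S (fun t => expR (- (n%:R * t))) =
      (n%:R `^ (- m) * expR (- (b * n%:R)))%:C) ->
    Rd m b phi = S phi.
  move=> m0 b0 dS SE; have [c' [dT HT]] := H m b m0 b0.
  apply: (@laplace_distribution_unique _ _ _ _ _ (Num.truncn c').+1 _ dT dS) => // n nc.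
  have n0 : 0 < n%:R :> R by rewrite ltr0n (leq_trans _ nc).
  rewrite SE; last by rewrite (leq_trans _ nc).
  rewrite -(laplace_distr_real _ dT) HT; last first.
    by rewrite /= (lt_le_trans (Num.Theory.truncnS_gt c'))// ler_nat.
  by rewrite R_symbol_real// powRr1// ltW.
have rep0 b : 0 < b -> Rd 0 b phi = (phi b)%:C.
  move=> b0; apply: (rep 0 b (fun phi => (phi b)%:C) 0) => //.
    by apply: laplace_distribution_dirac; exact: ltW.
  by move=> n _; rewrite oppr0 powRr0 mul1r mulrC.
have E b : b \in [set` `[a, +oo[] -> Rd 0 b phi = (phi b)%:C.
  by rewrite inE/= in_itv/= andbT => ab; apply: rep0; exact: lt_le_trans ab.
have iphi : mu.-integrable `[a, +oo[ (EFin \o phi).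
  by apply: laplace_test_integrable; [exact: ltW|exact: test_function_pos_laplace].
split.
  split.
    apply: eq_integrable iphi => // b Db /=; by rewrite E.
  apply: (@eq_integrable _ _ _ mu _ _ (cst 0)) => //; last exact: integrable0.
  by move=> b Db; rewrite E.
rewrite (rep 1 a (fun phi => (\int[mu]_(t in `[a, +oo[) phi t)%:C) 1)//.
- apply/eqP; rewrite eq_complex/=; apply/andP; split; apply/eqP.
    by apply: eq_Rintegral => b Db; rewrite E.
  rewrite (@eq_Rintegral _ _ _ mu _ (cst 0)); first by rewrite Rintegral_cst// mul0r.
  by move=> b Db; rewrite E.
- by apply: laplace_distribution_step; exact: ltW.
- by move=> n n0; rewrite Rintegral_expRN ?ltr0n// powR_inv1// mulrC [a * _]mulrC mulrC.
Qed.

End integer_order.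

(** * Fourier inversion on the half-line *)

Section fourier.
Context {R : realType}.
Notation mu := (@lebesgue_measure R).
Let D : set R := [set` `[0, +oo[].
Let mD : measurable D. Proof. exact: measurable_itv. Qed.

Lemma is_derive_cosM (c t : R) : is_derive t (1 : R) (fun w => cos (c * w)) (- c * sin (c * t)).
Proof.
have -> : (fun w => cos (c * w)) = cos \o (fun w => c * w) by [].
by apply: is_derive_eq; rewrite /GRing.scale/= ?mulr1; ring.
Qed.

Lemma is_derive_sinM (c t : R) : is_derive t (1 : R) (fun w => sin (c * w)) (c * cos (c * t)).
Proof.
have -> : (fun w => sin (c * w)) = sin \o (fun w => c * w) by [].
by apply: is_derive_eq; rewrite /GRing.scale/= ?mulr1; ring.
Qed.

Lemma measurable_cosM (E : set R) (c : R) : measurable E -> measurable_fun E (fun w => cos (c * w)).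
Proof.
move=> mE; apply: (measurable_funS measurableT) => //; apply: continuous_measurable_fun.
by move=> x; apply/differentiable_continuous/derivable1_diffP;
   have := is_derive_cosM c x => d; exact: ex_derive.
Qed.

Lemma measurable_sinM (E : set R) (c : R) : measurable E -> measurable_fun E (fun w => sin (c * w)).
Proof.
move=> mE; apply: (measurable_funS measurableT) => //; apply: continuous_measurable_fun.
by move=> x; apply/differentiable_continuous/derivable1_diffP;
   have := is_derive_sinM c x => d; exact: ex_derive.
Qed.

Lemma integrable_mul_cosM (h : R -> R) (w : R) : mu.-integrable D (EFin \o h) ->
  mu.-integrable D (EFin \o (fun u => cos (u * w) * h u)).
Proof.
move=> ih; have mh : measurable_fun D h by apply/measurable_EFinP; exact: measurable_int ih.
apply: (@le_integrable_EFin _ _ _ (fun u => `|h u|)) => //; last exact: integrable_norm.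
  apply: measurable_funM => //; under eq_fun do rewrite mulrC.
  exact: measurable_cosM.
by move=> u _; rewrite normrM ler_piMl// cos_max.
Qed.

Lemma integrable_mul_sinM (h : R -> R) (w : R) : mu.-integrable D (EFin \o h) ->
  mu.-integrable D (EFin \o (fun u => sin (u * w) * h u)).
Proof.
move=> ih; have mh : measurable_fun D h by apply/measurable_EFinP; exact: measurable_int ih.
apply: (@le_integrable_EFin _ _ _ (fun u => `|h u|)) => //; last exact: integrable_norm.
  apply: measurable_funM => //; under eq_fun do rewrite mulrC.
  exact: measurable_sinM.
by move=> u _; rewrite normrM ler_piMl// sin_max.
Qed.

Lemma poisson_kernel (e x : R) : 0 < e ->
  \int[mu]_(w in D) (expR (- (e * w)) * cos (x * w)) = e / (e ^+ 2 + x ^+ 2).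
Proof.
move=> e0.
have N0 : e ^+ 2 + x ^+ 2 != 0 by rewrite gt_eqF// ltr_pwDl ?sqr_ge0// exprn_gt0.
(* The real part of [exp((-e + i x) w) / (-e + i x)]. *)
pose F w := (e ^+ 2 + x ^+ 2)^-1 * (expR (- (e * w)) * (x * sin (x * w) - e * cos (x * w))).
have dF w : is_derive w (1 : R) F (expR (- (e * w)) * cos (x * w)).
  have d1 := is_derive_expRN e w; have d2 := is_derive_cosM x w; have d3 := is_derive_sinM x w.
  by apply: is_derive_eq; rewrite /GRing.scale/= ?mul0r ?addr0; field.
have cf : continuous (fun w => expR (- (e * w)) * cos (x * w)).
  move=> w; apply/differentiable_continuous/derivable1_diffP.
  have d1 := is_derive_expRN e w; have d2 := is_derive_cosM x w.
  by apply: derivableM; exact: ex_derive.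
rewrite (@Rintegral_FTC2y _ _ F 0 0)//.
- by rewrite /F !mulr0 oppr0 expR0 sin0 cos0; field.
- apply: (@le_integrable_EFin _ _ _ (fun w => expR (- (e * w)))) => //.
  + by apply: (measurable_funS measurableT) => //; exact: continuous_measurable_fun.
  + by move=> w _; rewrite normrM (ger0_norm (expR_ge0 _)) ler_piMr ?expR_ge0// cos_max.
  + exact: integrable_expRN.
- rewrite -[X in _ --> X](mulr0 (e ^+ 2 + x ^+ 2)^-1); apply: cvgM; first exact: cvg_cst.
  have E0 : expR (- (e * w)) * (`|x| + e) @[w --> +oo] --> 0.
    by rewrite -[X in _ --> X](mul0r (`|x| + e)); apply: cvgM; [exact: cvg_expRN|exact: cvg_cst].
  apply/cvgr0Pnorm_lt => d d0; near=> w.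
  apply: (@le_lt_trans _ _ (expR (- (e * w)) * (`|x| + e))); last first.
    by near: w; exact: (cvgr_lt _ E0).
  rewrite normrM (ger0_norm (expR_ge0 _)) ler_wpM2l ?expR_ge0//.
  rewrite (le_trans (ler_normB _ _))// !normrM (gtr0_norm e0) lerD//.
    by rewrite ler_piMr// sin_max.
  by rewrite ler_piMr ?(ltW e0)// cos_max.
Unshelve. all: by end_near. Qed.

(* The inverse Fourier integral, folded onto [w >= 0] by parity. *)
Definition osc (A B : R -> R) (t : R) : R :=
  pi^-1 * \int[mu]_(w in D) (A w * cos (t * w) + B w * sin (t * w)).

Section osc.
Variables A B : R -> R.
Hypothesis iA : mu.-integrable D (EFin \o A).
Hypothesis iB : mu.-integrable D (EFin \o B).

Let mA : measurable_fun D A.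
Proof. by apply/measurable_EFinP; exact: measurable_int iA. Qed.
Let mB : measurable_fun D B.
Proof. by apply/measurable_EFinP; exact: measurable_int iB. Qed.

Let iAB : mu.-integrable D (EFin \o (fun w => `|A w| + `|B w|)).
Proof. by apply: integrableD_EFin => //; exact: integrable_norm. Qed.

Let bound t w : `|A w * cos (t * w) + B w * sin (t * w)| <= `|A w| + `|B w|.
Proof.
rewrite (le_trans (ler_normD _ _))// !normrM lerD// ler_piMr//.
  exact: cos_max.
exact: sin_max.
Qed.

Let mosc t : measurable_fun D (fun w => A w * cos (t * w) + B w * sin (t * w)).
Proof.
apply: measurable_funD; apply: measurable_funM => //.
  exact: measurable_cosM.
exact: measurable_sinM.
Qed.

Lemma integrable_osc t :
  mu.-integrable D (EFin \o (fun w => A w * cos (t * w) + B w * sin (t * w))).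
Proof. by apply: le_integrable_EFin iAB => // w _; exact: bound. Qed.

Lemma continuous_osc : continuous (osc A B).
Proof.
move=> t; apply: cvgM; first exact: cvg_cst.
have := @continuity_under_integral R _ _ mu (fun t w => A w * cos (t * w) + B w * sin (t * w)) D mD
  (t - 1) (t + 1) (fun x _ => integrable_osc x).
move=> /(_ _ (fun w => `|A w| + `|B w|)); apply.
- apply: aeW => w _ x _.
  have cl : {for x, continuous (fun t : R => t * w)} by apply: cvgM; [exact: cvg_id|exact: cvg_cst].
  have c1 := continuous_comp cl (@continuous_cos R (x * w)).
  have c2 := continuous_comp cl (@continuous_sin R (x * w)).
  by apply: cvgD; apply: cvgM; try exact: cvg_cst; [exact: c1|exact: c2].
- exact: iAB.
- by move=> x _; apply: aeW => w _; exact: bound.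
- by rewrite inE/= in_itv/=; apply/andP; split; lra.
Qed.

End osc.

End fourier.

(** * Abel summation of the inversion integral *)

Section poisson_smoothing.
Context {R : realType}.
Notation mu := (@lebesgue_measure R).
Let D : set R := [set` `[0, +oo[].
Let mD : measurable D. Proof. exact: measurable_itv. Qed.

Variable f : R -> R.
Hypothesis intf : mu.-integrable D (EFin \o f).

Let mf : measurable_fun D f.
Proof. by apply/measurable_EFinP; exact: measurable_int intf. Qed.
Let inormf : mu.-integrable D (EFin \o (fun u => `|f u|)).
Proof. exact: integrable_norm. Qed.

Definition cos_transform (w : R) : R := \int[mu]_(u in D) (cos (u * w) * f u).
Definition sin_transform (w : R) : R := \int[mu]_(u in D) (sin (u * w) * f u).

Let A := cos_transform.
Let B := sin_transform.

(* Abel summation of the inversion integral is convolution with the Poisson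
   kernel. *)
Let poisson_smoothing (e t : R) : 0 < e ->
  \int[mu]_(w in D) (expR (- (e * w)) * (A w * cos (t * w) + B w * sin (t * w))) =
  \int[mu]_(u in D) (f u * (e / (e ^+ 2 + (t - u) ^+ 2))).
Proof.
move=> e0.
pose k (w u : R) := expR (- (e * w)) * (cos ((t - u) * w) * f u).
have mk : measurable_fun (D `*` D) (fun z : R * R => k z.1 z.2).
  apply: measurable_funM.
    apply: (measurable_funS measurableT) => //.
    exact: (measurableT_comp (@measurable_expRN R e _ measurableT) measurable_fst).
  apply: measurable_funM.
    apply: (measurable_funS measurableT) => //.
    apply: (measurableT_comp (f := @cos R)).
      by apply: continuous_measurable_fun; exact: continuous_cos.
    apply: measurable_funM; last exact: measurable_fst.
    by apply: measurable_funB; [exact: measurable_cst|exact: measurable_snd].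
  apply: (measurable_comp mD _ mf); first by move=> _ [[x y] [_ /= Dy] <-].
  by apply: (measurable_funS measurableT) => //; exact: measurable_snd.
have [] := @Fubini_dominated R D D k (fun w => expR (- (e * w))) (fun u => `|f u|) mD mD mk.
- exact: integrable_expRN.
- exact: inormf.
- move=> w u _ _; rewrite /k !normrM (ger0_norm (expR_ge0 _)) ler_wpM2l ?expR_ge0//.
  by rewrite ler_piMl// cos_max.
move=> _ E; transitivity (\int[mu]_(x in D) \int[mu]_(y in D) k x y).
  apply: eq_Rintegral => w _.
  have icos := integrable_mul_cosM w intf; have isin := integrable_mul_sinM w intf.
  rewrite /k RintegralZl//; last first.
    have := @le_integrable_EFin R D (fun u => cos ((t - u) * w) * f u) _ mD _ _ inormf; apply.
      apply: measurable_funM => //; apply: (measurable_funS measurableT) => //.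
      apply: (measurableT_comp (f := @cos R)).
        by apply: continuous_measurable_fun; exact: continuous_cos.
      apply: measurable_funM => //; exact: measurable_funB.
    by move=> u _; rewrite normrM ler_piMl// cos_max.
  congr (_ * _); rewrite /A /B /cos_transform /sin_transform -!RintegralZr// -RintegralD//.
  + apply: eq_Rintegral => u _; rewrite mulrBl cosB; ring.
  + have := integrableZl_EFin (cos (t * w)) mD icos.
    by congr (integrable _ _ _); apply/funext => u /=; rewrite mulrC.
  + have := integrableZl_EFin (sin (t * w)) mD isin.
    by congr (integrable _ _ _); apply/funext => u /=; rewrite mulrC.
rewrite E; apply: eq_Rintegral => u _.
rewrite -(poisson_kernel _ e0) -RintegralZl//; last first.
  apply: (@le_integrable_EFin _ _ _ (fun w => expR (- (e * w)))) => //.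
  + by apply: measurable_funM; [exact: measurable_expRN|exact: measurable_cosM].
  + by move=> w _; rewrite normrM (ger0_norm (expR_ge0 _)) ler_piMr ?expR_ge0// cos_max.
  + exact: integrable_expRN.
by apply: eq_Rintegral => w _; rewrite /k; ring.
Qed.

Let poisson_atan (e u p q : R) : 0 < e -> p < q ->
  \int[mu]_(t in `]p, q]) (e / (e ^+ 2 + (t - u) ^+ 2)) =
  atan ((q - u) / e) - atan ((p - u) / e).
Proof.
move=> e0 pq.
have N0 t : e ^+ 2 + (t - u) ^+ 2 != 0 by rewrite gt_eqF// ltr_pwDl ?sqr_ge0// exprn_gt0.
pose F t := atan ((t - u) / e).
have dl t : is_derive t (1 : R) (fun t => (t - u) / e) e^-1.
  have d1 := is_deriveB (is_derive_id t (1 : R)) (is_derive_cst u t (1 : R)).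
  have d2 : is_derive t (1 : R) (fun t => t - u) 1 by rewrite -[X in is_derive _ _ _ X]subr0; exact: d1.
  by apply: is_derive_eq; rewrite /GRing.scale/= ?mulr0 ?add0r ?addr0 ?mulr1.
have dF t : is_derive t (1 : R) F (e / (e ^+ 2 + (t - u) ^+ 2)).
  have := is_derive1_comp (f := @atan R) (g := fun t => (t - u) / e) (is_derive1_atan ((t - u) / e)) (dl t).
  move=> d; apply: is_derive_eq.
  by field; rewrite N0 gt_eqF.
have cF : continuous F.
  by move=> t; apply/differentiable_continuous/derivable1_diffP; exact: ex_derive.
have cf : continuous (fun t => e / (e ^+ 2 + (t - u) ^+ 2)).
  move=> t; apply: cvgM; first exact: cvg_cst.
  apply: cvgV => //; apply: cvgD; first exact: cvg_cst.
  apply: (@continuous_comp _ _ _ (fun t => t - u) (fun x => x ^+ 2)); last exact: exprn_continuous.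
  by apply: cvgB; [exact: cvg_id|exact: cvg_cst].
have icc : mu.-integrable `[p, q] (EFin \o (fun t => e / (e ^+ 2 + (t - u) ^+ 2))).
  apply: continuous_compact_integrable; first exact: segment_compact.
  exact: continuous_subspaceT.
rewrite Rintegral_itv_obnd_cbnd; last first.
  by apply: integrableS icc => //; apply: subset_itvr; rewrite bnd_simp.
exact: Rintegral_FTC2.
Qed.

(** Integrating over [t] as well replaces the Poisson kernel, which is unbounded as [e] tends to
    [0], by arctangents, which stay bounded and converge pointwise. *)
Lemma smoothed_itv (e p q : R) : 0 < e -> p < q ->
  \int[mu]_(t in `]p, q])
    \int[mu]_(w in D) (expR (- (e * w)) * (A w * cos (t * w) + B w * sin (t * w))) =
  \int[mu]_(u in D) (f u * (atan ((q - u) / e) - atan ((p - u) / e))).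
Proof.
move=> e0 pq.
pose k (t u : R) := f u * (e / (e ^+ 2 + (t - u) ^+ 2)).
pose E : set R := [set` `]p, q]].
have mE : measurable E by exact: measurable_itv.
have N0 t u : 0 < e ^+ 2 + (t - u) ^+ 2 by rewrite ltr_pwDl ?sqr_ge0// exprn_gt0.
have mk : measurable_fun (E `*` D) (fun z : R * R => k z.1 z.2).
  apply: measurable_funM.
    apply: (measurable_comp mD _ mf); first by move=> _ [[x y] [_ /= Dy] <-].
    by apply: (measurable_funS measurableT) => //; exact: measurable_snd.
  apply: (measurable_funS measurableT) => //.
  have cg : continuous (fun x : R => e / (e ^+ 2 + x ^+ 2)).
    move=> x; apply: cvgM; first exact: cvg_cst.
    apply: cvgV; first by have := N0 x 0; rewrite subr0; exact: lt0r_neq0.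
    by apply: cvgD; [exact: cvg_cst|exact: exprn_continuous].
  apply: (measurableT_comp (continuous_measurable_fun cg)).
  by apply: measurable_funB; [exact: measurable_fst|exact: measurable_snd].
have [] := @Fubini_dominated R E D k (fun=> e^-1) (fun u => `|f u|) mE mD mk.
- have cc : continuous (fun _ : R => e^-1) by move=> x; exact: cvg_cst.
  have icc : mu.-integrable `[p, q] (EFin \o (fun _ : R => e^-1)).
    apply: continuous_compact_integrable; first exact: segment_compact.
    exact: continuous_subspaceT.
  by apply: integrableS icc => //; apply: subset_itvr; rewrite bnd_simp.
- exact: inormf.
- move=> t u _ _; rewrite /k normrM mulrC ler_wpM2r//.
  rewrite ger0_norm; last by rewrite divr_ge0// ltW.
  rewrite ler_pdivrMr// mulrDr mulrA expr2 mulrA mulVf ?gt_eqF// mul1r lerDl.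
  by rewrite -mulrA mulr_ge0 ?invr_ge0 ?(ltW e0)// -expr2 sqr_ge0.
move=> _ EE; transitivity (\int[mu]_(x in E) \int[mu]_(y in D) k x y).
  by apply: eq_Rintegral => t _; exact: poisson_smoothing.
rewrite EE; apply: eq_Rintegral => u _.
have cg : continuous (fun t : R => e / (e ^+ 2 + (t - u) ^+ 2)).
  move=> x; apply: cvgM; first exact: cvg_cst.
  apply: cvgV; first exact: lt0r_neq0.
  apply: cvgD; first exact: cvg_cst.
  apply: (@continuous_comp _ _ _ (fun t => t - u) (fun x => x ^+ 2)); last exact: exprn_continuous.
  by apply: cvgB; [exact: cvg_id|exact: cvg_cst].
rewrite /k RintegralZl//; first by rewrite poisson_atan.
have icc : mu.-integrable `[p, q] (EFin \o (fun t => e / (e ^+ 2 + (t - u) ^+ 2))).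
  apply: continuous_compact_integrable; first exact: segment_compact.
  exact: continuous_subspaceT.
by apply: integrableS icc => //; apply: subset_itvr; rewrite bnd_simp.
Qed.

End poisson_smoothing.

(** * The limit of vanishing damping *)

Section fourier_inversion.
Context {R : realType}.
Notation mu := (@lebesgue_measure R).
Let D : set R := [set` `[0, +oo[].
Let mD : measurable D. Proof. exact: measurable_itv. Qed.

Variable f : R -> R.
Hypothesis intf : mu.-integrable D (EFin \o f).

Let mf : measurable_fun D f.
Proof. by apply/measurable_EFinP; exact: measurable_int intf. Qed.
Let inormf : mu.-integrable D (EFin \o (fun u => `|f u|)).
Proof. exact: integrable_norm. Qed.

Let A := cos_transform f.
Let B := sin_transform f.

Let eps (n : nat) : R := n.+1%:R^-1.
Let eps0 n : 0 < eps n. Proof. by rewrite /eps invr_gt0. Qed.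

Let cvg_atan_sg (c : R) : atan (c / eps n) @[n --> \oo] --> pi / 2 * Num.sg c.
Proof.
have pos (x : R) : 0 < x -> atan (x / eps n) @[n --> \oo] --> (pi / 2 : R).
  move=> x0; have xy : x / eps n @[n --> \oo] --> +oo.
    rewrite (_ : (fun n => x / eps n) = (fun n => x * n.+1%:R)); last first.
      by apply/funext => n; rewrite /eps invrK.
    apply/cvgryPge => M; near=> n.
    rewrite -ler_pdivrMl// (@le_trans _ _ n%:R)// ?ler_nat//.
    by near: n; exact: nbhs_infty_ger.
  exact: (cvg_comp _ _ xy (@cvgy_atan R)).
have [c0|c0|->] := ltgtP c 0.
- rewrite ltr0_sg// mulrN1 (_ : (fun n => atan (c / eps n)) = (fun n => - atan (- c / eps n))).
    by apply: cvgN; apply: pos; rewrite oppr_gt0.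
  by apply/funext => n; rewrite mulNr atanN opprK.
- by rewrite gtr0_sg// mulr1; exact: pos.
- rewrite sgr0 mulr0 (_ : (fun n => atan (0 / eps n)) = cst 0); first exact: cvg_cst.
  by apply/funext => n; rewrite mul0r atan0.
Unshelve. all: by end_near. Qed.

Let normr_atan_le (x : R) : `|atan x| <= pi / 2.
Proof. by rewrite ler_norml !ltW// ?atan_gtNpi2 ?atan_ltpi2. Qed.

(** The arctangents tend to [pi / 2] times signs, so the limit integrand [L] is [pi f] between [p]
    and [q], half of that at the two endpoints and [0] outside. *)
Let limit_right (p q : R) : 0 < p -> p < q ->
  \int[mu]_(u in D) (f u * (atan ((q - u) / eps n) - atan ((p - u) / eps n)))
    @[n --> \oo] --> pi * \int[mu]_(u in `]p, q]) f u.
Proof.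
move=> p0 pq.
pose L u : R := f u * (pi / 2 * Num.sg (q - u) - pi / 2 * Num.sg (p - u)).
have matan (c e : R) : measurable_fun D (fun u => atan ((c - u) / e)).
  apply: (measurable_funS measurableT) => //; apply: continuous_measurable_fun => x.
  have cl : {for x, continuous (fun u : R => (c - u) / e)}.
    by apply: cvgM; [apply: cvgB; [exact: cvg_cst|exact: cvg_id]|exact: cvg_cst].
  exact: (continuous_comp cl (@continuous_atan R _)).
have [] := @Rdominated_convergence R D
  (fun n u => f u * (atan ((q - u) / eps n) - atan ((p - u) / eps n))) L
  (fun u => pi * `|f u|) mD.
- by move=> n; apply: measurable_funM => //; apply: measurable_funB; exact: matan.
- move=> u _; apply: cvgM; first exact: cvg_cst.
  by apply: cvgB; exact: cvg_atan_sg.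
- exact: integrableZl_EFin.
- move=> n u _; rewrite normrM mulrC ler_wpM2r//.
  rewrite (le_trans (ler_normB _ _))// [leRHS]splitr lerD//.
move=> iL; suff -> : \int[mu]_(u in D) L u = pi * \int[mu]_(u in `]p, q]) f u by [].
have ipq : mu.-integrable D (EFin \o (f \_ `]p, q])).
  rewrite -restrict_EFin; apply/integrable_restrict => //.
  apply: integrableS intf => //; exact: measurableI.
have capE : D `&` [set` `]p, q]] = [set` `]p, q]].
  apply/seteqP; split => x /=; rewrite /D/= !in_itv/= ?andbT; first by case.
  by move=> /andP[h1 h2]; rewrite h1 h2 (le_trans (ltW p0))// ltW.
have -> : pi * \int[mu]_(u in `]p, q]) f u = \int[mu]_(u in D) (pi * (f \_ `]p, q]) u).
  by rewrite RintegralZl// -Rintegral_mkcondr capE.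
have ip := integrableZl_EFin pi mD ipq.
(* An intermediate function agreeing with [L] at [q], so that each of two applications has a single
   exceptional point. *)
have [i2 E2] := @integral_eq_off_point R q D (fun u => if u == q then L q else pi * (f \_ `]p, q]) u)
  _ mD ip (fun x _ xq => ifN_eq _ _ xq).
rewrite -E2; have [] := @integral_eq_off_point R p D L _ mD i2; last by [].
move=> u _ up; case: eqVneq => [->//|uq].
rewrite /L patchE mem_setE in_itv/= -[point]/(0 : R).
have [pu|pu|pu] := ltgtP p u; last by rewrite pu eqxx in up.
  have [qu|qu|qu] := ltgtP q u; last by rewrite qu eqxx in uq.
    by rewrite !ltr0_sg ?subr_lt0//=; ring.
  by rewrite (gtr0_sg (x := q - u)) ?subr_gt0// (ltr0_sg (x := p - u)) ?subr_lt0//=; field.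
by rewrite !gtr0_sg ?subr_gt0 ?(lt_trans pu pq)//=; ring.
Qed.

Hypothesis iA : mu.-integrable D (EFin \o A).
Hypothesis iB : mu.-integrable D (EFin \o B).

(** Dominated convergence twice: in [w] for fixed [t], by the integrable [g], and then in [t], by
    the constant integral of [g]. Integrability of both transforms enters here. *)
Let limit_left (p q : R) : p < q ->
  \int[mu]_(t in `]p, q])
    \int[mu]_(w in D) (expR (- (eps n * w)) * (A w * cos (t * w) + B w * sin (t * w)))
    @[n --> \oo] --> pi * \int[mu]_(t in `]p, q]) osc A B t.
Proof.
move=> pq.
pose E : set R := [set` `]p, q]].
have mE : measurable E by exact: measurable_itv.
pose g w := `|A w| + `|B w|.
have ig : mu.-integrable D (EFin \o g) by apply: integrableD_EFin => //; exact: integrable_norm.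
have bound t w : `|A w * cos (t * w) + B w * sin (t * w)| <= g w.
  rewrite (le_trans (ler_normD _ _))// !normrM lerD// ler_piMr//.
    exact: cos_max.
  exact: sin_max.
have E1 (n : nat) w : D w -> 0 <= expR (- (eps n * w)) <= 1.
  by rewrite /D/= in_itv/= andbT => w0; rewrite expR_ge0/= expR_le1 oppr_le0 mulr_ge0// ltW.
have boundn n t w : D w -> `|expR (- (eps n * w)) * (A w * cos (t * w) + B w * sin (t * w))| <= g w.
  move=> /(E1 n)/andP[h1 h2]; rewrite normrM (ger0_norm h1).
  by rewrite (le_trans _ (bound t w))// ler_piMl.
have ieA n (h : R -> R) : mu.-integrable D (EFin \o h) ->
    mu.-integrable D (EFin \o (fun w => expR (- (eps n * w)) * h w)).
  move=> ih; have mh : measurable_fun D h by apply/measurable_EFinP; exact: measurable_int ih.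
  apply: (@le_integrable_EFin _ _ _ (fun w => `|h w|)) => //.
  - by apply: measurable_funM => //; exact: measurable_expRN.
  - by move=> w /(E1 n)/andP[h1 h2]; rewrite normrM (ger0_norm h1) ler_piMl.
  - exact: integrable_norm.
pose G n t := \int[mu]_(w in D) (expR (- (eps n * w)) * (A w * cos (t * w) + B w * sin (t * w))).
(* The damped integral is again of the form [osc], hence continuous and therefore measurable in
   [t]. *)
have GE n : G n = fun t => pi * osc (fun w => expR (- (eps n * w)) * A w) (fun w => expR (- (eps n * w)) * B w) t.
  apply/funext => t; rewrite /osc mulrA mulfV ?gt_eqF ?pi_gt0// mul1r.
  by apply: eq_Rintegral => w _; ring.
have mG n : measurable_fun E (G n).
  apply: (measurable_funS measurableT) => //; apply: continuous_measurable_fun.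
  rewrite GE => t; apply: cvgM; first exact: cvg_cst.
  by apply: continuous_osc; exact: ieA.
have limG t : E t -> G n t @[n --> \oo] --> pi * osc A B t.
  move=> _; rewrite /osc mulrA mulfV ?gt_eqF ?pi_gt0// mul1r.
  have [] := @Rdominated_convergence R D
    (fun n w => expR (- (eps n * w)) * (A w * cos (t * w) + B w * sin (t * w)))
    (fun w => A w * cos (t * w) + B w * sin (t * w)) g mD => //.
  - move=> n; apply: measurable_funM; first exact: measurable_expRN.
    by apply/measurable_EFinP; exact: measurable_int (integrable_osc iA iB t).
  - move=> w _; rewrite -[X in _ --> X]mul1r; apply: cvgM; last exact: cvg_cst.
    rewrite -expR0; apply: (@continuous_cvg _ _ _ _ _ _ expR); first exact: continuous_expR.
    rewrite -oppr0; apply: cvgN; rewrite -(mul0r w); apply: cvgM; last exact: cvg_cst.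
    exact: cvg_harmonic.
  - by move=> n w; exact: boundn.
have [] := @Rdominated_convergence R E G (fun t => pi * osc A B t)
   (fun=> \int[mu]_(w in D) g w) mE mG limG.
- set C := \int[mu]_(w in D) g w.
  have cc : continuous (fun _ : R => C) by move=> x; exact: cvg_cst.
  have icc : mu.-integrable `[p, q] (EFin \o (fun _ : R => C)).
    apply: continuous_compact_integrable; first exact: segment_compact.
    exact: continuous_subspaceT.
  by apply: integrableS icc => //; apply: subset_itvr; rewrite bnd_simp.
- move=> n t _; apply: le_normr_Rintegral_dom => //; last by move=> w; exact: boundn.
  apply: measurable_funM; first exact: measurable_expRN.
  by apply/measurable_EFinP; exact: measurable_int (integrable_osc iA iB t).
move=> io; rewrite RintegralZl//.
have -> : EFin \o osc A B = EFin \o (fun t => pi^-1 * (pi * osc A B t)).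
  by apply/funext => t /=; rewrite mulrA mulVf ?mul1r// gt_eqF ?pi_gt0.
exact: integrableZl_EFin.
Qed.

Lemma fourier_inversion : {ae mu, forall t, 0 < t -> f t = osc A B t}.
Proof.
have itv p q : 0 < p -> p < q ->
    \int[mu]_(t in `]p, q]) f t = \int[mu]_(t in `]p, q]) osc A B t.
  move=> p0 pq; apply: (@mulfI _ pi); first by rewrite gt_eqF ?pi_gt0.
  have l1 := limit_left pq; have l2 := limit_right p0 pq.
  have E := funext (fun n => smoothed_itv intf (eps0 n) pq).
  by move: l1; rewrite [X in X @ _ --> _]E => l1; exact: (cvg_unique _ l2 l1).
have cosc : continuous (osc A B) by exact: continuous_osc.
(* [osc A B] is continuous but not known to be integrable on the half-line, so the difference is cut
   at [N] and the countably many null sets are united. *)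
pose h (N : nat) := (fun t => f t - osc A B t) \_ [set` `[0, N%:R]].
have io (x y : R) : mu.-integrable `[x, y] (EFin \o osc A B).
  apply: continuous_compact_integrable; first exact: segment_compact.
  exact: continuous_subspaceT.
have aeN N : {ae mu, forall t, 0 < t -> h N t = 0}.
  have if0 : mu.-integrable `[0, N%:R] (EFin \o f).
    by apply: integrableS intf => //; apply: subset_itvl; rewrite bnd_simp.
  have id := integrableB_EFin (measurable_itv _) if0 (io 0 N%:R).
  apply: ae_eq0_itv.
    rewrite -restrict_EFin; apply/integrable_restrict => //.
    by apply: integrableS id => //; exact: measurableI.
  move=> p q p0 pq; rewrite /h -Rintegral_mkcondr.
  have [Np|pN] := leP N%:R p.
    have -> : [set` `]p, q]] `&` [set` `[0, N%:R]] = set0.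
      apply/seteqP; split => x //=; rewrite !in_itv/= => -[/andP[px _] /andP[_ xN]].
      by have := lt_le_trans px (le_trans xN Np); rewrite ltxx.
    exact: Rintegral_set0.
  pose m := Num.min q N%:R.
  have pm : p < m by rewrite lt_min pq.
  have -> : [set` `]p, q]] `&` [set` `[0, N%:R]] = [set` `]p, m]].
    apply/seteqP; split => x /=; rewrite !in_itv/=.
      by move=> [/andP[px xq] /andP[_ xN]]; rewrite px le_min xq.
    by rewrite le_min => /and3P[px xq xN]; rewrite px xq xN (le_trans (ltW p0))// ltW.
  rewrite RintegralB//.
  - by rewrite itv// subrr.
  - apply: integrableS intf => // x; rewrite /D/= !in_itv/= andbT => /andP[px _].
    by rewrite (le_trans (ltW p0))// ltW.
  - by apply: integrableS (io p m) => //; apply: subset_itvr; rewrite bnd_simp.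
have aeA : {ae mu, forall t, forall N, 0 < t -> h N t = 0} by exact: ae_foralln aeN.
apply: (ae_sub2 _ aeA aeA) => t /= Ht _ t0.
have := Ht (Num.truncn t).+1 t0.
rewrite /h patchE mem_setE in_itv/= (ltW t0) (ltW (Num.Theory.truncnS_gt t))/=.
by move/eqP; rewrite subr_eq0 => /eqP.
Qed.

End fourier_inversion.

(** * The case [nu < 1] *)

Section bromwich_integral.
Context {R : realType}.
Notation mu := (@lebesgue_measure R).
Let D : set R := [set` `[0, +oo[].
Let mD : measurable D. Proof. exact: measurable_itv. Qed.

Definition line_mod (sigma w : R) : R := Num.sqrt (sigma ^+ 2 + w ^+ 2).

(* Polar form of [R_symbol p nu a] on the line [Re s = sigma]. *)
Definition symbol_mod (p nu a sigma w : R) : R :=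
  line_mod sigma w `^ (- p) *
  expR (- (line_mod sigma w `^ nu * cos (nu * atan (w / sigma)) * a)).

Definition symbol_arg (p nu a sigma w : R) : R :=
  - p * atan (w / sigma) - line_mod sigma w `^ nu * sin (nu * atan (w / sigma)) * a.

Lemma line_mod_gt0 (sigma w : R) : 0 < sigma -> 0 < line_mod sigma w.
Proof. by move=> s0; rewrite sqrtr_gt0 ltr_pwDl ?sqr_ge0// exprn_gt0. Qed.

Lemma line_mod_ge (sigma w : R) : 0 < sigma -> sigma <= line_mod sigma w.
Proof.
move=> s0; rewrite -[leLHS]ger0_norm ?(ltW s0)// -sqrtr_sqr ler_sqrt.
  by rewrite lerDl sqr_ge0.
by rewrite addr_ge0 ?sqr_ge0.
Qed.

Lemma line_mod_ge_norm (sigma w : R) : `|w| <= line_mod sigma w.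
Proof.
rewrite -sqrtr_sqr ler_sqrt; first by rewrite lerDr sqr_ge0.
by rewrite addr_ge0 ?sqr_ge0.
Qed.

(** Both angles have cosine [sigma] over the modulus; the case distinction in [carg] matches the
    sign of the arctangent. *)
Lemma carg_line (sigma w : R) : 0 < sigma -> carg (sigma +i* w) = atan (w / sigma).
Proof.
move=> s0; have r0 := line_mod_gt0 w s0.
have E : sigma / line_mod sigma w = cos (atan (w / sigma)).
  rewrite cos_atan; have -> : 1 + (w / sigma) ^+ 2 = (sigma ^+ 2 + w ^+ 2) / sigma ^+ 2.
    by field; rewrite gt_eqF.
  rewrite sqrtrM ?addr_ge0 ?sqr_ge0// sqrtrV ?sqr_ge0// sqrtr_sqr (gtr0_norm s0).
  by rewrite -/(line_mod sigma w); field; rewrite !gt_eqF.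
have := atan_ltpi2 (w / sigma); have := atan_gtNpi2 (w / sigma) => h1 h2.
have pi0 := @pi_gt0 R.
rewrite /carg /cmod/= -/(line_mod sigma w) E; case: ifPn => w0.
  rewrite cosK// in_itv/=; apply/andP; split; last by lra.
  by rewrite -(@atan0 R) le_atan// divr_ge0// ltW.
rewrite cosKN ?opprK//; apply/andP; split; first by lra.
by rewrite -(@atan0 R) le_atan// ltW// ltr_pdivrMr// mul0r ltNge.
Qed.

Lemma cpow_line (sigma w p : R) : 0 < sigma ->
  cpow (sigma +i* w) p =
  (line_mod sigma w `^ p * cos (p * atan (w / sigma))) +i*
  (line_mod sigma w `^ p * sin (p * atan (w / sigma))).
Proof.
move=> s0; rewrite /cpow /cln carg_line// /cmod/= -/(line_mod sigma w) /cexp/=.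
by rewrite !mul0r subr0 addr0 /powR gt_eqF ?line_mod_gt0.
Qed.

Lemma R_symbol_line (p nu a sigma w : R) : 0 < sigma ->
  R_symbol p nu a (sigma +i* w) =
  (symbol_mod p nu a sigma w * cos (symbol_arg p nu a sigma w)) +i*
  (symbol_mod p nu a sigma w * sin (symbol_arg p nu a sigma w)).
Proof.
move=> s0; rewrite /R_symbol !cpow_line//.
set r := line_mod sigma w; set th := atan (w / sigma).
rewrite /cexp /symbol_mod /symbol_arg -/r -/th /=.
rewrite !oppr0 !mul0r !subr0 !addr0.
rewrite (_ : - a * (r `^ nu * cos (nu * th)) = - (r `^ nu * cos (nu * th) * a)); last by ring.
rewrite (_ : - a * (r `^ nu * sin (nu * th)) = - (r `^ nu * sin (nu * th) * a)); last by ring.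
by rewrite cosD sinD; congr (_ +i* _); ring.
Qed.

Variables nu sigma : R.
Hypotheses (nu0 : 0 < nu) (nu1 : nu < 1) (sigma1 : 1 <= sigma).

Let sigma0 : 0 < sigma. Proof. exact: lt_le_trans sigma1. Qed.

(** The infimum of [cos(nu arg s)] over the open right half-plane; it is positive because [nu < 1],
    and this is the source of all decay below. *)
Definition decay_cst : R := cos (nu * (pi / 2)).

Lemma decay_cst_gt0 : 0 < decay_cst.
Proof.
apply: cos_gt0_pihalf; have pi0 := @pi_gt0 R.
have h0 : 0 < nu * (pi / 2) by rewrite mulr_gt0// divr_gt0.
have h1 : nu * (pi / 2) < pi / 2 by rewrite gtr_pMl// divr_gt0.
by apply/andP; split; lra.
Qed.

Lemma decay_cst_le (w : R) : decay_cst <= cos (nu * atan (w / sigma)).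
Proof.
have pi0 := @pi_gt0 R.
rewrite -(cos_norm (nu * _)) normrM (gtr0_norm nu0).
have h : `|atan (w / sigma)| <= pi / 2 by rewrite ler_norml !ltW// ?atan_gtNpi2 ?atan_ltpi2.
have h0 : 0 <= nu * `|atan (w / sigma)| by rewrite mulr_ge0// ltW.
have h1 : nu * `|atan (w / sigma)| <= nu * (pi / 2) by rewrite ler_pM2l.
have h2 : nu * (pi / 2) <= pi / 2 by rewrite ger_pMl ?ltW// divr_gt0.
rewrite leNgt ltr_cos ?in_itv/= -?leNgt//; apply/andP; split; lra.
Qed.

(** This is why lines with [1 <= sigma] are used: the factor [s^(-p)] is bounded by 1, and the real
    part of [s^nu] is at least [decay_cst]. *)
Let mod1 w : 1 <= line_mod sigma w.
Proof. exact: le_trans (line_mod_ge w sigma0). Qed.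

Let modnu1 w : 1 <= line_mod sigma w `^ nu.
Proof. by rewrite -(powRr0 (line_mod sigma w)) ler_powR// ltW. Qed.

Lemma symbol_mod_ge0 p a w : 0 <= symbol_mod p nu a sigma w.
Proof. by rewrite mulr_ge0 ?powR_ge0 ?expR_ge0. Qed.

(** The product bound needed for Fubini. In the exponent [b] is written [(b - a) + a]: the first
    part uses [|s|^nu >= 1] and decays in [b], the second uses [|s|^nu >= w^nu] and decays in
    [w]. *)
Lemma symbol_mod_le (p a b w : R) : 0 <= p -> 0 <= a -> a <= b -> 0 <= w ->
  symbol_mod p nu b sigma w <=
  expR (- (decay_cst * (b - a))) * expR (- (decay_cst * a * w `^ nu)).
Proof.
move=> p0 a0 ab w0; have c0 := decay_cst_gt0.
rewrite -[leRHS]mul1r /symbol_mod ler_pM ?powR_ge0 ?expR_ge0//.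
  by rewrite -(powRr0 (line_mod sigma w)) ler_powR// oppr_le0.
rewrite -expRD ler_expR -opprD lerN2.
have wr : w `^ nu <= line_mod sigma w `^ nu.
  apply: ge0_ler_powR; rewrite ?nnegrE//; first exact: ltW.
    exact: ltW (line_mod_gt0 w sigma0).
  by rewrite (le_trans _ (line_mod_ge_norm sigma w))// ler_norm.
have e1 : decay_cst * (b - a) <= line_mod sigma w `^ nu * cos (nu * atan (w / sigma)) * (b - a).
  rewrite ler_wpM2r ?subr_ge0//; rewrite -[leLHS]mul1r ler_pM ?(ltW c0)//.
  exact: decay_cst_le.
have e2 : decay_cst * a * w `^ nu <= line_mod sigma w `^ nu * cos (nu * atan (w / sigma)) * a.
  rewrite mulrAC ler_wpM2r// mulrC ler_pM ?powR_ge0 ?(ltW c0)//.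
  exact: decay_cst_le.
have -> : line_mod sigma w `^ nu * cos (nu * atan (w / sigma)) * b =
  line_mod sigma w `^ nu * cos (nu * atan (w / sigma)) * (b - a) +
  line_mod sigma w `^ nu * cos (nu * atan (w / sigma)) * a by ring.
exact: lerD.
Qed.

(** Comparison with [1 / (1 + w^2)]. With [m = 2 / nu] one has [w^2 = (w^nu)^m], and [x <= exp x] at
    [x = k w^nu / m] gives [C = (m / k)^m]. *)
Lemma integrable_expR_powR (k : R) : 0 < k ->
  mu.-integrable D (EFin \o (fun w => expR (- (k * w `^ nu)))).
Proof.
move=> k0.
pose m := 2 / nu; have m0 : 0 < m by rewrite divr_gt0.
pose C := (m / k) `^ m; have C0 : 0 <= C by exact: powR_ge0.
have ig : mu.-integrable D (EFin \o (fun x : R => (1 + x ^+ 2)^-1)).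
  apply/integrableP; split.
    apply/measurable_EFinP/(measurable_funS measurableT) => //.
    by apply: continuous_measurable_fun; exact: (@continuous_oneDsqrV R).
  under eq_integral do rewrite gee0_abs ?lee_fin ?invr_ge0 ?(le_trans ler01 (oneDsqr_ge1 _))//.
  by rewrite integral0y_oneDsqr ltry.
apply: (@le_integrable_EFin _ _ _ (fun w => (1 + C) * (1 + w ^+ 2)^-1)) => //; last first.
- exact: integrableZl_EFin.
- move=> w; rewrite /D/= in_itv/= andbT => w0.
  rewrite ger0_norm ?expR_ge0// ler_pdivlMr ?(lt_le_trans ltr01 (oneDsqr_ge1 _))//.
  have E1 : expR (- (k * w `^ nu)) <= 1 by rewrite expR_le1 oppr_le0 mulr_ge0 ?powR_ge0// ltW.
  have E2 : expR (- (k * w `^ nu)) * w ^+ 2 <= C.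
    rewrite mulrC expRN ler_pdivrMr ?expR_gt0//.
    have -> : w ^+ 2 = (w `^ nu) `^ m by rewrite -powRrM /m mulrC divfK ?gt_eqF// powR_mulrn.
    have -> : expR (k * w `^ nu) = (expR (k * w `^ nu / m)) `^ m by rewrite -expRM divfK// gt_eqF.
    rewrite /C -powRM ?expR_ge0//; last by rewrite divr_ge0// ltW.
    apply: ge0_ler_powR; rewrite ?nnegrE ?powR_ge0//; first exact: ltW.
      by rewrite mulr_ge0 ?expR_ge0// divr_ge0// ltW.
    rewrite -ler_pdivrMl ?divr_gt0//.
    have -> : (m / k)^-1 * w `^ nu = k * w `^ nu / m by field; rewrite !gt_eqF.
    have := expR_ge1Dx (k * w `^ nu / m); lra.
  by rewrite mulrDr mulr1 lerD.
- apply: (measurable_funS measurableT) => //.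
  apply: (measurableT_comp (f := fun x : R => expR (- (k * x)))).
    exact: measurable_expRN.
  exact: measurable_powR.
Qed.

Lemma measurable_line_mod : measurable_fun [set: R] (line_mod sigma).
Proof.
apply: continuous_measurable_fun => w.
have cl : {for w, continuous (fun w : R => sigma ^+ 2 + w ^+ 2)}.
  by apply: cvgD; [exact: cvg_cst|exact: exprn_continuous].
exact: (continuous_comp cl (@sqrt_continuous R _)).
Qed.

Lemma measurable_line_atan : measurable_fun [set: R] (fun w => atan (w / sigma)).
Proof.
apply: continuous_measurable_fun => w.
have cl : {for w, continuous (fun w : R => w / sigma)}.
  by apply: cvgM; [exact: cvg_id|exact: cvg_cst].
exact: (continuous_comp cl (@continuous_atan R _)).
Qed.

Let mexp : measurable_fun [set: R] (@expR R).
Proof. by apply: continuous_measurable_fun; exact: continuous_expR. Qed.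
Let mcos : measurable_fun [set: R] (@cos R).
Proof. by apply: continuous_measurable_fun; exact: continuous_cos. Qed.
Let msin : measurable_fun [set: R] (@sin R).
Proof. by apply: continuous_measurable_fun; exact: continuous_sin. Qed.

Let msnd (h : R -> R) : measurable_fun [set: R] h ->
  measurable_fun [set: R * R] (fun z : R * R => h z.2).
Proof. by move=> mh; exact: measurableT_comp. Qed.

Let mr q : measurable_fun [set: R * R] (fun z : R * R => line_mod sigma z.2 `^ q).
Proof.
apply: (msnd (h := fun w => line_mod sigma w `^ q)).
exact: (measurableT_comp (@measurable_powR R q) measurable_line_mod).
Qed.

Let ma q : measurable_fun [set: R * R] (fun z : R * R => q * atan (z.2 / sigma)).
Proof.
apply: (msnd (h := fun w => q * atan (w / sigma))).
by apply: measurable_funM => //; exact: measurable_line_atan.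
Qed.

Lemma measurable_symbol_mod (p : R) :
  measurable_fun [set: R * R] (fun z : R * R => symbol_mod p nu z.1 sigma z.2).
Proof.
have mc := measurableT_comp mcos (ma nu).
apply: measurable_funM => //.
apply: (measurableT_comp mexp); apply: measurableT_comp => //.
by apply: measurable_funM => //; apply: measurable_funM => //.
Qed.

Lemma measurable_symbol_arg (p : R) :
  measurable_fun [set: R * R] (fun z : R * R => symbol_arg p nu z.1 sigma z.2).
Proof.
have ms := measurableT_comp msin (ma nu).
apply: measurable_funB => //.
by apply: measurable_funM => //; apply: measurable_funM => //.
Qed.

(** The real part of the integral of [exp(i d - z b)] for [z = rho exp(i phi)]: dividing by [z]
    produces the factor [1 / rho] and the phase [-phi]. *)
Lemma integrable_expR_tail (rho phi d a : R) : 0 < rho -> 0 < cos phi ->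
  mu.-integrable `[a, +oo[ (EFin \o (fun b =>
    expR (- (rho * cos phi * b)) * cos (d - rho * sin phi * b))) /\
  \int[mu]_(b in `[a, +oo[) (expR (- (rho * cos phi * b)) * cos (d - rho * sin phi * b)) =
  rho^-1 * expR (- (rho * cos phi * a)) * cos (d - rho * sin phi * a - phi).
Proof.
move=> r0 c0; set x := rho * cos phi; set y := rho * sin phi.
have x0 : 0 < x by rewrite mulr_gt0.
pose f b := expR (- (x * b)) * cos (d - y * b).
pose F b := - (rho^-1 * expR (- (x * b)) * cos (d - y * b - phi)).
have dl c b : is_derive b (1 : R) (fun b => cos (c - y * b)) (y * sin (c - y * b)).
  have -> : (fun b => cos (c - y * b)) = cos \o (fun b => c - y * b) by [].
  by apply: is_derive_eq; rewrite /GRing.scale/= ?mulr1 ?mulr0; ring.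
have dF b : is_derive b (1 : R) F (f b).
  have d1 := is_derive_expRN x b; have d2 := dl (d - phi) b.
  have -> : F = (fun b => - rho^-1 * (expR (- (x * b)) * cos (d - phi - y * b))).
    by apply/funext => u; rewrite /F addrAC; ring.
  apply: is_derive_eq; rewrite /GRing.scale/= ?mul0r ?addr0.
  have -> : f b = expR (- (x * b)) * cos ((d - phi - y * b) + phi) by rewrite /f; congr (_ * cos _); ring.
  rewrite [in RHS]cosD; set E := expR _; set C := cos (d - phi - _); set S := sin _.
  rewrite /x /y; field; exact: lt0r_neq0.
have cf : continuous f.
  move=> b; apply/differentiable_continuous/derivable1_diffP.
  have d1 := is_derive_expRN x b; have d2 := dl d b.
  by apply: derivableM; exact: ex_derive.
have i_f : mu.-integrable `[a, +oo[ (EFin \o f).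
  apply: (@le_integrable_EFin _ _ _ (fun w => expR (- (x * w)))) => //.
  - by apply: (measurable_funS measurableT) => //; exact: continuous_measurable_fun.
  - by move=> w _; rewrite normrM (ger0_norm (expR_ge0 _)) ler_piMr ?expR_ge0// cos_max.
  - exact: integrable_expRN.
split=> //; rewrite (@Rintegral_FTC2y _ f F a 0)//; first by rewrite /F sub0r opprK.
have E0 : expR (- (x * w)) * rho^-1 @[w --> +oo] --> 0.
  by rewrite -[X in _ --> X](mul0r rho^-1); apply: cvgM; [exact: cvg_expRN|exact: cvg_cst].
apply/cvgr0Pnorm_lt => e e0; near=> w.
apply: (@le_lt_trans _ _ (expR (- (x * w)) * rho^-1)); last first.
  by near: w; exact: (cvgr_lt _ E0).
rewrite normrN normrM ger0_norm ?mulr_ge0 ?expR_ge0 ?invr_ge0 ?(ltW r0)//.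
by rewrite mulrC [leRHS]mulrC ler_piMl ?mulr_ge0 ?expR_ge0 ?invr_ge0 ?(ltW r0)// cos_max.
Unshelve. all: by end_near. Qed.

(** The previous formula with [z = s^nu], so [rho = |s|^nu] and [phi = nu arg s]; the phases of
    [s^(-p)] and [exp(i t w)] go into [d]. *)
Lemma Rintegral_symbol_wave (p a t w : R) :
  \int[mu]_(b in `[a, +oo[)
    (symbol_mod p nu b sigma w * cos (symbol_arg p nu b sigma w + t * w)) =
  symbol_mod (p + nu) nu a sigma w * cos (symbol_arg (p + nu) nu a sigma w + t * w).
Proof.
have r0 := line_mod_gt0 w sigma0.
pose th := atan (w / sigma); pose r := line_mod sigma w.
have c0 : 0 < cos (nu * th) by exact: lt_le_trans decay_cst_gt0 (decay_cst_le w).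
have rn0 : 0 < r `^ nu by exact: powR_gt0.
have [i1 I1] := integrable_expR_tail (- p * th + t * w) a rn0 c0.
rewrite (@eq_Rintegral _ _ _ mu _ (fun b => r `^ (- p) *
  (expR (- (r `^ nu * cos (nu * th) * b)) * cos (- p * th + t * w - r `^ nu * sin (nu * th) * b)))).
  rewrite RintegralZl// I1 /symbol_mod /symbol_arg -/r -/th opprD powRD; last first.
    by apply/implyP => _; rewrite gt_eqF.
  rewrite -powRN; set u := r `^ - p; set v := r `^ - nu.
  have -> : - p * th + t * w - r `^ nu * sin (nu * th) * a - nu * th =
    (- p - nu) * th - r `^ nu * sin (nu * th) * a + t * w by ring.
  ring.
move=> b _; rewrite /symbol_mod /symbol_arg -/r -/th -mulrA; congr (_ * (_ * cos _)).
ring.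
Qed.

Section bromwich.
Variable p : R.
Hypothesis p0 : 0 <= p.

Let A b w := symbol_mod p nu b sigma w * cos (symbol_arg p nu b sigma w).
Let B b w := - (symbol_mod p nu b sigma w * sin (symbol_arg p nu b sigma w)).

Let mmod b : measurable_fun [set: R] (fun w => symbol_mod p nu b sigma w).
Proof. exact: (measurableT_comp (measurable_symbol_mod p) (pair1_measurable b)). Qed.
Let marg b : measurable_fun [set: R] (fun w => symbol_arg p nu b sigma w).
Proof. exact: (measurableT_comp (measurable_symbol_arg p) (pair1_measurable b)). Qed.

Let integrable_mod b (h : R -> R) : 0 < b -> measurable_fun [set: R] h ->
  (forall x, `|h x| <= 1) ->
  mu.-integrable D (EFin \o (fun w => symbol_mod p nu b sigma w * h (symbol_arg p nu b sigma w))).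
Proof.
move=> b0 mh h1.
apply: (@le_integrable_EFin _ _ _ (fun w => expR (- (decay_cst * b * w `^ nu)))) => //.
- apply: (measurable_funS measurableT) => //; apply: measurable_funM => //.
  exact: (measurableT_comp mh).
- move=> w; rewrite /D/= in_itv/= andbT => w0; rewrite normrM ger0_norm ?symbol_mod_ge0//.
  have := symbol_mod_le p0 (ltW b0) (lexx b) w0; rewrite subrr mulr0 oppr0 expR0 mul1r.
  by apply: le_trans; rewrite ler_piMr// symbol_mod_ge0.
- by apply: integrable_expR_powR; rewrite mulr_gt0// decay_cst_gt0.
Qed.

Lemma integrable_symbol_cos (b : R) : 0 < b -> mu.-integrable D (EFin \o A b).
Proof. by move=> b0; apply: integrable_mod => // x; rewrite cos_max. Qed.

Lemma integrable_symbol_sin (b : R) : 0 < b -> mu.-integrable D (EFin \o B b).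
Proof.
move=> b0; have -> : EFin \o B b = EFin \o (fun w => -1 * (symbol_mod p nu b sigma w * sin (symbol_arg p nu b sigma w))).
  by apply/funext => w /=; rewrite mulN1r.
by apply: integrableZl_EFin => //; apply: integrable_mod => // x; rewrite sin_max.
Qed.

End bromwich.

(** The usual integral of [exp(s t) F(s)] along the line, divided by [2 pi i]. Since [F] takes
    conjugate values at conjugate points, it is [1 / pi] times the integral over [w >= 0] of the
    real part; the sine of the argument enters [cos(arg + t w)] with a minus sign. *)
Definition bromwich (p b t : R) : R := expR (sigma * t) *
  osc (fun w => symbol_mod p nu b sigma w * cos (symbol_arg p nu b sigma w))
      (fun w => - (symbol_mod p nu b sigma w * sin (symbol_arg p nu b sigma w))) t.

Lemma continuous_bromwich (p b : R) : 0 <= p -> 0 < b -> continuous (bromwich p b).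
Proof.
move=> p0 b0 t; apply: cvgM; last first.
  exact: (continuous_osc (integrable_symbol_cos p0 b0) (integrable_symbol_sin p0 b0)).
have cl : {for t, continuous (fun t : R => sigma * t)} by apply: cvgM; [exact: cvg_cst|exact: cvg_id].
exact: (continuous_comp cl (@continuous_expR R _)).
Qed.

Let bromwichE p b t : bromwich p b t = expR (sigma * t) * pi^-1 *
  \int[mu]_(w in D) (symbol_mod p nu b sigma w * cos (symbol_arg p nu b sigma w + t * w)).
Proof.
rewrite /bromwich /osc mulrA; congr (_ * _); apply: eq_Rintegral => w _.
by rewrite cosD; ring.
Qed.

Lemma integral_bromwich (p a t : R) : 0 <= p -> 0 < a ->
  mu.-integrable `[a, +oo[ (EFin \o (fun b => bromwich p b t)) /\
  \int[mu]_(b in `[a, +oo[) bromwich p b t = bromwich (p + nu) a t.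
Proof.
move=> p0 a0; have c0 := decay_cst_gt0.
pose K b w := symbol_mod p nu b sigma w * cos (symbol_arg p nu b sigma w + t * w).
have mK : measurable_fun [set: R * R] (fun z : R * R => K z.1 z.2).
  apply: measurable_funM; first exact: measurable_symbol_mod.
  apply: (measurableT_comp mcos); apply: measurable_funD; first exact: measurable_symbol_arg.
  exact: measurable_funM.
have [||||||iK EK] := @Fubini_dominated R [set` `[a, +oo[] D K
  (fun b => expR (- (decay_cst * (b - a)))) (fun w => expR (- (decay_cst * a * w `^ nu))).
- exact: measurable_itv.
- exact: mD.
- by apply: (measurable_funS measurableT) => //; apply: measurableX.
- have -> : (fun b => expR (- (decay_cst * (b - a)))) = (fun b => expR (decay_cst * a) * expR (- (decay_cst * b))).
    by apply/funext => b; rewrite -expRD; congr expR; ring.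
  by apply: integrableZl_EFin; [exact: measurable_itv|exact: integrable_expRN].
- by apply: integrable_expR_powR; rewrite mulr_gt0.
- move=> b w; rewrite /D/= !in_itv/= !andbT => ab w0; rewrite normrM ger0_norm ?symbol_mod_ge0//.
  apply: le_trans (symbol_mod_le p0 (ltW a0) ab w0).
  by rewrite ler_piMr ?symbol_mod_ge0// cos_max.
have E : (fun b => bromwich p b t) = (fun b => expR (sigma * t) * pi^-1 * \int[mu]_(w in D) K b w).
  by apply/funext => b; rewrite bromwichE.
rewrite E; split; first by apply: integrableZl_EFin => //; exact: measurable_itv.
rewrite RintegralZl ?measurable_itv// EK bromwichE; congr (_ * _).
by apply: eq_Rintegral => w _; exact: Rintegral_symbol_wave.
Qed.

End bromwich_integral.

(** * Identification of the inverse transforms for [nu < 1] *)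

Section fractional_order.
Context {R : realType}.
Notation mu := (@lebesgue_measure R).
Let D : set R := [set` `[0, +oo[].
Let mD : measurable D. Proof. exact: measurable_itv. Qed.

(** On a vertical line the Laplace transform is the Fourier transform of the damped function; [y] is
    complex, so four real transforms occur. *)
Lemma laplace_lineE (y : R -> R[i]) (sigma w : R) (f := fun u => expR (- (sigma * u)) * complex.Re (y u))
    (g := fun u => expR (- (sigma * u)) * complex.Im (y u)) :
  mu.-integrable D (EFin \o f) -> mu.-integrable D (EFin \o g) ->
  laplace y (sigma +i* w) =
    (cos_transform f w + sin_transform g w) +i* (cos_transform g w - sin_transform f w).
Proof.
move=> iF iG.
have E u : cexp (- (sigma +i* w) * u%:C) =
    (expR (- (sigma * u)) * cos (u * w)) +i* (- (expR (- (sigma * u)) * sin (u * w))).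
  rewrite /cexp/= !mulr0 subr0 add0r.
  rewrite (_ : - sigma * u = - (sigma * u)); last by ring.
  by rewrite (_ : - w * u = - (u * w)) ?cosN ?sinN ?mulrN//; ring.
rewrite /laplace /cintegral /cos_transform /sin_transform; congr (_ +i* _).
  rewrite -RintegralD//; [|exact: integrable_mul_cosM|exact: integrable_mul_sinM].
  apply: eq_Rintegral => u _; rewrite E /f /g; case: (y u) => p q /=.
  by ring.
rewrite -RintegralB//; [|exact: integrable_mul_cosM|exact: integrable_mul_sinM].
apply: eq_Rintegral => u _; rewrite E /f /g; case: (y u) => p q /=.
by ring.
Qed.

Lemma line_modN (sigma w : R) : line_mod sigma (- w) = line_mod sigma w.
Proof. by rewrite /line_mod sqrrN. Qed.

Lemma symbol_modN (p nu b sigma w : R) :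
  symbol_mod p nu b sigma (- w) = symbol_mod p nu b sigma w.
Proof. by rewrite /symbol_mod line_modN mulNr atanN mulrN cosN. Qed.

Lemma symbol_argN (p nu b sigma w : R) :
  symbol_arg p nu b sigma (- w) = - symbol_arg p nu b sigma w.
Proof. by rewrite /symbol_arg line_modN (mulNr w) atanN !mulrN sinN; ring. Qed.

(* Homogeneity: [lam^p F_(p,a)(lam s) = F_(p,lam^nu a)(s)]. *)
Lemma symbol_mod_scale (p nu a lam sigma w : R) : 0 < lam -> 0 < sigma ->
  lam `^ p * symbol_mod p nu a (lam * sigma) (lam * w) =
  symbol_mod p nu (lam `^ nu * a) sigma w /\
  symbol_arg p nu a (lam * sigma) (lam * w) = symbol_arg p nu (lam `^ nu * a) sigma w.
Proof.
move=> l0 s0.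
have E : line_mod (lam * sigma) (lam * w) = lam * line_mod sigma w.
  rewrite /line_mod !exprMn -mulrDr sqrtrM ?sqr_ge0// sqrtr_sqr gtr0_norm//.
have F : lam * w / (lam * sigma) = w / sigma by field; rewrite !gt_eqF.
have r0 := ltW (line_mod_gt0 w s0).
rewrite /symbol_mod /symbol_arg E F !powRM ?(ltW l0)//; split; last by ring.
rewrite -!mulrA mulrA -powRD; last by apply/implyP => _; rewrite gt_eqF.
rewrite subrr powRr0 mul1r; congr (_ * expR _); ring.
Qed.

Lemma laplace_scale (y : R -> R[i]) (c lam : R) (s : R[i]) : 0 < lam ->
  laplace_cvg y (lam%:C * s) ->
  laplace_cvg (fun t => c%:C * y (lam^-1 * t)) s /\
  laplace (fun t => c%:C * y (lam^-1 * t)) s = (c * lam)%:C * laplace y (lam%:C * s).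
Proof.
move=> l0; have k0 : 0 < lam^-1 by rewrite invr_gt0.
pose f1 u := complex.Re (cexp (- (lam%:C * s) * u%:C) * y u).
pose f2 u := complex.Im (cexp (- (lam%:C * s) * u%:C) * y u).
move=> [i1 i2].
have DE : (fun x => lam^-1 * x + 0) @^-1` D = D.
  by apply/seteqP; split => x /=; rewrite /D/= !in_itv/= !andbT addr0 pmulr_rge0.
have E t : cexp (- s * t%:C) * (c%:C * y (lam^-1 * t)) =
    c%:C * (cexp (- (lam%:C * s) * (lam^-1 * t + 0)%:C) * y (lam^-1 * t + 0)).
  rewrite addr0 mulrCA; congr (_ * (cexp _ * _)).
  by rewrite rmorphM/= fmorphV mulNr [in RHS]mulNr; congr (- _); field;
    rewrite eq_complex/= gt_eqF.
have ER t : complex.Re (cexp (- s * t%:C) * (c%:C * y (lam^-1 * t))) = c * f1 (lam^-1 * t + 0).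
  rewrite E /f1; case: (_ * y _) => p q /=; ring.
have EI t : complex.Im (cexp (- s * t%:C) * (c%:C * y (lam^-1 * t))) = c * f2 (lam^-1 * t + 0).
  rewrite E /f2; case: (_ * y _) => p q /=; ring.
have j1 := integrable_affine 0 k0 mD i1; have j2 := integrable_affine 0 k0 mD i2.
have h1 := Rintegral_affine 0 k0 mD i1; have h2 := Rintegral_affine 0 k0 mD i2.
rewrite DE in j1 j2 h1 h2.
rewrite /laplace_cvg /cintegrable /laplace /cintegral.
have -> : (fun t => (complex.Re (cexp (- s * t%:C) * (c%:C * y (lam^-1 * t))))%:E) =
    (EFin \o (fun t => c * f1 (lam^-1 * t + 0))).
  by apply/funext => t; rewrite ER.
have -> : (fun t => (complex.Im (cexp (- s * t%:C) * (c%:C * y (lam^-1 * t))))%:E) =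
    (EFin \o (fun t => c * f2 (lam^-1 * t + 0))).
  by apply/funext => t; rewrite EI.
split; first by split; exact: integrableZl_EFin.
have -> : (fun t => complex.Re (cexp (- s * t%:C) * (c%:C * y (lam^-1 * t)))) =
    (fun t => c * f1 (lam^-1 * t + 0)) by exact: funext.
have -> : (fun t => complex.Im (cexp (- s * t%:C) * (c%:C * y (lam^-1 * t)))) =
    (fun t => c * f2 (lam^-1 * t + 0)) by exact: funext.
rewrite !RintegralZl// h1 h2 /=.
apply/eqP; rewrite eq_complex/= !mul0r subr0 addr0; apply/andP; split; apply/eqP; field; exact: lt0r_neq0.
Qed.

Variable nu : R.
Hypotheses (nu0 : 0 < nu) (nu1 : nu < 1).

(* The real and imaginary parts of [y] are separated by the parity in [w]. *)
Lemma laplace_line_inversion (y : R -> R[i]) (p b sigma : R) : 0 <= p -> 0 < b -> 1 <= sigma ->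
  (forall w, laplace_cvg y (sigma +i* w) /\ laplace y (sigma +i* w) = R_symbol p nu b (sigma +i* w)) ->
  {ae mu, forall t, 0 < t -> complex.Re (y t) = bromwich nu sigma p b t} /\
  {ae mu, forall t, 0 < t -> complex.Im (y t) = 0}.
Proof.
move=> p0 b0 s1 H; have s0 : 0 < sigma by exact: lt_le_trans s1.
have [iF iG _ _] := laplace_realE (H 0).1.
set f := fun u => _ * complex.Re (y u) in iF; set g := fun u => _ * complex.Im (y u) in iG.
have key w : cos_transform f w + sin_transform g w = symbol_mod p nu b sigma w * cos (symbol_arg p nu b sigma w) /\
   cos_transform g w - sin_transform f w = symbol_mod p nu b sigma w * sin (symbol_arg p nu b sigma w).
  by have := (H w).2; rewrite (laplace_lineE w iF iG) R_symbol_line// => -[].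
have cN (h : R -> R) w : cos_transform h (- w) = cos_transform h w.
  by apply: eq_Rintegral => u _; rewrite mulrN cosN.
have sN (h : R -> R) w : mu.-integrable D (EFin \o h) -> sin_transform h (- w) = - sin_transform h w.
  move=> ih; rewrite -[RHS]mulN1r /sin_transform -RintegralZl//; last exact: integrable_mul_sinM.
  by apply: eq_Rintegral => u _; rewrite mulrN sinN mulN1r mulNr.
have {}key w : [/\ cos_transform f w = symbol_mod p nu b sigma w * cos (symbol_arg p nu b sigma w),
   sin_transform f w = - (symbol_mod p nu b sigma w * sin (symbol_arg p nu b sigma w)),
   cos_transform g w = 0 & sin_transform g w = 0].
  have [h1 h2] := key w; have := key (- w).
  rewrite !cN !sN// symbol_modN symbol_argN cosN sinN => -[h3 h4].
  by split; lra.
have /all_and4[/funext Cf /funext Sf /funext Cg /funext Sg] := key.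
have E u : expR (sigma * u) * expR (- (sigma * u)) = 1 by rewrite -expRD subrr expR0.
split.
  have := fourier_inversion iF; rewrite Cf Sf.
  move=> /(_ (integrable_symbol_cos nu0 nu1 s1 p0 b0) (integrable_symbol_sin nu0 nu1 s1 p0 b0)) h.
  apply: (ae_sub2 _ h h) => t ht _ t0.
  by rewrite /bromwich -(ht t0) mulrA E mul1r.
have := fourier_inversion iG; rewrite Cg Sg => /(_ (integrable0 mu D) (integrable0 mu D)) h.
apply: (ae_sub2 _ h h) => t ht _ t0.
rewrite -[LHS]mul1r -(E t) -mulrA -/(g t) (ht t0) /osc.
under eq_Rintegral do rewrite !mul0r addr0.
by rewrite Rintegral_cst// mul0r !mulr0.
Qed.
(* [sigma] only has to exceed the abscissa of [ya]: rescaling [ya] gives a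
   function with the same transform as [yb] on [Re s >= sigma]. *)
Lemma inverse_laplace_bromwich (ya yb : R -> R[i]) (p a b sigma sa t : R) :
  0 <= p -> 0 < a -> a <= b -> 1 <= sigma -> sa < sigma ->
  (forall s : R[i], sa < complex.Re s ->
     laplace_cvg ya s /\ laplace ya s = R_symbol p nu a s) ->
  inverse_laplace (R_symbol p nu b) yb -> 0 < t ->
  yb t = (bromwich nu sigma p b t)%:C.
Proof.
move=> p0 a0 ab s1 sas Ha [[sb Hb] reg] t0.
have b0 : 0 < b by exact: lt_le_trans ab.
(* Chosen so that [lam^nu a = b]; it is at least 1 because [a <= b]. *)
pose lam := (b / a) `^ nu^-1.
have ba1 : 1 <= b / a by rewrite ler_pdivlMr// mul1r.
have l1 : 1 <= lam by rewrite -(powRr0 (b / a)) ler_powR// invr_ge0 ltW.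
have l0 : 0 < lam by exact: lt_le_trans l1.
have lnu : lam `^ nu * a = b.
  by rewrite -powRrM mulVf ?gt_eqF// powRr1 ?divfK ?gt_eqF// divr_ge0// ltW.
(* The substitution in the transform contributes a factor [lam], which completes the prefactor to
   the [lam^p] of homogeneity. *)
pose z t := (lam `^ (p - 1))%:C * ya (lam^-1 * t).
have Hz sigma' w : sigma <= sigma' -> laplace_cvg z (sigma' +i* w) /\
    laplace z (sigma' +i* w) = R_symbol p nu b (sigma' +i* w).
  move=> ss'; have s'0 : 0 < sigma' by apply: lt_le_trans ss'; exact: lt_le_trans s1.
  have E : lam%:C * (sigma' +i* w) = (lam * sigma') +i* (lam * w).
    by apply/eqP; rewrite eq_complex/= !mul0r subr0 addr0 !eqxx.
  (* As [lam >= 1], multiplication by [lam] moves points further to the right, so the half-plane of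
     [ya] suffices. *)
  have [] := Ha (lam%:C * (sigma' +i* w)).
    rewrite E/= (lt_le_trans sas)// (le_trans ss')// -[leLHS]mul1r ler_wpM2r//.
    exact: ltW.
  move=> cv lE; have [h1 h2] := laplace_scale (lam `^ (p - 1)) l0 cv.
  split=> //; rewrite h2 lE E R_symbol_line ?mulr_gt0// R_symbol_line//.
  have -> : lam `^ (p - 1) * lam = lam `^ p.
    by rewrite -[X in _ * X]powRr1 ?(ltW l0)// -powRD ?subrK//; apply/implyP => _; rewrite gt_eqF.
  have [m1 ->] := symbol_mod_scale p nu a w l0 s'0; rewrite lnu in m1 *.
  by rewrite -m1; apply/eqP; rewrite eq_complex/= !mul0r subr0 addr0 !mulrA !eqxx.
(* On the line [sigma1] both [yb] and [z] have the known transform, so they agree almost everywhere;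
   [z] is then evaluated on the line [sigma], which may lie outside the half-plane of [yb]. *)
pose sigma1 := Num.max sigma (sb + 1).
have ss1 : sigma <= sigma1 by rewrite le_max lexx.
have bs1 : sb < sigma1 by rewrite lt_max ltrDl ltr01 orbT.
have [y1 y2] := laplace_line_inversion p0 b0 (le_trans s1 ss1) (fun w => Hb (sigma1 +i* w) bs1).
have [z1 z2] := laplace_line_inversion p0 b0 (le_trans s1 ss1) (fun w => Hz sigma1 w ss1).
have [z3 _] := laplace_line_inversion p0 b0 s1 (fun w => Hz sigma w (lexx _)).
apply: regular_representative_eq => //; last exact: continuous_bromwich.
apply: (ae_sub2 _ y1 (ae_sub2 (fun x h h' => conj h h') z1 z3)) => x h1 [h2 h3] x0.
by rewrite h1// -h2// h3.
Qed.

Lemma R_integral_nu_lt1 (p a : R) (Rf : R -> R -> R -> R[i]) : 0 <= p -> 0 < a ->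
  (forall m b : R, 0 <= m -> 0 < b -> inverse_laplace (R_symbol m nu b) (Rf m b)) ->
  forall t, 0 < t ->
  cintegrable `[a, +oo[ (fun b => Rf p b t) /\
  Rf (p + nu) a t = cintegral `[a, +oo[ (fun b => Rf p b t).
Proof.
move=> p0 a0 H t t0.
have q0 : 0 <= p + nu by rewrite addr_ge0// ltW.
have [[s1 H1] _] := H p a p0 a0.
have [[s2 H2] _] := H (p + nu) a q0 a0.
(* One line for both orders, chosen from the abscissae at [a] alone and hence the same for all
   [b >= a]. *)
pose sigma := Num.max 1 (Num.max (s1 + 1) (s2 + 1)).
have sg1 : 1 <= sigma by rewrite le_max lexx.
have ssg1 : s1 < sigma by rewrite !lt_max ltrDl ltr01 orbT.
have ssg2 : s2 < sigma by rewrite !lt_max [s2 < s2 + 1]ltrDl ltr01 !orbT.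
have E b : b \in [set` `[a, +oo[] -> Rf p b t = (bromwich nu sigma p b t)%:C.
  rewrite inE/= in_itv/= andbT => ab.
  apply: (inverse_laplace_bromwich p0 a0 ab sg1 ssg1 H1 _ t0).
  by apply: H => //; exact: lt_le_trans ab.
have Eq : Rf (p + nu) a t = (bromwich nu sigma (p + nu) a t)%:C.
  by apply: (inverse_laplace_bromwich q0 a0 (lexx a) sg1 ssg2 H2 _ t0); exact: H.
have [iV IV] := integral_bromwich nu0 nu1 sg1 t p0 a0.
have mE : measurable [set` `[a, +oo[] by exact: measurable_itv.
split.
  split.
    by apply: eq_integrable iV => // b Eb /=; rewrite E.
  by apply: eq_integrable (integrable0 mu `[a, +oo[) => // b Eb /=; rewrite E.
rewrite Eq -IV; apply/eqP; rewrite eq_complex/=; apply/andP; split; apply/eqP.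
  by apply: eq_Rintegral => b Eb; rewrite E.
rewrite (@eq_Rintegral _ _ _ mu _ (cst 0)) ?Rintegral_cst ?mul0r// => b Eb.
by rewrite E.
Qed.

End fractional_order.

Theorem proposition2p6 (R : realType) (mu nu a : R)
    (hmu : 0 <= mu) (hnu0 : 0 < nu) (hnu1 : nu <= 1) (ha : 0 < a) :
  (* R_(mu,nu) is a function: pointwise identity *)
  (R_is_function mu nu ->
   forall Rf : R -> R -> R -> R[i],
     (forall mu' a' : R, 0 <= mu' -> 0 < a' -> R_is_function mu' nu ->
        inverse_laplace (R_symbol mu' nu a') (Rf mu' a')) ->
     forall t : R, 0 < t ->
       cintegrable `[a, +oo[ (fun a' => Rf mu a' t) /\
       Rf (mu + nu) a t = cintegral `[a, +oo[ (fun a' => Rf mu a' t))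
  /\
  (* R_(0,1) is not a function: identity of distributions on t > 0 *)
  (nu = 1 -> mu = 0 ->
   forall Rd : R -> R -> (R -> R) -> R[i],
     (forall mu' a' : R, 0 <= mu' -> 0 < a' ->
        inverse_laplace_distr (R_symbol mu' nu a') (Rd mu' a')) ->
     forall phi : R -> R, test_function_pos phi ->
       cintegrable `[a, +oo[ (fun a' => Rd mu a' phi) /\
       Rd (mu + nu) a phi = cintegral `[a, +oo[ (fun a' => Rd mu a' phi)).
Proof.
split=> [Rfun Rf H t t0|nu1 mu0 Rd H phi tphi].
  have [nu1|nu1] := ltP nu 1.
    apply: (R_integral_nu_lt1 hnu0 nu1 hmu ha) => // m b m0 b0.
    by apply: H => //; left.
  have nuE : nu = 1 by apply/eqP; rewrite eq_le hnu1.
  subst nu; have mu0 : 0 < mu by case: Rfun; rewrite ?ltxx.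
  exact: R_integral_nu1.
subst nu mu; rewrite add0r.
exact: R_distr_integral.
Qed.
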